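(* Let $L_\infty\subset\mathbb{R}P^2$ be a line and let $C\subset\mathbb{R}P^2$ be a (generic) curve that is generically transverse to $L_\infty$, with $n(C)$ nodes, $i(C)$ flexes and $a=|C\cap L_\infty|$ intersection points with $L_\infty$. Then the signed count $\sigma(C)$ of bitangents of $C$ (with Fabricius-Bjerre signs taken in the affine chart $\mathbb{R}P^2\setminus L_\infty$) satisfies $$\sigma(C)=n(C)+\frac{i(C)}{2}+\frac{a(a-2)}{2}-\sum_{T\in\mathscr{T}_\infty(C)}\left(|C\cap T|-1\right).$$
   Context: **Curves.** A *curve* in $\mathbb{R}P^2$ is a closed immersed $C^1$ curve (the image of an immersion of a finite disjoint union of circles, called its normalization; it may have several components) which is the union of finitely many strictly convex arcs. A *flex* is a point where the curve passes through (crosses) its tangent. A *node* is a double point (self-intersection). A *bitangent* is a line tangent to the curve at two points. There are finitely many flexes, nodes and bitangents. All curves are assumed *generic*: double points are simple (exactly two branches, crossing transversally), no tangent at a flex is tangent to the curve elsewhere, and every bitangent has exactly two tangency points. **Transversality to $L_\infty$.** $C$ is *generically transverse* to the line $L_\infty$ if no line passing through a point of $C\cap L_\infty$ is a bitangent of $C$ or a tangent at a flex of $C$, and $L_\infty$ is transverse to the union of $C$, its bitangents and its tangents at flexes (in particular $L_\infty$ is not tangent to $C$ and does not pass through a node of $C$). **Notation.** $\mathscr{T}_\infty(C)$ is the set of tangent lines to $C$ at the points of $C\cap L_\infty$. For a line $L$, $|C\cap L|$ is the number of intersection points of $C$ with $L$, without intersection multiplicity (a tangency point counts once), points being counted on the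 normalization of $C$ (so a node of $C$ lying on $L$ counts twice, once per branch). **Signs.** In the affine chart $\mathbb{R}P^2\setminus L_\infty\cong\mathbb{R}^2$, a bitangent $D$ has sign $+1$ (exterior, type $T$) if the arcs of $C$ near the two tangency points lie on the same side of $D$, and sign $-1$ (interior, type $S$) if they lie on opposite sides of $D$. The number $\sigma(C)$ is the sum of the signs of all bitangents of $C$. *)

(* Defs.v *)
From mathcomp Require Import all_boot all_order all_algebra finmap.
From mathcomp Require Import all_classical all_reals all_analysis.

Set Implicit Arguments.
Unset Strict Implicit.
Unset Printing Implicit Defensive.

Import Order.TTheory GRing.Theory Num.Theory.
Import numFieldNormedType.Exports.

Local Open Scope classical_set_scope.
Local Open Scope ring_scope.

(* A point (resp. a line) of the real projective plane is a subspace of R^3 of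
   dimension 1 (resp. 2); incidence is inclusion of subspaces. *)
Notation subspace3 R := {vspace 'rV[R]_3}.

(* A linear form on R^3 is given by a column vector. *)
Definition form (R : realType) (l : 'cV[R]_3) (v : 'rV[R]_3) : R :=
  (v *m l) ord0 ord0.

Definition equation (R : realType) (L : subspace3 R) (l : 'cV[R]_3) : Prop :=
  forall v, (v \in L) = (form l v == 0).

(* If l and m are equations of lines L and D, then m / l is an affine function
   on the affine chart complementary to L, vanishing on D: its sign tells the
   two sides of D in that chart.  It depends only on the projective point
   spanned by v. *)
Definition side (R : realType) (l m : 'cV[R]_3) (v : 'rV[R]_3) : R :=
  form m v / form l v.

Definition lift_point (R : realType) (g : R -> 'rV[R]_3) (t : R) :
  subspace3 R := <[g t]>%VS.

Definition lift_tangent (R : realType) (g : R -> 'rV[R]_3) (t : R) :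
  subspace3 R := (<[g t]> + <[derive1 g t]>)%VS.

(* In some affine chart containing it, the arc g([s, t]) lies strictly on one
   side of each of its tangents, apart from the tangency point. *)
Definition strictly_convex_arc (R : realType) (g : R -> 'rV[R]_3) (s t : R) :
  Prop :=
  exists l : 'cV[R]_3,
    (forall u, s <= u <= t -> form l (g u) != 0) /\
    (forall u, s <= u <= t ->
       exists2 m, equation (lift_tangent g u) m &
         forall w, s <= w <= t -> w != u -> 0 < side l m (g w)).

(* Each component is an immersion of the circle R/Z in the projective plane,
   given by a global lift to R^3 \ {0} along R -> R/Z; a lift always exists, but
   it need not be periodic (e.g. for a one-sided component).  The map induced
   in the projective plane is an immersion iff the lift and its derivative are
   linearly independent everywhere. *)
Record curve (R : realType) := Curve {
  ncomp : nat;
  lift : 'I_ncomp -> R -> 'rV[R]_3;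
  lift_derivable : forall i t, derivable (lift i) t 1;
  lift_C1 : forall i, continuous (derive1 (lift i));
  lift_immersion : forall i t, free [:: lift i t; derive1 (lift i) t];
  lift_closed : forall i t, lift_point (lift i) (t + 1) = lift_point (lift i) t;
  lift_arcs : forall i, exists (k : nat) (tau : nat -> R),
    [/\ tau 0%N = 0, tau k = 1 &
        forall j, (j < k)%N ->
          tau j < tau j.+1 /\ strictly_convex_arc (lift i) (tau j) (tau j.+1)]
}.

Section Curve.
Variables (R : realType) (C : curve R).

Definition normalization : set ('I_(ncomp C) * R) :=
  [set x | 0 <= x.2 < 1].

Definition point (x : 'I_(ncomp C) * R) : subspace3 R :=
  lift_point (lift x.1) x.2.

Definition tangent (x : 'I_(ncomp C) * R) : subspace3 R :=
  lift_tangent (lift x.1) x.2.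

(* The sign of form m along the lift tells the local side of the tangent, since
   the lift is continuous and nonzero; the two directions of crossing are
   exchanged by m |-> - m. *)
Definition is_flex (x : 'I_(ncomp C) * R) : Prop :=
  exists2 m, equation (tangent x) m &
    (\forall u \near x.2^'-, form m (lift x.1 u) < 0) /\
    (\forall u \near x.2^'+, 0 < form m (lift x.1 u)).

Definition flexes : set ('I_(ncomp C) * R) :=
  [set x | normalization x /\ is_flex x].

Definition nodes : set (subspace3 R) :=
  [set P | exists x y, [/\ normalization x, normalization y, x <> y,
                           point x = P & point y = P]].

Definition bitangents : set (subspace3 R) :=
  [set D | exists x y, [/\ normalization x, normalization y, x <> y,
                           tangent x = D & tangent y = D]].

Definition flex_tangents : set (subspace3 R) := tangent @` flexes.

Definition meet (L : subspace3 R) : set ('I_(ncomp C) * R) :=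
  [set x | normalization x /\ (point x <= L)%VS].

Definition nmeet (L : subspace3 R) : nat := #|` fset_set (meet L)|.

Record generic : Prop := Generic {
  finite_flexes : finite_set flexes;
  finite_nodes : finite_set nodes;
  finite_bitangents : finite_set bitangents;
  node_transverse : forall x y, normalization x -> normalization y -> x <> y ->
    point x = point y -> tangent x <> tangent y;
  node_double : forall x y z,
    normalization x -> normalization y -> normalization z ->
    x <> y -> y <> z -> x <> z -> ~ (point x = point y /\ point y = point z);
  flex_tangent_once : forall x y, flexes x -> normalization y -> x <> y ->
    tangent y <> tangent x;
  bitangent_twice : forall x y z,
    normalization x -> normalization y -> normalization z ->
    x <> y -> y <> z -> x <> z ->
    ~ (tangent x = tangent y /\ tangent y = tangent z)
}.

(* Transversality to the union of C and of finitely many lines excludes the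
   crossing points of that union, exactly as it excludes the nodes of C; the
   crossings of C with those lines are excluded by the first clause. *)
Record generically_transverse (Linf : subspace3 R) : Prop :=
  GenericallyTransverse {
  meet_special : forall x D, meet Linf x -> (bitangents `|` flex_tangents) D ->
    ~ (point x <= D)%VS;
  not_tangent : forall x, normalization x -> tangent x <> Linf;
  not_node : forall P, nodes P -> ~ (P <= Linf)%VS;
  not_special : forall D, (bitangents `|` flex_tangents) D -> D <> Linf;
  not_special_crossing : forall D D',
    (bitangents `|` flex_tangents) D -> (bitangents `|` flex_tangents) D' ->
    D <> D' -> (D :&: D' :&: Linf = 0)%VS
}.

Definition tangents_at (Linf : subspace3 R) : set (subspace3 R) :=
  tangent @` meet Linf.

Definition exterior_bitangent (Linf D : subspace3 R) : Prop :=
  exists l m, [/\ equation Linf l, equation D m &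
    forall x, normalization x -> tangent x = D ->
      \forall u \near x.2^', 0 < side l m (lift x.1 u)].

Definition interior_bitangent (Linf D : subspace3 R) : Prop :=
  exists l m, [/\ equation Linf l, equation D m &
    exists x y, [/\ normalization x, normalization y,
      tangent x = D, tangent y = D &
      (\forall u \near x.2^', 0 < side l m (lift x.1 u)) /\
      (\forall u \near y.2^', side l m (lift y.1 u) < 0)]].

(* For generic data, exactly one of the first two cases occurs. *)
Definition bitangent_sign (Linf D : subspace3 R) : int :=
  if `[< exterior_bitangent Linf D >] then 1
  else if `[< interior_bitangent Linf D >] then -1
  else 0.

Definition sigma (Linf : subspace3 R) : int :=
  \sum_(D \in bitangents) bitangent_sign Linf D.

End Curve.

Arguments normalization {R} C.
Arguments flexes {R} C.
Arguments meet {R} C L.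

(* Main.v *)
From HB Require Import structures.
From mathcomp Require Import all_boot all_order all_algebra finmap.
From mathcomp Require Import all_classical all_reals all_analysis.
From mathcomp Require Import zify ring lra.
Require Import Defs.

(** The proof counts, as a point [x] runs along the curve, the points of the curve
    on the tangent at [x], in the affine chart where the line at infinity is
    removed: a point of the tangent counts 1 if it is ahead of [x] in the
    direction of motion and -1 if it is behind ([weight]).  This count is a step
    function of [x] ([count_limit]), and on each closed component its jumps add up
    to 0 ([step_circle]).  Evaluating the jumps gives the formula.

    The tangent at [x] turns around [x], and all its points on one side of [x] move to
    one side of the curve ([rotation], [sweep_sign]).  Hence:
    - at a flex, the point where the tangent meets the curve again passes from
      ahead to behind: jump -2 ([count_flex]);
    - at a node, the other branch passes from ahead to behind: jump -2, for each
      of the two branches ([count_node]);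
    - at a tangency point [x] of a bitangent, two points near the other tangency
      point [y] appear or disappear.  Whether they are ahead or behind, and whether
      they appear or disappear, combine into a jump of twice the sign of the
      bitangent, for each of its two tangency points ([count_bitangent],
      [bitangent_signE]);
    - when [x] crosses the line at infinity, it comes back from the other end of its
      asymptote [T], and each of the |C meet T| - 1 other points of [T] passes from
      behind to ahead: jump 2 ([count_source_infinity]);
    - when the tangent at [x] passes through a point at infinity [y], other than [x],
      the point near [y] passes from one end of the asymptote of [y] to the other:
      the jump is 2 or -2 ([count_target_infinity]).

    The sum of the last jumps is not visible on the configuration.  It is
    computed, for each [y] at infinity, by a second step function of [x], the height
    ([height_step]): with affine coordinates in which the asymptote of [y] is the
    x-axis, it is the sign of y y' along the curve, up to normalization.  It has the
    opposite jump at the tangents through [y] ([height_fold]), and its other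
    jumps are 2 at each point [x] of the asymptote of [y] ([height_cross]), including
    [y] itself ([height_self]), and -2 at each other point at infinity
    ([height_infinity]).  Its jumps also add up to 0.

    Adding the count and the heights of all the points at infinity, the unknown signs
    disappear.  With S the sum of the |C meet T| - 1 over the tangents at infinity, the
    sum of all the jumps ([total_jump_sum], [sum_jump_table]) is
    - 2 i - 4 n + 4 sigma + 2 S + 2 S + 2 a - 2 a (a - 1) = 0,
    which is the formula.  Genericity and transversality ensure that at most one
    of these events relates a given ordered pair of points ([local_data_exists]). *)

Set Implicit Arguments.
Unset Strict Implicit.
Unset Printing Implicit Defensive.

Import Order.TTheory GRing.Theory Num.Theory.
Import numFieldNormedType.Exports.

Local Open Scope classical_set_scope.
Local Open Scope ring_scope.

(** * Determinants and linear forms on R^3 *)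

Definition ord3_0 : 'I_3 := @Ordinal 3 0 isT.
Definition ord3_1 : 'I_3 := @Ordinal 3 1 isT.
Definition ord3_2 : 'I_3 := @Ordinal 3 2 isT.
Local Notation "v `0" := (v ord0 ord3_0) (at level 8, format "v `0").
Local Notation "v `1" := (v ord0 ord3_1) (at level 8, format "v `1").
Local Notation "v `2" := (v ord0 ord3_2) (at level 8, format "v `2").

Definition mkcol (R : realType) (x y z : R) : 'cV[R]_3 :=
  \col_i (if i == ord3_0 then x else if i == ord3_1 then y else z).

HB.lock Definition cross (R : realType) (u v : 'rV[R]_3) : 'cV[R]_3 :=
  mkcol (u`1 * v`2 - u`2 * v`1) (u`2 * v`0 - u`0 * v`2) (u`0 * v`1 - u`1 * v`0).

HB.lock Definition det3 (R : realType) (u v w : 'rV[R]_3) : R :=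
  form (cross u v) w.

HB.lock Definition dot (R : realType) (u v : 'rV[R]_3) : R :=
  u`0 * v`0 + u`1 * v`1 + u`2 * v`2.

(** [form (beta_form a b) v] is the coefficient of [b] in [v = x a + y b], up to
    the factor |a x b|^2, positive when [a] and [b] are independent. *)
HB.lock Definition beta_form (R : realType) (a b : 'rV[R]_3) : 'cV[R]_3 :=
  mkcol (dot a a * b`0 - dot a b * a`0) (dot a a * b`1 - dot a b * a`1)
        (dot a a * b`2 - dot a b * a`2).

Section LinearAlgebra.
Variable R : realType.
Implicit Types (u v w a b c : 'rV[R]_3) (l : 'cV[R]_3).

Lemma forall_ord3 (P : 'I_3 -> Prop) : P ord3_0 -> P ord3_1 -> P ord3_2 ->
  forall i, P i.
Proof.
by move=> P0 P1 P2 [[|[|[|//]]] hi];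
  [rewrite (_ : Ordinal hi = ord3_0)|rewrite (_ : Ordinal hi = ord3_1)
  |rewrite (_ : Ordinal hi = ord3_2)] => //; exact: val_inj.
Qed.

Lemma formE l v : form l v =
  v`0 * l ord3_0 ord0 + v`1 * l ord3_1 ord0 + v`2 * l ord3_2 ord0.
Proof.
rewrite /form mxE !big_ord_recr big_ord0 /= add0r.
by congr (_ + _ + _); congr (_ * _); congr (fun_of_matrix _ _ _); exact: val_inj.
Qed.

Lemma formD l u v : form l (u + v) = form l u + form l v.
Proof. by rewrite /form mulmxDl mxE. Qed.

Lemma formZ l (k : R) v : form l (k *: v) = k * form l v.
Proof. by rewrite /form -scalemxAl mxE. Qed.

Lemma formN l v : form l (- v) = - form l v.
Proof. by rewrite /form mulNmx mxE. Qed.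

Lemma formB l u v : form l (u - v) = form l u - form l v.
Proof. by rewrite formD formN. Qed.

Lemma det3_form u v w : det3 u v w = form (cross u v) w.
Proof. by rewrite unlock. Qed.

Lemma crossE u v : cross u v =
  mkcol (u`1 * v`2 - u`2 * v`1) (u`2 * v`0 - u`0 * v`2) (u`0 * v`1 - u`1 * v`0).
Proof. by rewrite unlock. Qed.

Lemma det3E u v w : det3 u v w =
  w`0 * (u`1 * v`2 - u`2 * v`1) + w`1 * (u`2 * v`0 - u`0 * v`2)
  + w`2 * (u`0 * v`1 - u`1 * v`0).
Proof. by rewrite det3_form crossE formE !mxE. Qed.

Lemma dotE u v : dot u v = u`0 * v`0 + u`1 * v`1 + u`2 * v`2.
Proof. by rewrite unlock. Qed.

Lemma rV3P u v : u`0 = v`0 -> u`1 = v`1 -> u`2 = v`2 -> u = v.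
Proof.
move=> h0 h1 h2; apply/rowP; exact: forall_ord3.
Qed.

Lemma det3_rot u v w : det3 v w u = det3 u v w.
Proof. rewrite !det3E; ring. Qed.

Lemma det3_swap u v w : det3 u w v = - det3 u v w.
Proof. rewrite !det3E; ring. Qed.

Lemma det3_uuv u v : det3 u u v = 0.
Proof. rewrite !det3E; ring. Qed.

Lemma det3_uvu u v : det3 u v u = 0.
Proof. rewrite !det3E; ring. Qed.

Lemma det3_uvv u v : det3 u v v = 0.
Proof. rewrite !det3E; ring. Qed.

Lemma det3D u v w w' : det3 u v (w + w') = det3 u v w + det3 u v w'.
Proof. by rewrite !det3_form formD. Qed.

Lemma det3Z u v k w : det3 u v (k *: w) = k * det3 u v w.
Proof. by rewrite !det3_form formZ. Qed.

Lemma det3Dm u v v' w : det3 u (v + v') w = det3 u v w + det3 u v' w.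
Proof. rewrite !det3E !mxE; ring. Qed.

Lemma det3Zm u v k w : det3 u (k *: v) w = k * det3 u v w.
Proof. rewrite !det3E !mxE; ring. Qed.

Lemma det3Dl u u' v w : det3 (u + u') v w = det3 u v w + det3 u' v w.
Proof. rewrite !det3E !mxE; ring. Qed.

Lemma det3Zl u v k w : det3 (k *: u) v w = k * det3 u v w.
Proof. rewrite !det3E !mxE; ring. Qed.

Lemma cramer a b c v : det3 a b c *: v =
  det3 v b c *: a + det3 a v c *: b + det3 a b v *: c.
Proof. apply: rV3P; rewrite !mxE !det3E; ring. Qed.

Lemma cramer_div a b c v : det3 a b c != 0 -> v =
  (det3 v b c / det3 a b c) *: a + (det3 a v c / det3 a b c) *: b
  + (det3 a b v / det3 a b c) *: c.
Proof.
move=> h; apply: (@scalerI _ _ (det3 a b c)) => //.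
rewrite {1}cramer !scalerDr !scalerA.
by congr (_ *: _ + _ *: _ + _ *: _); rewrite mulrCA divff ?mulr1.
Qed.

Lemma lagrange a b : dot a a * dot b b - dot a b ^+ 2 =
  cross a b ord3_0 ord0 ^+ 2 + cross a b ord3_1 ord0 ^+ 2 + cross a b ord3_2 ord0 ^+ 2.
Proof. rewrite crossE !mxE /= !dotE; ring. Qed.

Lemma beta_formE a b v : form (beta_form a b) v = dot a a * dot b v - dot a b * dot a v.
Proof. rewrite formE unlock !mxE /= !dotE; ring. Qed.

Lemma beta_form_l a b : form (beta_form a b) a = 0.
Proof. rewrite beta_formE !dotE; ring. Qed.

(** The normal direction of the plane completes a free pair to a direct basis; the
    decompositions below in a basis [g s, g' s, n] use such a vector. *)
Lemma cross_neq0 a b : free [:: a; b] -> exists n, 0 < det3 a b n.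
Proof.
move=> fab; suff cN0 : cross a b != 0.
  have tE i : (cross a b)^T ord0 i = cross a b i ord0 by rewrite mxE.
  exists (cross a b)^T; rewrite det3_form formE !tE -!expr2.
  rewrite lt_neqAle eq_sym !addr_ge0 ?sqr_ge0// andbT.
  apply: contra cN0; rewrite paddr_eq0 ?addr_ge0 ?sqr_ge0// paddr_eq0 ?sqr_ge0// !sqrf_eq0.
  case/andP => /andP[/eqP h0 /eqP h1] /eqP h2.
  by apply/eqP/colP; apply: forall_ord3; rewrite [RHS]mxE.
apply/eqP => h0; move: fab; rewrite free_cons span_seq1 seq1_free => /andP[+ bN0].
move=> /negP; apply.
have key (i j : 'I_3) : a ord0 i * b ord0 j = a ord0 j * b ord0 i.
  have e0 : cross a b ord3_0 ord0 = 0 by rewrite h0 mxE.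
  have e1 : cross a b ord3_1 ord0 = 0 by rewrite h0 mxE.
  have e2 : cross a b ord3_2 ord0 = 0 by rewrite h0 mxE.
  rewrite crossE !mxE /= in e0 e1 e2.
  move: i; apply: forall_ord3; move: j; apply: forall_ord3 => //; lra.
have [j bj] : exists j, b ord0 j != 0.
  apply/not_existsP => hb; move/negP: bN0; apply; apply/eqP/rowP => j.
  by rewrite mxE; have /negP := hb j; rewrite negbK => /eqP.
apply/vlineP; exists (a ord0 j / b ord0 j); apply/rowP => i; rewrite mxE.
by rewrite mulrAC -key mulfK.
Qed.

Lemma beta_form_r a b : free [:: a; b] -> 0 < form (beta_form a b) b.
Proof.
move=> fab; rewrite beta_formE -expr2 lagrange.
have [n hn] := cross_neq0 fab; rewrite lt_neqAle eq_sym !addr_ge0 ?sqr_ge0// andbT.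
apply/eqP => /eqP; rewrite paddr_eq0 ?addr_ge0 ?sqr_ge0// paddr_eq0 ?sqr_ge0// !sqrf_eq0.
case/andP => /andP[/eqP h0 /eqP h1] /eqP h2.
by move: hn; rewrite det3_form formE h0 h1 h2 !mulr0 !addr0 ltxx.
Qed.

Lemma plane_coord a b v : free [:: a; b] -> det3 a b v = 0 ->
  exists x y, v = x *: a + y *: b.
Proof.
move=> /cross_neq0[n hn] h0.
exists (det3 v b n / det3 a b n), (det3 a v n / det3 a b n).
by rewrite {1}(@cramer_div a b n v) ?lt0r_neq0// h0 mul0r scale0r addr0.
Qed.

Lemma beta_form_comb a b x y :
  form (beta_form a b) (x *: a + y *: b) = y * form (beta_form a b) b.
Proof. by rewrite formD !formZ beta_form_l mulr0 add0r. Qed.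

Lemma dot_gt0 a : a != 0 -> 0 < dot a a.
Proof.
move=> aN0; rewrite lt_neqAle eq_sym !dotE -!expr2 !addr_ge0 ?sqr_ge0// andbT.
apply: contra aN0; rewrite paddr_eq0 ?addr_ge0 ?sqr_ge0// paddr_eq0 ?sqr_ge0// !sqrf_eq0.
case/andP => /andP[/eqP h0 /eqP h1] /eqP h2; apply/eqP/rV3P; rewrite mxE //.
Qed.

Lemma formZl l (k : R) v : form (k *: l) v = k * form l v.
Proof. by rewrite !formE !mxE; ring. Qed.

End LinearAlgebra.

(** * Lifts: limits and the mean value theorem along linear forms *)

Section Calculus.
Variable R : realType.

Record regular (g : R -> 'rV[R]_3) : Prop := Regular {
  regular_derivable : forall t, derivable g t 1;
  regular_C1 : continuous (derive1 g);
  regular_free : forall t, free [:: g t; derive1 g t] }.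

Lemma is_derive_form l (g : R -> 'rV[R]_3) (t : R) : derivable g t 1 ->
  is_derive t 1 (fun u => form l (g u)) (form l (derive1 g t)).
Proof.
move=> dg.
have dc i : is_derive t 1 (fun u => g u ord0 i) (derive1 g t ord0 i).
  have /derivable_mxP/(_ ord0 i) di := dg.
  by rewrite derive1E derive_mx// mxE; exact: derivableP.
have -> : (fun u => form l (g u)) =
    l ord3_0 ord0 \*: (fun u => g u ord0 ord3_0) +
    l ord3_1 ord0 \*: (fun u => g u ord0 ord3_1) +
    l ord3_2 ord0 \*: (fun u => g u ord0 ord3_2).
  by apply/funext => u; rewrite formE /= !(mulrC (g u _ _)).
rewrite formE !(mulrC (derive1 g t _ _)).
by apply: is_deriveD.
Qed.

Lemma regular_continuous g : regular g -> continuous g.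
Proof.
move=> rg t; apply: differentiable_continuous; apply/derivable1_diffP.
exact: regular_derivable.
Qed.

Section Limits.
Variables (T : Type) (F : set_system T) (FF : Filter F).
Implicit Types (f : T -> 'rV[R]_3) (a b c : 'rV[R]_3).

Lemma cvg_coord f a i : f @ F --> a -> (fun x => f x ord0 i) @ F --> a ord0 i.
Proof. by move=> fa; exact: (cvg_comp _ _ fa (@coord_continuous _ _ _ _ _ _)). Qed.

Lemma cvg_det3 f1 f2 f3 a b c : f1 @ F --> a -> f2 @ F --> b -> f3 @ F --> c ->
  (fun x => det3 (f1 x) (f2 x) (f3 x)) @ F --> det3 a b c.
Proof.
move=> ha hb hc; under eq_fun do rewrite det3E; rewrite det3E.
by apply: cvgD; first apply: cvgD; (apply: cvgM; first exact: cvg_coord);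
  apply: cvgB; apply: cvgM; exact: cvg_coord.
Qed.

Lemma cvg_form l f a : f @ F --> a -> (fun x => form l (f x)) @ F --> form l a.
Proof.
move=> ha; under eq_fun do rewrite formE; rewrite formE.
by apply: cvgD; first apply: cvgD; (apply: cvgM; [exact: cvg_coord|exact: cvg_cst]).
Qed.

Lemma cvg_beta f1 f2 f3 a b c : f1 @ F --> a -> f2 @ F --> b -> f3 @ F --> c ->
  (fun x => form (beta_form (f1 x) (f2 x)) (f3 x)) @ F --> form (beta_form a b) c.
Proof.
move=> ha hb hc; under eq_fun do rewrite beta_formE !dotE; rewrite beta_formE !dotE.
by apply: cvgB; apply: cvgM; apply: cvgD; try apply: cvgD; apply: cvgM; exact: cvg_coord.
Qed.

Lemma cvg_sgz (f : T -> R) (a : R) : a != 0 -> f @ F --> a ->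
  \forall x \near F, sgz (f x) = sgz a.
Proof.
rewrite neq_lt => /orP[a0|a0] fa.
- by near=> x; rewrite !ltr0_sgz//; near: x; exact: cvgr_lt fa _ a0.
- by near=> x; rewrite !gtr0_sgz//; near: x; exact: cvgr_gt fa _ a0.
Unshelve. all: by end_near. Qed.

End Limits.

Lemma near_ball (P : R -> Prop) (s0 : R) : (\forall s \near s0, P s) <->
  exists2 d, 0 < d & forall s, `|s - s0| < d -> P s.
Proof.
split => [/nbhs_ballP[d /= d0 hd]|[d d0 hd]].
  by exists d => // s hs; apply: hd; rewrite /ball /= distrC.
by apply/nbhs_ballP; exists d => // s; rewrite /ball /= distrC; exact: hd.
Qed.

Lemma near_ball2 (P : R -> R -> Prop) (s0 t0 : R) :
  (\forall s \near s0 & t \near t0, P s t) ->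
  exists2 d, 0 < d & forall s t, `|s - s0| < d -> `|t - t0| < d -> P s t.
Proof.
case=> -[A B] /= [/near_ball[d1 d10 h1] /near_ball[d2 d20 h2]] h.
exists (Num.min d1 d2); first by rewrite lt_min d10.
by move=> s t; rewrite !lt_min => /andP[s1 s2] /andP[t1 t2]; apply: (h (s, t)); split;
  [exact: h1|exact: h2].
Qed.

Lemma near_det3 (f1 f2 f3 : R -> 'rV[R]_3) (s0 z : R) :
  f1 @ s0 --> f1 s0 -> f2 @ s0 --> f2 s0 -> f3 @ s0 --> f3 s0 ->
  z < det3 (f1 s0) (f2 s0) (f3 s0) ->
  \forall s \near s0, z < det3 (f1 s) (f2 s) (f3 s).
Proof. by move=> h1 h2 h3 hz; exact: (cvgr_gt _ (cvg_det3 _ h1 h2 h3) _ hz). Qed.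

Lemma cvg_const (v : 'rV[R]_3) (s0 : R) : (fun=> v) @ s0 --> v.
Proof. exact: cvg_cst. Qed.

Lemma near_right (P : R -> Prop) (s0 : R) : (\forall s \near s0^'+, P s) <->
  exists2 d, 0 < d & forall s, s0 < s -> s < s0 + d -> P s.
Proof.
split => [/near_ball[d d0 h]|[d d0 h]].
  exists d => // s h1 h2; apply: h => //.
  by rewrite ger0_norm ?subr_ge0 ?ltW// ltrBlDl.
apply/near_ball; exists d => // s h1 h2; apply: h => //.
by move: h1; rewrite ltr_norml => /andP[_]; rewrite ltrBlDl.
Qed.

Lemma near_left (P : R -> Prop) (s0 : R) : (\forall s \near s0^'-, P s) <->
  exists2 d, 0 < d & forall s, s0 - d < s -> s < s0 -> P s.
Proof.
split => [/near_ball[d d0 h]|[d d0 h]].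
  exists d => // s h1 h2; apply: h => //.
  by rewrite ltr0_norm ?subr_lt0//; lra.
apply/near_ball; exists d => // s h1 h2; apply: h => //.
by move: h1; rewrite ltr_norml => /andP[+ _]; lra.
Qed.

Lemma continuous_const_sign (f : R -> R) (fc : continuous f) a b : a <= b ->
  (forall u, a <= u <= b -> f u != 0) -> 0 < f a * f b.
Proof.
move=> ab h; rewrite ltNge; apply/negP => fab.
have [||c] := @IVT R f a b 0 ab.
- exact: continuous_subspaceT.
- rewrite ge_min le_max; have [fa|fa|fa] := ltgtP (f a) 0; last by [].
    by apply/orP; right; rewrite leNgt; apply/negP => fb; nra.
  by rewrite andbT; apply/orP; right; rewrite leNgt; apply/negP => fb; nra.
rewrite in_itv /= => /h; by move=> /negP + /eqP.
Qed.

Section Form.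
Variables (g : R -> 'rV[R]_3) (rg : regular g) (l : 'cV[R]_3).

Lemma form_continuous : continuous (fun t => form l (g t)).
Proof. by move=> t; apply: cvg_form; exact: regular_continuous. Qed.

Lemma form_increasing a b : a < b ->
  (forall u, a < u < b -> 0 < form l (derive1 g u)) -> form l (g a) < form l (g b).
Proof.
move=> ab h.
have [||c cab e] := @MVT R (fun t => form l (g t)) (fun t => form l (derive1 g t)) a b ab.
- by move=> x _; apply: is_derive_form; exact: regular_derivable.
- by apply: continuous_subspaceT; exact: form_continuous.
rewrite -subr_gt0 e mulr_gt0 ?subr_gt0//; apply: h.
by move: cab; rewrite in_itv.
Qed.

Lemma form_IVT a b : a < b -> form l (g a) * form l (g b) < 0 ->
  exists2 c, a < c < b & form l (g c) = 0.
Proof.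
move=> ab hab.
have [||c] := @IVT R (fun t => form l (g t)) a b 0 (ltW ab).
- by apply: continuous_subspaceT; exact: form_continuous.
- rewrite ge_min le_max; have [h|h] := leP (form l (g a)) 0.
    by apply/orP; right; rewrite leNgt; apply/negP => hb; nra.
  by rewrite (ltW h) andbT; apply/orP; right; rewrite leNgt; apply/negP => hb; nra.
rewrite in_itv /= => /andP[ac cb] e; exists c => //.
rewrite !lt_neqAle ac cb !andbT; apply/andP; split; apply/eqP => E; move: hab.
  by rewrite E e mul0r ltxx.
by rewrite -E e mulr0 ltxx.
Qed.

Lemma form_const_sign a b : a <= b -> (forall u, a <= u <= b -> form l (g u) != 0) ->
  0 < form l (g a) * form l (g b).
Proof. exact: (continuous_const_sign form_continuous). Qed.

End Form.
End Calculus.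

(** * Convex arcs *)

(** [tdet g s] is an equation of the tangent to the arc [g] at the parameter [s]. *)
HB.lock Definition tdet (R : realType) (g : R -> 'rV[R]_3) (s : R) (v : 'rV[R]_3) : R :=
  det3 (g s) (derive1 g s) v.

Lemma tdetE (R : realType) (g : R -> 'rV[R]_3) s v :
  tdet g s v = det3 (g s) (derive1 g s) v.
Proof. by rewrite unlock. Qed.

Section ConvexArcs.
Variable R : realType.
Implicit Types (l : 'cV[R]_3) (v : 'rV[R]_3).

Lemma tdet_same (g : R -> 'rV[R]_3) s : tdet g s (g s) = 0.
Proof. by rewrite tdetE det3_uvu. Qed.

(** A projective form of strict convexity, in terms of the lift only: no affine
    chart occurs, and the sign of [e] tells to which side the arc curves. *)
Definition convex_on (g : R -> 'rV[R]_3) (e a b : R) : Prop := forall u w,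
  a <= u <= b -> a <= w <= b -> u != w -> 0 < e * tdet g u (g w).

Lemma convex_on_sub g e a b a' b' : a <= a' -> b' <= b ->
  convex_on g e a b -> convex_on g e a' b'.
Proof.
move=> aa bb h u w /andP[? ?] /andP[? ?]; apply: h; apply/andP; split; lra.
Qed.

Section Regular.
Variables (g : R -> 'rV[R]_3) (rg : regular g).

Lemma tdet_continuous v : continuous (fun s => tdet g s v).
Proof.
move=> s; under eq_fun do rewrite tdetE; apply: cvg_det3; [exact: regular_continuous|exact: regular_C1|exact: cvg_cst].
Qed.

(** If three points of the arc were collinear, a linear relation between them
    would give, at each of the three tangents, a relation between two values of
    the equation of that tangent. These values all have the sign of [e], so any two
    of the three coefficients would have opposite signs. *)
Lemma convex_det3_neq0 e a b x y z : convex_on g e a b ->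
  a <= x <= b -> a <= y <= b -> a <= z <= b -> x != y -> y != z -> x != z ->
  det3 (g x) (g y) (g z) != 0.
Proof.
move=> cv hx hy hz xy yz xz; apply/eqP => d0.
pose v := derive1 g x.
set p := det3 v (g y) (g z); set q := det3 (g x) v (g z); set r := det3 (g x) (g y) v.
have rel w : p * tdet g w (g x) + q * tdet g w (g y) + r * tdet g w (g z) = 0.
  by rewrite !tdetE -!det3Z -!det3D -cramer d0 scale0r -(scale0r 0) det3Z mul0r.
have rE : r = - tdet g x (g y) by rewrite /r tdetE det3_swap.
have := rel z; have := rel y; have := rel x.
rewrite !tdet_same !mulr0 add0r !addr0.
have h1 := cv _ _ hx hy xy; have h2 := cv _ _ hx hz xz.
have h3 : 0 < e * tdet g y (g x) by apply: cv => //; rewrite eq_sym.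
have h4 := cv _ _ hy hz yz.
have h5 : 0 < e * tdet g z (g x) by apply: cv => //; rewrite eq_sym.
have h6 : 0 < e * tdet g z (g y) by apply: cv => //; rewrite eq_sym.
move=> e1 e2 e3.
have f1 : q * (e * tdet g x (g y)) + r * (e * tdet g x (g z)) = 0.
  by rewrite !(mulrCA _ e) -mulrDr e1 mulr0.
have f2 : p * (e * tdet g y (g x)) + r * (e * tdet g y (g z)) = 0.
  by rewrite !(mulrCA _ e) -mulrDr e2 mulr0.
have f3 : p * (e * tdet g z (g x)) + q * (e * tdet g z (g y)) = 0.
  by rewrite !(mulrCA _ e) -mulrDr e3 mulr0.
have rN0 : r != 0 by rewrite rE oppr_eq0; apply/eqP => E; move: h1; rewrite E mulr0 ltxx.
clear -h1 h2 h3 h4 h5 h6 f1 f2 f3 rN0.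
move: h1 h2 h3 h4 h5 h6 f1 f2 f3.
set A := e * _; set B := e * _; set A' := e * _; set B' := e * _; set A'' := e * _; set B'' := e * _.
move=> h1 h2 h3 h4 h5 h6 f1 f2 f3.
have [r0|r0] : r < 0 \/ 0 < r by apply/orP; rewrite -neq_lt.
- have q0 : 0 < q by rewrite -(pmulr_lgt0 _ h1); have := nmulr_rlt0 B r0; rewrite h2; lra.
  have p0 : 0 < p by rewrite -(pmulr_lgt0 _ h3); have := nmulr_rlt0 B' r0; rewrite h4; lra.
  by have := mulr_gt0 p0 h5; have := mulr_gt0 q0 h6; lra.
- have q0 : q < 0 by rewrite -(pmulr_llt0 _ h1); have := mulr_gt0 r0 h2; lra.
  have p0 : p < 0 by rewrite -(pmulr_llt0 _ h3); have := mulr_gt0 r0 h4; lra.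
  by have := nmulr_rlt0 A'' p0; have := nmulr_rlt0 B'' q0; rewrite h5 h6; lra.
Qed.

(** The determinant vanishes when [z = y], and increases just after, its
    derivative there being the position of [g x] with respect to the tangent at
    [y]. By [convex_det3_neq0] it keeps its sign up to [z]. *)
Lemma convex_det3_gt0 e a b x y z : convex_on g e a b ->
  a <= x -> x < y -> y < z -> z <= b -> 0 < e * det3 (g x) (g y) (g z).
Proof.
move=> cv ax xy yz zb.
have ix : a <= x <= b by apply/andP; split; lra.
have iy : a <= y <= b by apply/andP; split; lra.
pose f w := e * det3 (g x) (g y) w.
have fE w : f w = form (e *: cross (g x) (g y)) w.
  by rewrite /f formZl det3_form.
have fy : 0 < f (derive1 g y).
  rewrite /f -det3_rot -tdetE; apply: (cv y x) => //; by rewrite gt_eqF.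
have [d d0 hd] : exists2 d, 0 < d & forall u, `|u - y| < d -> 0 < f (derive1 g u).
  apply/near_ball.
  have : (fun u => f (derive1 g u)) @ y --> f (derive1 g y).
    by under eq_fun do rewrite fE; rewrite fE; apply: cvg_form; exact: regular_C1.
  by move/cvgr_gt; apply.
pose c := Num.min z (y + d / 2).
have yc : y < c by rewrite lt_min yz /=; lra.
have cz : c <= z by rewrite ge_min lexx.
have cd : c <= y + d / 2 by rewrite ge_min lexx orbT.
have fc : 0 < f (g c).
  rewrite fE; suff : form (e *: cross (g x) (g y)) (g y) < form (e *: cross (g x) (g y)) (g c).
    by rewrite -!fE {1}/f det3_uvv mulr0.
  apply: form_increasing => // u /andP[yu uc]; rewrite -fE; apply: hd.
  by rewrite ger0_norm; lra.
have fN0 u : c <= u <= z -> form (e *: cross (g x) (g y)) (g u) != 0.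
  move=> /andP[cu uz]; rewrite -fE mulf_neq0//.
    by apply: contraTneq fy => e0; rewrite /f e0 mul0r ltxx.
  apply: (convex_det3_neq0 cv) => //; first by (apply/andP; split; lra).
  - by rewrite lt_eqF.
  - by rewrite lt_eqF//; lra.
  - by rewrite lt_eqF//; lra.
by have := form_const_sign rg cz fN0; rewrite -!fE pmulr_rgt0.
Qed.

Lemma form_three_zeros l (p q r : R) : det3 (g p) (g q) (g r) != 0 ->
  form l (g p) = 0 -> form l (g q) = 0 -> form l (g r) = 0 -> forall x, form l x = 0.
Proof.
move=> d0 hp hq hr x; rewrite (cramer_div x d0) !formD !formZ hp hq hr.
by rewrite !mulr0 !addr0.
Qed.

(** If a line that separates the ends of a convex arc met it in two points [u < w],
    it would also leave both ends on the same side, as [g b] is a positive multiple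
    of [g a] modulo [g u] and [g w]. *)
Lemma convex_line_once e a b l : a < b -> convex_on g e a b ->
  form l (g a) * form l (g b) < 0 ->
  exists2 c, a < c < b &
    form l (g c) = 0 /\ forall c', a <= c' <= b -> form l (g c') = 0 -> c' = c.
Proof.
move=> ab cv hab; have [c cab c0] := form_IVT rg ab hab.
have key u w : a < u -> u < w -> w < b -> form l (g u) = 0 -> form l (g w) = 0 -> False.
  move=> au uw wb hu hw.
  have d1 := convex_det3_gt0 cv (lexx a) au uw (ltW wb).
  have d2 := convex_det3_gt0 cv (ltW au) uw wb (lexx b).
  have d1N0 : det3 (g u) (g w) (g a) != 0.
    by rewrite det3_rot; apply: contraTneq d1 => ->; rewrite mulr0 ltxx.
  have := cramer (g u) (g w) (g a) (g b).
  move=> /(congr1 (form l)); rewrite !formD !formZ hu hw !mulr0 !add0r => E.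
  rewrite (det3_rot (g a)) in E.
  have : (e * det3 (g a) (g u) (g w)) * form l (g b) * form l (g a) =
         (e * det3 (g u) (g w) (g b)) * (form l (g a)) ^+ 2.
    by rewrite -(mulrA e) E; ring.
  have faN0 : form l (g a) != 0 by apply: contraTneq hab => ->; rewrite mul0r ltxx.
  have : 0 < (e * det3 (g u) (g w) (g b)) * (form l (g a)) ^+ 2.
    by rewrite mulr_gt0// lt_neqAle eq_sym sqr_ge0 sqrf_eq0 faN0.
  move=> P E'; move: P; rewrite -E' -mulrA pmulr_rgt0//.
  by rewrite mulrC ltNge ltW.
exists c => //; split=> // c' /andP[ac' c'b] c'0.
have aNc' : a < c'.
  by rewrite lt_neqAle ac' andbT; apply: contraTneq hab => ->; rewrite c'0 mul0r ltxx.
have c'Nb : c' < b.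
  by rewrite lt_neqAle c'b andbT; apply: contraTneq hab => <-; rewrite c'0 mulr0 ltxx.
move: cab => /andP[ac cb].
apply/eqP; rewrite eq_le !leNgt; apply/andP; split; apply/negP => lt.
  exact: (key c c').
exact: (key c' c).
Qed.

(** A line meets a convex arc in at most two points. *)
Lemma convex_line_finite e a b l v : convex_on g e a b -> form l v != 0 ->
  finite_set [set t | a <= t <= b /\ form l (g t) = 0].
Proof.
move=> cv lv; set A := [set t | _].
have three x y z : A x -> A y -> A z -> x != y -> y != z -> x != z -> False.
  move=> [hx x0] [hy y0] [hz z0] xy yz xz; move/negP: lv; apply; apply/eqP.
  by apply: (form_three_zeros (convex_det3_neq0 cv hx hy hz xy yz xz)).
have [[x [y [Ax Ay xy]]]|nxy] := pselect (exists x y, [/\ A x, A y & x != y]).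
  apply: (@sub_finite_set _ _ [set x; y]); last exact: finite_set2.
  move=> z Az /=; have [zx|zx] := eqVneq z x; first by left.
  have [zy|zy] := eqVneq z y; first by right.
  by case: (three x y z) => //; rewrite eq_sym.
have [[x Ax]|nx] := pselect (exists x, A x).
  apply: (@sub_finite_set _ _ [set x]); last exact: finite_set1.
  by move=> z Az /=; apply: contrapT => /eqP zx; apply: nxy; exists z, x.
suff -> : A = set0 by exact: finite_set0.
by apply/seteqP; split => // x Ax; apply: nx; exists x.
Qed.

End Regular.
End ConvexArcs.

(** * Convexity in a chart, and the change of lift along a closed component *)

Section Tangents.
Variable R : realType.
Implicit Types (v : 'rV[R]_3) (g : R -> 'rV[R]_3).

Lemma form_ext (u v : 'rV[R]_3) : (forall m, form m u = form m v) -> u = v.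
Proof.
move=> h; apply/rowP => i.
by have := h (delta_mx i ord0); rewrite /form -!colE !mxE.
Qed.

Lemma mem_tangent g t v : free [:: g t; derive1 g t] ->
  (v \in lift_tangent g t) = (tdet g t v == 0).
Proof.
move=> fg; apply/idP/eqP => [/memv_addP[_ /vlineP[x ->]] [_ /vlineP[y ->]] ->|].
  by rewrite tdetE det3D !det3Z det3_uvu det3_uvv !mulr0 addr0.
rewrite tdetE => /(plane_coord fg)[x [y ->]].
by rewrite memv_add// memvZ// memv_line.
Qed.

Lemma tangent_equation g t m : free [:: g t; derive1 g t] ->
  equation (lift_tangent g t) m ->
  exists2 c, c != 0 & forall v, form m v = c * tdet g t v.
Proof.
move=> fg em; have [n hn] := cross_neq0 fg.
have tn : tdet g t n != 0 by rewrite tdetE gt_eqF.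
have hz v : tdet g t v = 0 -> form m v = 0.
  by move=> h; apply/eqP; rewrite -em mem_tangent// h.
have mn : form m n != 0 by rewrite -em mem_tangent.
exists (form m n / tdet g t n) => [|v]; first by rewrite mulf_neq0// invr_eq0.
have dn : det3 (g t) (derive1 g t) n != 0 by rewrite gt_eqF.
rewrite {1}(cramer_div v dn) !formD !formZ.
rewrite (hz (g t)) ?tdet_same// (hz (derive1 g t)) ?tdetE ?det3_uvv//.
by rewrite !mulr0 !add0r mulrAC [RHS]mulrAC (mulrC (det3 _ _ v)).
Qed.

Section Regular.
Variables (g : R -> 'rV[R]_3) (rg : regular g).

(** The chart gives, for each tangent, a common sign for the points of the arc
    other than the tangency point. As [tdet g u (g w)] is also continuous in [u], this
    sign is the same for all the tangents. *)
Lemma arc_convex a b : a < b -> strictly_convex_arc g a b ->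
  exists e, convex_on g e a b.
Proof.
move=> ab [l [l0 arc]].
have H u w w' : a <= u <= b -> a <= w <= b -> a <= w' <= b -> w != u -> w' != u ->
    0 < tdet g u (g w) * tdet g u (g w').
  move=> hu hw hw' wu w'u; have [m em hm] := arc u hu.
  have [c cN0 hc] := tangent_equation (regular_free rg u) em.
  have := hm w hw wu; have := hm w' hw' w'u; rewrite /side !hc => h' h.
  have ll : 0 < form l (g w) * form l (g w').
    have sub u' : Num.min w w' <= u' <= Num.max w w' -> form l (g u') != 0.
      move=> /andP[]; rewrite ge_min le_max => h1 h2; apply: l0; apply/andP; split.
        by move: hw hw' => /andP[? ?] /andP[? ?]; case/orP: h1; lra.
      by move: hw hw' => /andP[? ?] /andP[? ?]; case/orP: h2; lra.
    have := form_const_sign rg _ sub; rewrite ge_min !le_max !lexx => /(_ isT).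
    by rewrite minEle maxEle; case: (leP w w') => _ //; rewrite mulrC.
  have /mulr_gt0/(_ h') := h.
  rewrite mulrACA -invfM pmulr_lgt0 ?invr_gt0//.
  rewrite mulrACA -expr2 pmulr_rgt0// lt_neqAle eq_sym sqr_ge0 andbT.
  by rewrite sqrf_eq0.
pose e := tdet g a (g b); exists e.
have ia : a <= a <= b by rewrite lexx ltW.
have ib : a <= b <= b by rewrite lexx ltW.
have nz u w : a <= u <= b -> a <= w <= b -> u != w -> tdet g u (g w) != 0.
  move=> hu hw uw; have := H u w w hu hw hw; rewrite eq_sym uw => /(_ isT isT).
  by apply: contraTneq => ->; rewrite mul0r ltxx.
have C w u u' : a <= w <= b -> a <= u -> u <= u' -> u' <= b -> (u' < w) || (w < u) ->
    0 < tdet g u (g w) * tdet g u' (g w).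
  move=> hw au uu' u'b h.
  apply: (continuous_const_sign (f := fun s => tdet g s (g w))) => //.
    exact: tdet_continuous.
  move=> s /andP[us su']; apply: nz => //; first by apply/andP; split; lra.
  by rewrite neq_lt; case/orP: h => h; apply/orP; [left|right]; lra.
have T (x y z : R) : 0 < x * y -> 0 < y * z -> 0 < x * z.
  move=> h1 h2; have := mulr_gt0 h1 h2.
  rewrite (_ : x * y * (y * z) = y ^+ 2 * (x * z)); last by ring.
  by rewrite pmulr_rgt0// lt_neqAle eq_sym sqr_ge0 andbT sqrf_eq0;
    apply: contraTneq h1 => ->; rewrite mulr0 ltxx.
have sw (x y : R) : 0 < x * y -> 0 < y * x by rewrite mulrC.
move=> u w hu hw uw; move: (hu) => /andP[au]; rewrite le_eqVlt => /orP[/eqP ub|ub].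
- rewrite ub in hu au uw *; pose c := (a + b) / 2.
  have [ac cb] : a < c /\ c < b by rewrite /c; split; lra.
  have ic : a <= c <= b by rewrite !ltW.
  apply: (T _ (tdet g c (g b))); first by apply: C => //; rewrite ?ltW// cb.
  apply: (T _ (tdet g c (g a))); first by apply: H => //; [rewrite gt_eqF|rewrite lt_eqF].
  apply: (T _ (tdet g b (g a))); first by apply: C => //; rewrite ?ltW// ac orbT.
  by apply: H => //; [rewrite lt_eqF|rewrite eq_sym].
- apply: (T _ (tdet g u (g b))); first by apply: C => //; [exact: ltW|rewrite ub].
  by apply: H => //; [rewrite gt_eqF|rewrite eq_sym].
Qed.

Hypothesis closed : forall t, lift_point g (t + 1) = lift_point g t.

Lemma lift_neq0 t : g t != 0.
Proof.
have := regular_free rg t; rewrite free_cons span_seq1 => /andP[+ _].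
by apply: contraNneq => ->; rewrite mem0v.
Qed.

(** The lift is multiplied by a factor over one period; this factor depends on
    the parameter, so that the derivative also acquires a component along the
    lift. *)
Lemma lift_shift t : exists c k,
  [/\ c != 0, g (t + 1) = c *: g t & derive1 g (t + 1) = k *: g t + c *: derive1 g t].
Proof.
have hc s : exists2 c, c != 0 & g (s + 1) = c *: g s.
  have := closed s; rewrite /lift_point => E.
  have /vlineP[c hc] : g (s + 1) \in <[g s]>%VS by rewrite -E memv_line.
  exists c => //; apply: contraNneq (lift_neq0 (s + 1)) => c0.
  by rewrite hc c0 scale0r.
have [c cN0 gc] := hc t.
pose l : 'cV[R]_3 := (g t)^T.
have lN0 : form l (g t) != 0.
  rewrite formE !mxE -dotE gt_eqF// dot_gt0//; exact: lift_neq0.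
(* proportionality of g (u + 1) and g u, cleared of the unknown factor, can be
   differentiated *)
have key (m : 'cV[R]_3) u : form m (g (u + 1)) * form l (g u) = form l (g (u + 1)) * form m (g u).
  by have [c' _ ->] := hc u; rewrite !formZ mulrAC.
have dS (m : 'cV[R]_3) (u : R) : is_derive u (1 : R) (fun s : R => form m (g (s + 1))) (form m (derive1 g (u + 1))).
  rewrite -[form m _]mulr1.
  apply: (@is_derive1_comp _ (fun s : R => form m (g s)) (fun s : R => s + 1)).
    by apply: is_derive_form; exact: regular_derivable.
  by rewrite -[X in is_derive _ _ _ X]addr0; apply: is_deriveD.
have dkey (m : 'cV[R]_3) :
    form m (derive1 g (t + 1)) * form l (g t) + form m (g (t + 1)) * form l (derive1 g t)
  = form l (derive1 g (t + 1)) * form m (g t) + form l (g (t + 1)) * form m (derive1 g t).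
  have d0 (m' : 'cV[R]_3) : is_derive (t : R) (1 : R) (fun u : R => form m' (g u)) (form m' (derive1 g t)).
    by apply: is_derive_form; exact: regular_derivable.
  have dL := is_deriveM (dS m t) (d0 l).
  have dR := is_deriveM (dS l t) (d0 m).
  have E : (fun u : R => form m (g (u + 1))) * (fun u : R => form l (g u)) =
           (fun u : R => form l (g (u + 1))) * (fun u : R => form m (g u)).
    by apply/funext => u; exact: key.
  move: dL; rewrite E => dL.
  have := @derive_val _ _ _ _ _ _ _ dL; rewrite (@derive_val _ _ _ _ _ _ _ dR).
  rewrite /GRing.scale /= => h.
  by rewrite addrC [X in _ + X = _]mulrC [RHS]addrC [X in _ = _ + X]mulrC -h.
pose k := (form l (derive1 g (t + 1)) - c * form l (derive1 g t)) / form l (g t).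
exists c, k; split => //; apply: form_ext => m.
rewrite formD !formZ; apply: (mulIf lN0).
have := dkey m; rewrite gc !formZ /k => h.
have kL : k * form l (g t) = form l (derive1 g (t + 1)) - c * form l (derive1 g t).
  by rewrite divfK.
rewrite -/k (mulrDl (k * _)) [k * _ * _]mulrAC kL.
rewrite -[LHS](addrK (c * form m (g t) * form l (derive1 g t))) h.
move: (form l _) (form l _) (form l _) (form m _) (form m _) => x1 x2 x3 x4 x5.
by ring.
Qed.

End Regular.
End Tangents.

(** * Rotation of the tangent and local convexity *)

Section LocalConvexity.
Variable R : realType.
Implicit Types (v : 'rV[R]_3) (g : R -> 'rV[R]_3).

(** At a common end of two arcs of the curve nothing relates the sides to which
    they curve, whence one sign for each side of [s0]. *)
Definition locally_convex g (s0 em ep : R) : Prop := exists2 d, 0 < d &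
  convex_on g em (s0 - d) s0 /\ convex_on g ep s0 (s0 + d).

Lemma near_itv (s0 d d' u : R) : d < d' -> s0 - d <= u <= s0 + d ->
  [/\ s0 - d' <= u, u <= s0 + d', `|u - s0| < d' & `|u - s0| <= d].
Proof.
move=> dd /andP[ul uu]; rewrite ltr_norml ler_norml.
by split; try (apply/andP; split); lra.
Qed.

Section Regular.
Variables (g : R -> 'rV[R]_3) (rg : regular g).

(** As [s] leaves [s0], the tangent at [s] meets the tangent at [s0] close to the
    point [g s0]: hence all other points [al g(s0) + be g'(s0)] of the latter
    are on the same side of the former, and that side changes with the side
    of [s0] on which [s] lies.  Let [a, b, z] be the coordinates of [g s] in the
    basis [g s0, g' s0, n], and [x], [y], [E] the values at this basis of the equation
    of the tangent at [s], up to the factors [D] in [a], [b], [z] and [e] in [x], [y],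
    [z].  Then [b] has the sign of [s - s0] and, as [g s] lies on its own tangent,
    a x + b y + z E = 0. *)
Lemma rotation (s0 M m : R) : 0 < m -> exists2 d, 0 < d & forall s, 0 < `|s - s0| < d ->
  forall e, 0 < e * tdet g s (g s0) -> 0 < e * tdet g s0 (g s) ->
  forall al be : R, `|al| <= M -> m <= be ->
  (s - s0) * (e * (al * tdet g s (g s0) + be * tdet g s (derive1 g s0))) < 0.
Proof.
move=> m0; have [n Dn] := cross_neq0 (regular_free rg s0).
set D := det3 _ _ n in Dn.
have gc : g @ s0 --> g s0 by exact: regular_continuous.
have g'c : derive1 g @ s0 --> derive1 g s0 by exact: regular_C1.
have M1 : 0 < `|M| + 1 by rewrite ltr_wpDl.
have cc v := @cvg_const R v s0.
have n1 : \forall s \near s0, D / 2 < det3 (g s) (derive1 g s0) n.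
  by apply: (near_det3 gc (cc (derive1 g s0)) (cc n)); rewrite -/D; lra.
have n2 : \forall s \near s0, 0 < det3 (g s) (derive1 g s) n.
  exact: (near_det3 gc g'c (cc n)).
have n3 : \forall s \near s0, 0 < det3 (g s0) (derive1 g s) n.
  exact: (near_det3 (cc (g s0)) g'c (cc n)).
have n4 : \forall s \near s0, `|det3 (g s0) (g s) n| < m * (D / 2) / (`|M| + 1).
  have := cvg_det3 (nbhs_filter s0) (cc (g s0)) gc (cc n).
  rewrite det3_uuv => /cvgr0Pnorm_lt; apply.
  by rewrite !divr_gt0// mulr_gt0// divr_gt0.
have [d d0 hd] := (near_ball (fun s : R => (_ /\ _) /\ (_ /\ _)) s0).1
  (filterI (filterI n1 n2) (filterI n3 n4)).
exists d => // s /andP[ss0 sd] e ex ec al be hal hbe.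
have [[ha hE] [_ hb]] := hd s sd.
set a := det3 _ _ _ in ha; set E := det3 _ _ _ in hE; set b := det3 _ _ _ in hb.
pose x := e * tdet g s (g s0); pose y := e * tdet g s (derive1 g s0).
pose z := e * tdet g s0 (g s).
have rel : a * x + b * y + z * E = 0.
  have := cramer (g s0) (derive1 g s0) n (g s).
  move=> /(congr1 (form (cross (g s) (derive1 g s)))).
  rewrite !formD !formZ -!det3_form det3_uvu mulr0 -!tdetE (tdetE g s n) => h.
  rewrite /x /y /z -/a -/b -/E in h *.
  by transitivity (e * 0); [rewrite [in RHS]h; ring|rewrite mulr0].
have bs : 0 < b * (s - s0).
  pose l := cross n (g s0).
  have lE v : form l v = det3 (g s0) v n by rewrite -det3_form -det3_rot.
  have inc u w : u < w -> (`|u - s0| < d) -> (`|w - s0| < d) -> form l (g u) < form l (g w).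
    move=> uw ud wd; apply: form_increasing => // t /andP[ut tw].
    rewrite lE; apply: (hd t _).2.1; move: ud wd; rewrite !ltr_norml.
    by move=> /andP[? ?] /andP[? ?]; apply/andP; split; lra.
  have l0 : form l (g s0) = 0 by rewrite lE det3_uuv.
  have [lt|gt|eq] := ltgtP s s0.
  - have := inc s s0 lt sd; rewrite subrr normr0 => /(_ d0); rewrite l0 lE => bn.
    by rewrite nmulr_rgt0// subr_lt0.
  - have := inc s0 s gt; rewrite subrr normr0 => /(_ d0 sd); rewrite l0 lE => bp.
    by rewrite mulr_gt0// subr_gt0.
  - by move: ss0; rewrite eq subrr normr0 ltxx.
rewrite mulrDr !(mulrCA e) -/x -/y.
rewrite -/x in ex; rewrite -/z in ec; clearbody a b E x y z.
have a0 : 0 < a by apply: lt_trans ha; exact: divr_gt0.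
have bM : b * al < be * a.
  apply: le_lt_trans (ler_norm _) _; rewrite normrM.
  move: hb; rewrite ltr_pdivlMr// => hb.
  have h1 : `|b| * `|al| <= `|b| * (`|M| + 1).
    rewrite ler_wpM2l// (le_trans hal)// (le_trans (ler_norm _))//; lra.
  apply: (le_lt_trans h1); apply: (lt_le_trans hb).
  by apply: ler_pM; [exact: ltW|apply/ltW/divr_gt0|exact: hbe|exact: ltW].
have key : b * (al * x + be * y) < 0.
  have -> : b * (al * x + be * y) = x * (b * al - be * a) - be * (z * E) + be * (a * x + b * y + z * E).
    by ring.
  rewrite rel mulr0 addr0 subr_lt0; apply: (@lt_trans _ _ 0).
    by rewrite pmulr_rlt0// subr_lt0.
  by apply: mulr_gt0; [exact: lt_le_trans m0 hbe|exact: mulr_gt0].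
have := nmulr_rlt0 (b * (s - s0)) key; rewrite bs.
set S := al * x + be * y => h; rewrite ltNge; apply/negP => S0.
have : 0 <= b ^+ 2 * ((s - s0) * S) by rewrite mulr_ge0// sqr_ge0.
rewrite (_ : b ^+ 2 * _ = b * S * (b * (s - s0))); last by ring.
by rewrite leNgt h.
Qed.

Lemma locally_convex_sweep (s0 em ep M m : R) : locally_convex g s0 em ep -> 0 < m ->
  exists2 d, 0 < d & forall s, `|s - s0| < d -> forall al be : R, `|al| <= M -> m <= be ->
  (s0 < s -> ep * (al * tdet g s (g s0) + be * tdet g s (derive1 g s0)) < 0) /\
  (s < s0 -> 0 < em * (al * tdet g s (g s0) + be * tdet g s (derive1 g s0))).
Proof.
move=> [d1 d10 [cm cp]] m0; have [d2 d20 h] := rotation s0 M m0.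
exists (Num.min d1 d2) => [|s]; first by rewrite lt_min d10.
rewrite lt_min => /andP[sd1 sd2] al be hal hbe; move: (sd1).
rewrite ltr_norml => /andP[sl su].
split=> ss0.
- have hs : s0 <= s <= s0 + d1 by apply/andP; split; lra.
  have h0 : s0 <= s0 <= s0 + d1 by apply/andP; split; lra.
  have /h : 0 < `|s - s0| < d2 by rewrite sd2 normr_gt0 subr_eq0 gt_eqF.
  move=> /(_ ep _ _ al be hal hbe); rewrite pmulr_rlt0 ?subr_gt0//; apply.
    by apply: cp => //; rewrite gt_eqF.
  by apply: cp => //; rewrite lt_eqF.
- have hs : s0 - d1 <= s <= s0 by apply/andP; split; lra.
  have h0 : s0 - d1 <= s0 <= s0 by apply/andP; split; lra.
  have /h : 0 < `|s - s0| < d2 by rewrite sd2 normr_gt0 subr_eq0 lt_eqF.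
  move=> /(_ em _ _ al be hal hbe); rewrite nmulr_rlt0 ?subr_lt0//; apply.
    by apply: cm => //; rewrite lt_eqF.
  by apply: cm => //; rewrite gt_eqF.
Qed.

(** For [u] and [w] on both sides of [s0], the position of [g w] with respect to the
    tangent at [u] is computed in the basis [g s0, g' s0, n]: the three terms have
    the same sign, by convexity of the arc that contains [u], by the rotation of
    the tangent, and by convexity of the arc that contains [w]. *)
Lemma locally_convex_join (s0 em ep : R) : locally_convex g s0 em ep -> 0 < em * ep ->
  exists2 d, 0 < d & convex_on g em (s0 - d) (s0 + d).
Proof.
move=> lc emp; have [d1 d10 h1] := locally_convex_sweep 0 lc ltr01.
case: lc => d2 d20 [cm cp].
have same x : 0 < ep * x -> 0 < em * x.
  move=> h; rewrite -(pmulr_rgt0 _ emp) (_ : em * ep * (em * x) = em ^+ 2 * (ep * x)); last by ring.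
  by rewrite mulr_gt0// lt_neqAle eq_sym sqr_ge0 sqrf_eq0 andbT;
    apply: contraTneq emp => ->; rewrite mul0r ltxx.
have same' x : ep * x < 0 -> em * x < 0.
  by move=> h; rewrite -oppr_gt0 -mulrN; apply: same; rewrite mulrN oppr_gt0.
have [n Dn] := cross_neq0 (regular_free rg s0).
set D := det3 _ _ n in Dn.
have gc : g @ s0 --> g s0 by exact: regular_continuous.
have g'c : derive1 g @ s0 --> derive1 g s0 by exact: regular_C1.
have cc v := @cvg_const R v s0.
have n1 : \forall s \near s0, 0 < det3 (g s) (derive1 g s0) n.
  exact: (near_det3 gc (cc (derive1 g s0)) (cc n)).
have n2 : \forall s \near s0, 0 < det3 (g s) (derive1 g s) n.
  exact: (near_det3 gc g'c (cc n)).
have n3 : \forall s \near s0, 0 < det3 (g s0) (derive1 g s) n.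
  exact: (near_det3 (cc (g s0)) g'c (cc n)).
have [d3 d30 h3] := (near_ball (fun s : R => _ /\ (_ /\ _)) s0).1
  (filterI n1 (filterI n2 n3)).
have [d [d0 dd1 dd2 dd3]] : exists d, [/\ 0 < d, d < d1, d < d2 & d < d3].
  exists (Num.min d1 (Num.min d2 d3) / 2).
  have m0 : 0 < Num.min d1 (Num.min d2 d3) by rewrite !lt_min d10 d20.
  have : Num.min d1 (Num.min d2 d3) <= d1 by rewrite ge_min lexx.
  have : Num.min d1 (Num.min d2 d3) <= d2 by rewrite !ge_min lexx orbT.
  have : Num.min d1 (Num.min d2 d3) <= d3 by rewrite !ge_min lexx !orbT.
  by split; lra.
have betas w : `|w - s0| <= d -> (s0 < w -> 0 < det3 (g s0) (g w) n) /\
    (w < s0 -> det3 (g s0) (g w) n < 0).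
  pose l := cross n (g s0).
  have lE v : form l v = det3 (g s0) v n by rewrite -det3_form -det3_rot.
  have l0 : form l (g s0) = 0 by rewrite lE det3_uuv.
  rewrite ler_norml => /andP[? ?].
  split => ws; rewrite -lE -{1}l0; apply: form_increasing => // t /andP[? ?].
    by rewrite lE; apply: (h3 t _).2.2; rewrite ltr_norml; apply/andP; split; lra.
  by rewrite lE; apply: (h3 t _).2.2; rewrite ltr_norml; apply/andP; split; lra.
exists d => // u w hu hw uw.
have [_ _ ud _] := near_itv dd1 hu; have [ul uu _ _] := near_itv dd2 hu.
have [_ _ ud' _] := near_itv dd3 hu; have [wl wu _ _] := near_itv dd2 hw.
have [_ _ wd' wd] := near_itv dd3 hw.
have [al _] := h3 w wd'; have [_ [E _]] := h3 u ud'; have [bp bn] := betas w wd.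
have rel : em * (D * tdet g u (g w)) = det3 (g w) (derive1 g s0) n * (em * tdet g u (g s0)) +
    det3 (g s0) (g w) n * (em * tdet g u (derive1 g s0)) +
    (em * tdet g s0 (g w)) * det3 (g u) (derive1 g u) n.
  have := cramer (g s0) (derive1 g s0) n (g w).
  move=> /(congr1 (form (cross (g u) (derive1 g u)))).
  rewrite !formD !formZ -!det3_form -!tdetE (tdetE g s0 n) -/D => ->.
  by rewrite (tdetE g u n); ring.
have s0l : s0 - d2 <= s0 by rewrite lerBlDr lerDl ltW.
have s0u : s0 <= s0 + d2 by rewrite lerDl ltW.
have iu : (s0 < u -> 0 < ep * tdet g u (g s0)) /\ (u < s0 -> 0 < em * tdet g u (g s0)).
  split=> us.
    by apply: cp; rewrite ?gt_eqF// ?lexx ?s0u// uu ltW.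
  by apply: cm; rewrite ?lt_eqF// ?lexx ?s0l// ul ltW.
have iw : (s0 < w -> 0 < ep * tdet g s0 (g w)) /\ (w < s0 -> 0 < em * tdet g s0 (g w)).
  split=> ws.
    by apply: cp; rewrite ?lt_eqF// ?lexx ?s0u// wu ltW.
  by apply: cm; rewrite ?gt_eqF// ?lexx ?s0l// wl ltW.
have [sp sm] : (s0 < u -> ep * tdet g u (derive1 g s0) < 0) /\
    (u < s0 -> 0 < em * tdet g u (derive1 g s0)).
  by have := h1 u ud 0 1; rewrite normr0 lexx mul0r add0r mul1r => /(_ isT (lexx _)).
have [us|us|us] := ltgtP u s0; have [ws|ws|ws] := ltgtP w s0.
- by apply: cm; rewrite // ?ul ?wl ltW.
- rewrite -(pmulr_rgt0 _ Dn) mulrCA rel.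
  exact: (addr_gt0 (addr_gt0 (mulr_gt0 al (iu.2 us)) (mulr_gt0 (bp ws) (sm us)))
    (mulr_gt0 (same _ (iw.1 ws)) E)).
- by rewrite ws; apply: iu.2.
- rewrite -(pmulr_rgt0 _ Dn) mulrCA rel.
  have X : 0 < det3 (g s0) (g w) n * (em * tdet g u (derive1 g s0)).
    by rewrite (nmulr_rgt0 _ (bn ws)); exact: (same' _ (sp us)).
  exact: (addr_gt0 (addr_gt0 (mulr_gt0 al (same _ (iu.1 us))) X) (mulr_gt0 (iw.2 ws) E)).
- by apply: same; apply: cp; rewrite // ?uu ?wu ltW.
- by rewrite ws; apply/same/iu.1.
- by rewrite us; apply: iw.2.
- by rewrite us; apply/same/iw.1.
- by move: uw; rewrite us ws eqxx.
Qed.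

End Regular.
End LocalConvexity.

(** * Periodicity of convexity and finiteness on a component *)

Section ClosedLift.
Variable R : realType.
Implicit Types (v : 'rV[R]_3).
Variables (g : R -> 'rV[R]_3) (rg : regular g).
Hypothesis closed : forall t, lift_point g (t + 1) = lift_point g t.

Lemma tdet_shift (t : R) : exists2 c : R, c != 0 & [/\ g (t + 1) = c *: g t,
  forall v, tdet g (t + 1) v = c ^+ 2 * tdet g t v &
  forall v, form (beta_form (g (t + 1)) (derive1 g (t + 1))) v =
            c ^+ 3 * form (beta_form (g t) (derive1 g t)) v].
Proof.
have [c [k [c0 E1 E2]]] := lift_shift rg closed t; exists c => //.
split => // v.
  by rewrite !tdetE E1 E2 det3Zl det3Dm !det3Zm det3_uuv; ring.
by rewrite E1 E2 !beta_formE !dotE !mxE; ring.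
Qed.

(** The factor between [g] and its translate by a period is continuous, hence of
    constant sign; it may be negative, whence a new sign [e']. *)
Lemma convex_shift (e a b : R) : convex_on g e (a + 1) (b + 1) ->
  exists e', convex_on g e' a b.
Proof.
move=> cv; have [ab|ba] := leP a b; last first.
  by exists 0 => u w /andP[au ub] _ _; have := lt_le_trans ba (le_trans au ub); rewrite ltxx.
have fE (w : R) : exists2 c : R, c != 0 & g (w + 1) = c *: g w /\
    dot (g (w + 1)) (g w) = c * dot (g w) (g w).
  have [c c0 [E _ _]] := tdet_shift w; exists c => //; split=> //.
  by rewrite E !dotE !mxE; ring.
have dp (w : R) : 0 < dot (g w) (g w) by apply: dot_gt0; exact: lift_neq0.
have fc : continuous (fun w : R => dot (g (w + 1)) (g w)).
  move=> w; rewrite (_ : (fun w : R => _) = fun w : R =>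
    g (w + 1) ord0 ord3_0 * g w ord0 ord3_0 + g (w + 1) ord0 ord3_1 * g w ord0 ord3_1 +
    g (w + 1) ord0 ord3_2 * g w ord0 ord3_2); last by apply/funext => u; rewrite dotE.
  have gc : g @ w --> g w by exact: regular_continuous.
  have sc : (fun u : R => g (u + 1)) @ w --> g (w + 1).
    apply: (@cvg_comp _ _ _ (fun u : R => u + 1) g (nbhs w) (nbhs (w + 1))).
      by apply: cvgD; [exact: cvg_id|exact: cvg_cst].
    exact: regular_continuous.
  have P i : (fun u : R => g (u + 1) ord0 i * g u ord0 i) @ w --> g (w + 1) ord0 i * g w ord0 i.
    by apply: cvgM; exact: cvg_coord.
  apply: cvgD; last exact: P.
  by apply: cvgD; exact: P.
exists (e * dot (g (a + 1)) (g a)) => u w hu hw uw.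
have fN0 (s : R) : a <= s <= w -> dot (g (s + 1)) (g s) != 0.
  by move=> _; have [c c0 [_ ->]] := fE s; rewrite mulf_neq0// gt_eqF.
have := continuous_const_sign fc (andP hw).1 fN0.
have [c c0 [E ->]] := fE w; rewrite mulrA (pmulr_lgt0 _ (dp w)) => fac.
have [d d0 [_ T _]] := tdet_shift u.
have := cv (u + 1) (w + 1); rewrite !lerD2r => /(_ hu hw).
rewrite (inj_eq (addIr 1)) uw => /(_ isT); rewrite E T !tdetE det3Z => h.
have := mulr_gt0 fac h.
rewrite (_ : dot _ _ * c * _ = (c * d) ^+ 2 *
  (e * dot (g (a + 1)) (g a) * det3 (g u) (derive1 g u) (g w))); last by ring.
rewrite pmulr_rgt0// lt_neqAle eq_sym sqr_ge0 andbT sqrf_eq0.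
by rewrite mulf_neq0.
Qed.

Variables (k : nat) (tau : nat -> R).
Hypotheses (tau0 : tau 0%N = 0) (tauk : tau k = 1).
Hypothesis arcs : forall j, (j < k)%N ->
  tau j < tau j.+1 /\ strictly_convex_arc g (tau j) (tau j.+1).

Lemma arc_after (s : R) : 0 <= s -> s < 1 ->
  exists2 j, (j < k)%N & tau j <= s < tau j.+1.
Proof.
move=> s0 s1; apply: contrapT => h.
suff H j : (j <= k)%N -> tau j <= s by have := H k (leqnn k); rewrite tauk leNgt s1.
elim: j => [_|j IH jk]; first by rewrite tau0.
have js := IH (ltnW jk).
by rewrite leNgt; apply/negP => sj; apply: h; exists j; rewrite // js.
Qed.

Lemma arc_before (s : R) : 0 < s -> s <= 1 ->
  exists2 j, (j < k)%N & tau j < s <= tau j.+1.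
Proof.
move=> s0 s1; apply: contrapT => h.
suff H j : (j <= k)%N -> tau j < s by have := H k (leqnn k); rewrite tauk ltNge s1.
elim: j => [_|j IH jk]; first by rewrite tau0.
have js := IH (ltnW jk).
by rewrite ltNge; apply/negP => sj; apply: h; exists j; rewrite // js.
Qed.

(** Only the parameter 0 needs care: the arc that precedes it is the last one,
    translated by a period. *)
Lemma exists_locally_convex (s : R) : 0 <= s < 1 ->
  exists em ep, locally_convex g s em ep.
Proof.
move=> /andP[s0 s1].
have [j jk /andP[js sj]] := arc_after s0 s1.
have [jj /(arc_convex rg jj)[ep cp]] := arcs jk.
have [d1 d10 [em cm]] : exists2 d, 0 < d & exists em, convex_on g em (s - d) s.
  have [s0'|s0'] : 0 < s \/ s = 0.
    by move: s0; rewrite le_eqVlt => /orP[/eqP <-|]; [right|left].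
    have [i ik /andP[is_ si]] := arc_before s0' (ltW s1).
    have [ii /(arc_convex rg ii)[em cm]] := arcs ik.
    exists (s - tau i); first by rewrite subr_gt0.
    by exists em; apply: convex_on_sub cm => //; rewrite subKr.
  have [i ik /andP[is_ si]] := arc_before ltr01 (lexx 1).
  have [ii /(arc_convex rg ii)[em cm]] := arcs ik.
  have d0 : 0 < 1 - tau i by rewrite subr_gt0.
  exists (1 - tau i) => //; rewrite s0'; apply: (@convex_shift em).
  by apply: convex_on_sub cm; rewrite add0r// opprB subrK.
exists em, ep; exists (Num.min d1 (tau j.+1 - s)); first by rewrite lt_min d10 subr_gt0.
split.
  by apply: convex_on_sub cm => //; rewrite lerD2l lerN2 ge_min lexx.
by apply: convex_on_sub cp => //; rewrite -lerBrDl ge_min lexx orbT.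
Qed.

Lemma finite_form_zeros l v : form l v != 0 ->
  finite_set [set t : R | 0 <= t < 1 /\ form l (g t) = 0].
Proof.
move=> lv.
apply: (@sub_finite_set _ _ (\bigcup_(j in `I_k)
   [set t | tau j <= t <= tau j.+1 /\ form l (g t) = 0])).
  move=> t [/andP[t0 t1] ft]; have [j jk /andP[js sj]] := arc_after t0 t1.
  by exists j => //; split=> //; rewrite js ltW.
apply: bigcup_finite => [|j jk]; first exact: finite_II.
have [jj /(arc_convex rg jj)[e cv]] := arcs jk.
exact: (convex_line_finite cv lv).
Qed.

End ClosedLift.

(** * The count of the points of the curve on a moving tangent *)

Section LocalCounts.
Variable R : realType.
Implicit Types (v n : 'rV[R]_3) (l : 'cV[R]_3) (g h f : R -> 'rV[R]_3).

Section Boxes.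
Variables (s0 t0 : R).
Let F := filter_prod (nbhs s0) (nbhs t0).

Lemma cvg_prod1 f : continuous f -> (fun p : R * R => f p.1) @ F --> f s0.
Proof.
move=> fc; apply: (@cvg_comp _ _ _ fst f F (nbhs s0) (nbhs (f s0))); last exact: fc.
exact: cvg_fst.
Qed.

Lemma cvg_prod2 f : continuous f -> (fun p : R * R => f p.2) @ F --> f t0.
Proof.
move=> fc; apply: (@cvg_comp _ _ _ snd f F (nbhs t0) (nbhs (f t0))); last exact: fc.
exact: cvg_snd.
Qed.

Lemma box_gt (phi : R -> R -> R) a z : (fun p : R * R => phi p.1 p.2) @ F --> a -> z < a ->
  exists2 d, 0 < d & forall s t, `|s - s0| < d -> `|t - t0| < d -> z < phi s t.
Proof. by move=> fa za; apply: near_ball2; exact: (cvgr_gt _ fa _ za). Qed.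

Lemma box_sgz (phi : R -> R -> R) a : (fun p : R * R => phi p.1 p.2) @ F --> a -> a != 0 ->
  exists2 d, 0 < d &
    forall s t, `|s - s0| < d -> `|t - t0| < d -> sgz (phi s t) = sgz a.
Proof. by move=> fa a0; apply: near_ball2; exact: (cvg_sgz _ a0 fa). Qed.

Lemma box_small (phi : R -> R -> R) a z : (fun p : R * R => phi p.1 p.2) @ F --> a ->
  a = 0 -> 0 < z ->
  exists2 d, 0 < d & forall s t, `|s - s0| < d -> `|t - t0| < d -> `|phi s t| < z.
Proof.
by move=> fa a0 z0; apply: near_ball2; rewrite a0 in fa; exact: ((cvgr0Pnorm_lt _).1 fa z z0).
Qed.

End Boxes.

Lemma distR_between (x y z c d : R) : `|x - c| < d -> `|y - c| < d ->
  x < z < y -> `|z - c| < d.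
Proof.
rewrite !ltr_norml => /andP[? ?] /andP[? ?] /andP[? ?]; apply/andP; split; lra.
Qed.

Section FirstOrder.
Variables (h : R -> 'rV[R]_3) (rh : regular h) (l : 'cV[R]_3).

Lemma form_increasing_lb a b c : a < b ->
  (forall u, a < u < b -> c < form l (derive1 h u)) ->
  c * (b - a) < form l (h b) - form l (h a).
Proof.
move=> ab hc.
have [||u cab e] := @MVT R (fun t => form l (h t)) (fun t => form l (derive1 h t)) a b ab.
- by move=> x _; apply: is_derive_form; exact: regular_derivable.
- by apply: continuous_subspaceT; exact: form_continuous.
by rewrite e ltr_pM2r ?subr_gt0//; apply: hc; move: cab; rewrite in_itv.
Qed.

Lemma form_lipschitz (c d K a b : R) : `|a - c| < d -> `|b - c| < d ->
  (forall u, `|u - c| < d -> `|form l (derive1 h u)| < K) ->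
  `|form l (h b) - form l (h a)| <= K * `|b - a|.
Proof.
move=> ac bc hK.
suff H x y : `|x - c| < d -> `|y - c| < d -> x < y ->
    `|form l (h y) - form l (h x)| <= K * `|y - x|.
  have [ab|ba|->] := ltgtP a b; first exact: H.
    by rewrite distrC (distrC b); exact: H.
  by rewrite !subrr normr0 mulr0.
move=> {}ac {}bc ab.
have [||u cab e] := @MVT R (fun t => form l (h t)) (fun t => form l (derive1 h t)) x y ab.
- by move=> z _; apply: is_derive_form; exact: regular_derivable.
- by apply: continuous_subspaceT; exact: form_continuous.
rewrite e normrM ler_wpM2r// ltW// hK//.
by apply: distR_between ac bc _; move: cab; rewrite in_itv.
Qed.

Lemma form_sgz_const t0 : form l (h t0) != 0 ->
  exists2 d, 0 < d & forall t, `|t - t0| < d -> sgz (form l (h t)) = sgz (form l (h t0)).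
Proof.
move=> l0.
have c : (fun t => form l (h t)) @ t0 --> form l (h t0) by exact: form_continuous.
exact: (near_ball _ _).1 (cvg_sgz _ l0 c).
Qed.

Lemma form_simple_zero t0 : form l (h t0) = 0 -> form l (derive1 h t0) != 0 ->
  exists2 d, 0 < d & forall t, `|t - t0| < d ->
    sgz (form l (h t)) = sgz (form l (derive1 h t0)) * sgz (t - t0).
Proof.
move=> l0 l1; pose k := form l (derive1 h t0).
have : (fun t => form (k *: l) (derive1 h t)) @ t0 --> form (k *: l) (derive1 h t0).
  by apply: cvg_form; exact: regular_C1.
move/cvgr_gt => /(_ 0); rewrite formZl -/k -expr2 lt_neqAle eq_sym sqrf_eq0 l1 sqr_ge0.
move=> /(_ isT)/near_ball[d d0 hd]; exists d => // t td.
have inc x y : `|x - t0| < d -> `|y - t0| < d -> x < y -> k * form l (h x) < k * form l (h y).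
  move=> xd yd xy; rewrite -!formZl; apply: form_increasing => // u uxy.
  by apply: hd; apply: distR_between xd yd uxy.
have t0d : `|t0 - t0| < d by rewrite subrr normr0.
have [lt|gt|->] := ltgtP t t0; last by rewrite l0 subrr !sgz0 mulr0.
- have := inc t t0 td t0d lt; rewrite l0 mulr0 => hn.
  rewrite (ltr0_sgz (x := t - t0)) ?subr_lt0// mulrN1.
  have [k0|k0] : k < 0 \/ 0 < k by apply/orP; rewrite -neq_lt.
    by rewrite -/k (ltr0_sgz k0) opprK gtr0_sgz// -(nmulr_rlt0 _ k0).
  by rewrite -/k (gtr0_sgz k0) ltr0_sgz// -(pmulr_rlt0 _ k0).
- have := inc t0 t t0d td gt; rewrite l0 mulr0 => hn.
  rewrite (gtr0_sgz (x := t - t0)) ?subr_gt0// mulr1.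
  have [k0|k0] : k < 0 \/ 0 < k by apply/orP; rewrite -neq_lt.
    by rewrite -/k (ltr0_sgz k0) ltr0_sgz// -(nmulr_rgt0 _ k0).
  by rewrite -/k (gtr0_sgz k0) gtr0_sgz// -(pmulr_rgt0 _ k0).
Qed.

End FirstOrder.

(** A point [h t] of the tangent at [g s] is counted with the sign [1] if it is
    ahead of [g s] and [-1] if it is behind, in the affine chart: when
    [h t = x g(s) + y g'(s)], the affine vector from [g s] to [h t] is the velocity of
    the affine curve multiplied by [y l(g s) / l(h t)].  The product replaces the
    quotient, so that points at infinity have weight 0. *)
Definition weight l g h (s t : R) : int :=
  if tdet g s (h t) == 0 then
    sgz (form (beta_form (g s) (derive1 g s)) (h t) * form l (g s) * form l (h t))
  else 0.

(** As [s] tends to [s0], the points of [h] that tend to [h t0] contribute [wm] on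
    the left and [wp] on the right. *)
Definition local_count (W : R -> R -> int) (s0 t0 : R) (wm wp : int) : Prop :=
  exists2 d, 0 < d & forall d', 0 < d' < d -> \forall s \near s0, s != s0 ->
    \sum_(t \in [set t | `|t - t0| < d']) W s t = if s0 < s then wp else wm.

Lemma sgz_side (X : int) (s s0 : R) : s != s0 ->
  X * sgz (s - s0) = if s0 < s then X else - X.
Proof.
rewrite neq_lt => /orP[ss0|ss0].
  by rewrite ltr0_sgz ?subr_lt0// mulrN1 ltNge (ltW ss0).
by rewrite gtr0_sgz ?subr_gt0// mulr1 ss0.
Qed.

Lemma sgz_mulK (e x : R) : e != 0 -> sgz x = sgz e * sgz (e * x).
Proof. by move=> e0; rewrite sgzM mulrA mulz_sg e0 mul1r. Qed.

Section FewTerms.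
Variables (V : set R) (w : R -> int).

Lemma sum_one t1 : V t1 -> (forall t, V t -> t != t1 -> w t = 0) ->
  \sum_(t \in V) w t = w t1.
Proof.
move=> V1 h; rewrite -(fsbig_set1 +%R t1 w); apply/esym/fsbig_widen.
  by move=> _ ->.
by move=> t [Vt /= /eqP tt1]; apply: h.
Qed.

Lemma sum_two t1 t2 : V t1 -> V t2 -> t1 != t2 ->
  (forall t, V t -> t != t1 -> t != t2 -> w t = 0) ->
  \sum_(t \in V) w t = w t1 + w t2.
Proof.
move=> V1 V2 t12 h.
rewrite -(fsbig_set1 +%R t1 w) -(fsbig_set1 +%R t2 w) -fsbigU0.
- apply/esym/fsbig_widen; first by move=> _ [->|->].
  by move=> t [Vt /= /not_orP[/eqP tt1 /eqP tt2]]; apply: h.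
- exact: finite_set1.
- exact: finite_set1.
- by move=> t [/= -> e]; move: t12; rewrite e eqxx.
Qed.

End FewTerms.

End LocalCounts.

(** * Jumps of the count: transversal crossings *)

Section Transversal.
Variable R : realType.
Variables (l : 'cV[R]_3) (g h : R -> 'rV[R]_3).
Hypotheses (rg : regular g) (rh : regular h).

Let betag s v := form (beta_form (g s) (derive1 g s)) v.

Lemma cvg_tdet_box (f : R -> 'rV[R]_3) (s0 t0 : R) : continuous f ->
  (fun p : R * R => tdet g p.1 (f p.2)) @ filter_prod (nbhs s0) (nbhs t0) --> tdet g s0 (f t0).
Proof.
move=> fc; rewrite tdetE (_ : (fun p : R * R => _) =
  fun p : R * R => det3 (g p.1) (derive1 g p.1) (f p.2)); last first.
  by apply/funext => p; rewrite tdetE.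
apply: cvg_det3; last exact: cvg_prod2.
  by apply: cvg_prod1; exact: regular_continuous.
by apply: cvg_prod1; exact: regular_C1.
Qed.

Lemma cvg_beta_box (s0 t0 : R) :
  (fun p : R * R => betag p.1 (h p.2)) @ filter_prod (nbhs s0) (nbhs t0) --> betag s0 (h t0).
Proof.
apply: cvg_beta.
- by apply: cvg_prod1; exact: regular_continuous.
- by apply: cvg_prod1; exact: regular_C1.
- by apply: cvg_prod2; exact: regular_continuous.
Qed.

Lemma near_tdet (s0 k : R) v : 0 < k * tdet g s0 v ->
  \forall s \near s0, 0 < k * tdet g s v.
Proof.
have c : (fun s => k * tdet g s v) @ s0 --> k * tdet g s0 v.
  by apply: cvgM; [exact: cvg_cst|exact: tdet_continuous].
by move=> h0; exact: (cvgr_gt _ c _ h0).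
Qed.

(** The tangents to [g] depend only continuously on their parameter, but the
    equation of the tangent is strictly monotone along [h], with a slope bounded
    below: this gives one zero, its side and its rate of convergence. *)
Lemma transversal_zero (s0 t0 : R) : tdet g s0 (h t0) = 0 ->
  tdet g s0 (derive1 h t0) != 0 -> let phi := tdet g s0 (derive1 h t0) in
  exists2 d, 0 < d & forall d', 0 < d' < d -> \forall s \near s0, exists t1,
    [/\ `|t1 - t0| < d', tdet g s (h t1) = 0,
        forall t, `|t - t0| < d -> tdet g s (h t) = 0 -> t = t1,
        sgz (t1 - t0) = - (sgz phi * sgz (tdet g s (h t0))) &
        phi ^+ 2 / 2 * `|t1 - t0| <= `|phi * tdet g s (h t0)|].
Proof.
move=> F0 p0 phi; have p2 : 0 < phi ^+ 2.
  by rewrite lt_neqAle eq_sym sqrf_eq0 p0 sqr_ge0.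
pose ls s := phi *: cross (g s) (derive1 g s).
have lsE s v : form (ls s) v = phi * tdet g s v by rewrite formZl tdetE det3_form.
have [d d0 hd] : exists2 d, 0 < d & forall s t, `|s - s0| < d -> `|t - t0| < d ->
    phi ^+ 2 / 2 < phi * tdet g s (derive1 h t).
  apply: (@box_gt _ _ _ (fun s t => phi * tdet g s (derive1 h t)) (phi * phi)).
    by apply: cvgM; [exact: cvg_cst|apply: cvg_tdet_box; exact: regular_C1].
  by rewrite -expr2 ltr_pdivrMr// ltr_pMr// ltr1n.
have lb s x y : `|s - s0| < d -> `|x - t0| < d -> `|y - t0| < d -> x < y ->
    phi ^+ 2 / 2 * (y - x) < phi * tdet g s (h y) - phi * tdet g s (h x).
  move=> sd xd yd xy; rewrite -!lsE; apply: form_increasing_lb => // u uxy.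
  by rewrite lsE; apply: hd => //; apply: distR_between xd yd uxy.
have s0d : `|s0 - s0| < d by rewrite subrr normr0.
have t0d : `|t0 - t0| < d by rewrite subrr normr0.
have c0 : 0 < phi ^+ 2 / 2 by rewrite divr_gt0.
exists d => // d' /andP[d'0 d'd]; pose e := d' / 2.
have e0 : 0 < e by rewrite divr_gt0.
have ed' : e < d' by rewrite ltr_pdivrMr// ltr_pMr// ltr1n.
have ed : e < d by exact: lt_trans d'd.
have ted : `|t0 + e - t0| < d by rewrite addrAC subrr add0r gtr0_norm.
have tNed : `|t0 - e - t0| < d by rewrite addrAC subrr add0r normrN gtr0_norm.
have teN : t0 - e < t0 by rewrite ltrBlDr ltrDl.
have te : t0 < t0 + e by rewrite ltrDl.
have n1 : \forall s \near s0, 0 < phi * tdet g s (h (t0 + e)).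
  have lbe := lb s0 _ _ s0d t0d ted te.
  have pos : 0 < phi * tdet g s0 (h (t0 + e)).
    move: lbe; rewrite F0 mulr0 subr0; apply: lt_trans.
    by rewrite mulr_gt0// addrAC subrr add0r.
  exact: near_tdet.
have n2 : \forall s \near s0, 0 < - phi * tdet g s (h (t0 - e)).
  have lbe := lb s0 _ _ s0d tNed t0d teN.
  have neg : 0 < - phi * tdet g s0 (h (t0 - e)).
    move: lbe; rewrite F0 mulr0 sub0r mulNr; apply: lt_trans.
    by rewrite mulr_gt0// opprB addrC subrK.
  exact: near_tdet.
have n3 : \forall s \near s0, `|s - s0| < d by apply/near_ball; exists d.
apply: filterS3 n1 n2 n3 => s sp sn sd.
have [||t1 /andP[t1l t1u]] := @form_IVT _ h rh (ls s) (t0 - e) (t0 + e).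
- exact: lt_trans te.
- by rewrite !lsE nmulr_rlt0// -oppr_gt0 -mulNr.
rewrite lsE => /eqP; rewrite mulf_eq0 (negbTE p0) /= => /eqP t1z.
have t1d' : `|t1 - t0| < d' by rewrite (le_lt_trans _ ed')// ler_distl !ltW.
have t1d : `|t1 - t0| < d by exact: lt_trans d'd.
exists t1; split => //.
- move=> t td tz; have [lt|lt|//] := ltgtP t t1.
    have := lb s _ _ sd td t1d lt; rewrite tz t1z subrr.
    by rewrite pmulr_rlt0// subr_lt0 ltNge ltW.
  have := lb s _ _ sd t1d td lt; rewrite tz t1z subrr.
  by rewrite pmulr_rlt0// subr_lt0 ltNge ltW.
- rewrite -sgzM; have [lt|lt|eq] := ltgtP t1 t0; last by rewrite -eq subrr t1z mulr0 !sgz0 oppr0.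
    have := lb s _ _ sd t1d t0d lt; rewrite t1z mulr0 subr0 => h1.
    rewrite ltr0_sgz ?subr_lt0// gtr0_sgz//; apply: lt_trans h1.
    by rewrite mulr_gt0// subr_gt0.
  have := lb s _ _ sd t0d t1d lt; rewrite t1z mulr0 sub0r => h1.
  rewrite gtr0_sgz ?subr_gt0// ltr0_sgz ?opprK// -oppr_gt0; apply: lt_trans h1.
  by rewrite mulr_gt0// subr_gt0.
- have [lt|lt|->] := ltgtP t1 t0; last by rewrite subrr normr0 mulr0.
    have := lb s _ _ sd t1d t0d lt; rewrite t1z mulr0 subr0 => h1.
    rewrite distrC gtr0_norm ?subr_gt0// (le_trans (ltW h1))//; exact: ler_norm.
  have := lb s _ _ sd t0d t1d lt; rewrite t1z mulr0 sub0r => h1.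
  rewrite gtr0_norm ?subr_gt0// (le_trans (ltW h1))// -normrN; exact: ler_norm.
Qed.

Lemma transversal_sum (s0 t0 : R) : tdet g s0 (h t0) = 0 ->
  tdet g s0 (derive1 h t0) != 0 -> let phi := tdet g s0 (derive1 h t0) in
  exists2 d, 0 < d & forall d', 0 < d' < d -> \forall s \near s0, exists t1,
    [/\ `|t1 - t0| < d', tdet g s (h t1) = 0,
        \sum_(t \in [set t | `|t - t0| < d']) weight l g h s t =
          sgz (betag s (h t1)) * sgz (form l (g s)) * sgz (form l (h t1)),
        sgz (t1 - t0) = - (sgz phi * sgz (tdet g s (h t0))) &
        phi ^+ 2 / 2 * `|t1 - t0| <= `|phi * tdet g s (h t0)|].
Proof.
move=> F0 p0 phi; have [d d0 hd] := transversal_zero F0 p0.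
exists d => // d' /andP[d'0 d'd].
have /hd : 0 < d' < d by rewrite d'0.
apply: filterS => s [t1 [t1d t1z uniq sg bd]]; exists t1; split => //.
rewrite -!sgzM (sum_one t1d).
  by rewrite /weight t1z eqxx.
move=> t td tt1; rewrite /weight; case: eqP => // tz.
by move: tt1; rewrite (uniq t) ?eqxx//; exact: lt_trans d'd.
Qed.

Lemma count_off (s0 t0 : R) : tdet g s0 (h t0) != 0 ->
  local_count (weight l g h) s0 t0 0 0.
Proof.
move=> F0.
have [d d0 hd] := box_sgz (phi := fun s t => tdet g s (h t))
  (cvg_tdet_box (s0 := s0) (t0 := t0) (regular_continuous rh)) F0.
exists d => // d' /andP[d'0 d'd].
have n3 : \forall s \near s0, `|s - s0| < d by apply/near_ball; exists d.
apply: filterS n3 => s sd _; rewrite if_same; apply: fsbig1 => t td.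
rewrite /weight -sgz_eq0 (hd s t sd) ?sgz_eq0 ?(negbTE F0)//.
exact: lt_trans d'd.
Qed.

Lemma count_transversal (s0 t0 : R) : tdet g s0 (h t0) = 0 ->
  tdet g s0 (derive1 h t0) != 0 ->
  betag s0 (h t0) != 0 -> form l (g s0) != 0 -> form l (h t0) != 0 ->
  exists w, local_count (weight l g h) s0 t0 w w.
Proof.
move=> F0 p0 b0 lg lh.
have [d1 d10 h1] := box_sgz (phi := fun s t => betag s (h t))
  (cvg_beta_box (s0 := s0) (t0 := t0)) b0.
have [d2 d20 h2] := transversal_sum F0 p0.
have [d3 d30 h3] := form_sgz_const rg lg.
have [d4 d40 h4] := form_sgz_const rh lh.
exists (sgz (betag s0 (h t0)) * sgz (form l (g s0)) * sgz (form l (h t0))).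
exists (Num.min d1 (Num.min d2 d4)); first by rewrite !lt_min d10 d20.
move=> d' /andP[d'0]; rewrite !lt_min => /and3P[dd1 dd2 dd4].
have n3 : \forall s \near s0, `|s - s0| < Num.min d1 d3.
  by apply/near_ball; exists (Num.min d1 d3); rewrite // lt_min d10.
have /h2 n2 : 0 < d' < d2 by rewrite d'0.
apply: filterS2 n2 n3 => s [t1 [t1d t1z -> _ _]]; rewrite lt_min => /andP[sd1 sd3] _.
rewrite if_same h1// ?h3// ?h4//; exact: lt_trans t1d _.
Qed.

Lemma plane_beta (s0 : R) v : tdet g s0 v = 0 -> exists x y : R,
  v = x *: g s0 + y *: derive1 g s0 /\ sgz (betag s0 v) = sgz y.
Proof.
rewrite tdetE => /(plane_coord (regular_free rg s0))[x [y E]]; exists x, y; split=> //.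
by rewrite E /betag beta_form_comb sgzM (gtr0_sgz (beta_form_r (regular_free rg s0))) mulr1.
Qed.

(** At a point at infinity of [g] the affine curve comes back from the other
    end of its asymptote, so that all points of the tangent change ends. *)
Lemma count_source_infinity (s0 t0 : R) : tdet g s0 (h t0) = 0 ->
  tdet g s0 (derive1 h t0) != 0 ->
  betag s0 (h t0) != 0 -> form l (g s0) = 0 -> form l (derive1 g s0) != 0 ->
  local_count (weight l g h) s0 t0 (-1) 1.
Proof.
move=> F0 p0 b0 lg lg'.
have [x [y [E bE]]] := plane_beta F0.
have lhE : form l (h t0) = y * form l (derive1 g s0).
  by rewrite E formD !formZ lg mulr0 add0r.
have y0 : y != 0 by rewrite -sgz_eq0 -bE sgz_eq0.
have lh : form l (h t0) != 0 by rewrite lhE mulf_neq0.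
have [d1 d10 h1] := box_sgz (phi := fun s t => betag s (h t))
  (cvg_beta_box (s0 := s0) (t0 := t0)) b0.
have [d2 d20 h2] := transversal_sum F0 p0.
have [d3 d30 h3] := form_simple_zero rg lg lg'.
have [d4 d40 h4] := form_sgz_const rh lh.
exists (Num.min d1 (Num.min d2 d4)); first by rewrite !lt_min d10 d20.
move=> d' /andP[d'0]; rewrite !lt_min => /and3P[dd1 dd2 dd4].
have n3 : \forall s \near s0, `|s - s0| < Num.min d1 d3.
  by apply/near_ball; exists (Num.min d1 d3); rewrite // lt_min d10.
have /h2 n2 : 0 < d' < d2 by rewrite d'0.
apply: filterS2 n2 n3 => s [t1 [t1d t1z -> _ _]]; rewrite lt_min => /andP[sd1 sd3] ss0.
rewrite h1 ?(lt_trans t1d dd1)// h3// h4 ?(lt_trans t1d dd4)// lhE bE sgzM.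
rewrite -(sgz_side 1 ss0) (_ : _ * _ = (sgz y * sgz y) *
  (sgz (form l (derive1 g s0)) * sgz (form l (derive1 g s0))) * sgz (s - s0)); last by ring.
by rewrite !mulz_sg y0 lg' !mulr1.
Qed.

Lemma convex_neq0 (e a b : R) : a < b -> convex_on g e a b -> e != 0.
Proof.
move=> ab /(_ a b); rewrite !lexx (ltW ab) lt_eqF// => /(_ isT isT isT).
by apply: contraTneq => ->; rewrite mul0r ltxx.
Qed.

Lemma convex_locally (e d s0 : R) : 0 < d -> convex_on g e (s0 - d) (s0 + d) ->
  locally_convex g s0 e e.
Proof.
move=> d0 cv; exists d => //; split; apply: convex_on_sub cv => //.
  by rewrite lerDl ltW.
by rewrite lerBlDr lerDl ltW.
Qed.

(** The rotation of the tangent, in terms of a single point of the tangent at [s0]. *)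
Lemma sweep_sign (s0 e d : R) v : 0 < d -> convex_on g e (s0 - d) (s0 + d) ->
  tdet g s0 v = 0 -> betag s0 v != 0 ->
  \forall s \near s0, s != s0 ->
    sgz (tdet g s v) = - (sgz e * sgz (betag s0 v) * sgz (s - s0)).
Proof.
move=> d0 cv F0 b0; have [x [y [E bE]]] := plane_beta F0.
have y0 : y != 0 by rewrite -sgz_eq0 -bE sgz_eq0.
have ny : 0 < `|y| by rewrite normr_gt0.
have [d1 d10 h1] := locally_convex_sweep rg `|x| (convex_locally d0 cv) ny.
have e0 : e != 0 by apply: (convex_neq0 _ cv); rewrite ltrD2l gtrN.
apply/near_ball; exists d1 => // s sd ss0.
have FE : tdet g s v = x * tdet g s (g s0) + y * tdet g s (derive1 g s0).
  by rewrite !tdetE E det3D !det3Z.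
rewrite (sgz_mulK _ e0) bE -mulrA -mulrN; congr (_ * _).
have sgN (a b : R) : 0 < - a -> 0 < b -> sgz a = - sgz b.
  by move=> a0 b0'; rewrite (gtr0_sgz b0') ltr0_sgz// -oppr_gt0.
have [y_lt|y_gt] : y < 0 \/ 0 < y by apply/orP; rewrite -neq_lt.
- have := h1 s sd (- x) (- y); rewrite normrN lexx ltr0_norm// lexx => /(_ isT isT).
  rewrite !mulNr -opprD -FE mulrN => -[hp hm].
  rewrite (ltr0_sgz y_lt) mulN1r opprK.
  move: ss0; rewrite neq_lt => /orP[lt|gt].
    by rewrite [RHS]ltr0_sgz ?subr_lt0// ltr0_sgz// -oppr_gt0; exact: hm.
  by rewrite [RHS]gtr0_sgz ?subr_gt0// gtr0_sgz// -oppr_lt0; exact: hp.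
- have := h1 s sd x y; rewrite lexx gtr0_norm// lexx => /(_ isT isT).
  rewrite -FE => -[hp hm].
  rewrite (gtr0_sgz y_gt) mul1r.
  move: ss0; rewrite neq_lt => /orP[lt|gt].
    by rewrite [in RHS]ltr0_sgz ?subr_lt0// gtr0_sgz//; exact: hm.
  by rewrite [in RHS]gtr0_sgz ?subr_gt0// ltr0_sgz//; exact: hp.
Qed.

(** When the tangent passes through the point at infinity of [h], its intersection
    with [h] jumps from one end of the asymptote to the other; the order of the two
    ends depends on the direction in which the tangent sweeps [h t0]. *)
Lemma count_target_infinity (s0 t0 e d : R) : 0 < d -> convex_on g e (s0 - d) (s0 + d) ->
  tdet g s0 (h t0) = 0 -> tdet g s0 (derive1 h t0) != 0 ->
  betag s0 (h t0) != 0 -> form l (g s0) != 0 ->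
  form l (h t0) = 0 -> form l (derive1 h t0) != 0 ->
  let j := sgz (form l (derive1 h t0)) * sgz (tdet g s0 (derive1 h t0)) *
           sgz e * sgz (form l (g s0)) in
  local_count (weight l g h) s0 t0 (- j) j.
Proof.
move=> d0 cv F0 p0 b0 lg lh lh' j.
have [d1 d10 h1] := box_sgz (phi := fun s t => betag s (h t))
  (cvg_beta_box (s0 := s0) (t0 := t0)) b0.
have [d2 d20 h2] := transversal_sum F0 p0.
have [d3 d30 h3] := form_sgz_const rg lg.
have [d4 d40 h4] := form_simple_zero rh lh lh'.
have n4 := sweep_sign d0 cv F0 b0.
exists (Num.min d1 (Num.min d2 d4)); first by rewrite !lt_min d10 d20.
move=> d' /andP[d'0]; rewrite !lt_min => /and3P[dd1 dd2 dd4].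
have n3 : \forall s \near s0, `|s - s0| < Num.min d1 d3.
  by apply/near_ball; exists (Num.min d1 d3); rewrite // lt_min d10.
have /h2 n2 : 0 < d' < d2 by rewrite d'0.
apply: filterS3 n2 n3 n4 => s [t1 [t1d t1z -> tE _]]; rewrite lt_min => /andP[sd1 sd3] FE ss0.
rewrite h1 ?(lt_trans t1d dd1)// h3// h4 ?(lt_trans t1d dd4)// tE (FE ss0).
rewrite -(sgz_side j ss0) /j.
move: (sgz (form l (g s0))) (sgz (form l (derive1 h t0))) (sgz e) (sgz (s - s0)) => a b c f.
move: (sgz (tdet _ _ _)) => p.
rewrite (_ : _ * _ = (sgz (betag s0 (h t0)) * sgz (betag s0 (h t0))) * (b * p * c * a * f));
  last by ring.
by rewrite mulz_sg b0 mul1r.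
Qed.

(** The zero [t1] is at distance O(s - s0) of [t0], and [h] leaves [h t0] in the
    direction [n]: in a coordinate transversal to [n], the point [h t1] has moved
    little with respect to [s - s0], while [g s] moves at a nonzero speed.  The other branch, at first
    ahead, is behind afterwards. *)
Lemma count_node (s0 t0 a0 : R) : a0 != 0 -> h t0 = a0 *: g s0 ->
  tdet g s0 (derive1 h t0) != 0 -> form l (g s0) != 0 ->
  local_count (weight l g h) s0 t0 1 (-1).
Proof.
move=> a00 hE p0 lg; set phi := tdet g s0 (derive1 h t0) in p0.
have F0 : tdet g s0 (h t0) = 0 by rewrite hE tdetE det3Z det3_uvu mulr0.
have lh : form l (h t0) != 0 by rewrite hE formZ mulf_neq0.
have p2 : 0 < phi ^+ 2 by rewrite lt_neqAle eq_sym sqrf_eq0 p0 sqr_ge0.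
pose n := derive1 h t0.
have gc := regular_continuous rg; have hc := regular_continuous rh.
have g'c := regular_C1 rg; have h'c := regular_C1 rh.
have [d1 d10 h1] : exists2 d, 0 < d & forall s t, `|s - s0| < d -> `|t - t0| < d ->
    sgz (det3 (g s) (derive1 g s) n) = sgz phi.
  apply: (@box_sgz _ _ _ (fun s t => det3 (g s) (derive1 g s) n)); last exact: p0.
  rewrite /phi tdetE; apply: cvg_det3; [apply: cvg_prod1; exact: gc|apply: cvg_prod1; exact: g'c|exact: cvg_cst].
have [d2 d20 h2] := transversal_sum F0 p0.
have [d3 d30 h3] := form_sgz_const rg lg.
have [d4 d40 h4] := form_sgz_const rh lh.
(* by the mean value theorem [h5] bounds by [|s - s0|] the equation of the tangent
   at [s], evaluated at [g s0]; [h6] and [h7] control the speeds of [h] and [g] in the coordinate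
   transversal to [n] *)
have [d5 d50 h5] : exists2 d, 0 < d & forall s u, `|s - s0| < d -> `|u - s0| < d ->
    `|tdet g s (derive1 g u)| < 1.
  apply: (@box_small _ _ _ (fun s u => tdet g s (derive1 g u)) (tdet g s0 (derive1 g s0))) => //.
    by apply: cvg_tdet_box; exact: g'c.
  by rewrite tdetE det3_uvv.
have [d6 d60 h6] : exists2 d, 0 < d & forall s t, `|s - s0| < d -> `|t - t0| < d ->
    `|det3 (g s) (derive1 h t) n| < phi ^+ 2 / 8.
  apply: (@box_small _ _ _ (fun s t => det3 (g s) (derive1 h t) n) (det3 (g s0) n n)).
  - by apply: cvg_det3; [apply: cvg_prod1; exact: gc|apply: cvg_prod2; exact: h'c|exact: cvg_cst].
  - by rewrite det3_uvv.
  - by rewrite divr_gt0.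
have [d7 d70 h7] : exists2 d, 0 < d & forall s u, `|s - s0| < d -> `|u - s0| < d ->
    phi ^+ 2 / 2 < phi * det3 (g s) (derive1 g u) n.
  apply: (@box_gt _ _ _ (fun s u => phi * det3 (g s) (derive1 g u) n) (phi * phi)).
    apply: cvgM; [exact: cvg_cst|rewrite /phi tdetE].
    by apply: cvg_det3; [apply: cvg_prod1; exact: gc|apply: cvg_prod2; exact: g'c|exact: cvg_cst].
  by rewrite -expr2 ltr_pdivrMr// ltr_pMr// ltr1n.
exists (Num.min d1 (Num.min d2 (Num.min d4 d6))); first by rewrite !lt_min d10 d20 d40.
move=> d' /andP[d'0]; rewrite !lt_min => /and4P[dd1 dd2 dd4 dd6].
pose D := Num.min d1 (Num.min d3 (Num.min d5 (Num.min d6 d7))).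
have n3 : \forall s \near s0, `|s - s0| < D.
  by apply/near_ball; exists D; rewrite // /D !lt_min d10 d30 d50 d60.
have /h2 n2 : 0 < d' < d2 by rewrite d'0.
apply: filterS2 n2 n3 => s [t1 [t1d t1z -> _ bd]].
rewrite /D !lt_min => /and5P[sd1 sd3 sd5 sd6 sd7] ss0.
have s0d d'' : 0 < d'' -> `|s0 - s0| < d'' by rewrite subrr normr0.
have t0d d'' : 0 < d'' -> `|t0 - t0| < d'' by rewrite subrr normr0.
have fE : tdet g s (h t0) = a0 * tdet g s (g s0) by rewrite hE !tdetE det3Z.
have GE v : form (cross n (g s)) v = det3 (g s) v n by rewrite -det3_form -det3_rot.
have A : `|tdet g s (g s0)| <= `|s - s0|.
  have := form_lipschitz rg (l := cross (g s) (derive1 g s)) (K := 1) sd5 (s0d _ d50) _.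
  rewrite -!det3_form det3_uvu subr0 -tdetE mul1r distrC; apply => u ud.
  by rewrite -det3_form -tdetE; exact: h5.
have B : `|det3 (g s) (h t1) n - det3 (g s) (h t0) n| <= phi ^+ 2 / 8 * `|t1 - t0|.
  have := form_lipschitz rh (l := cross n (g s)) (K := phi ^+ 2 / 8) (t0d _ d60) (lt_trans t1d dd6).
  by rewrite !GE; apply => t td; rewrite GE; exact: h6.
have Cc : phi ^+ 2 / 2 * (s - s0) ^+ 2 < (s0 - s) * (phi * det3 (g s) (g s0) n).
  have LE v : form (phi *: cross n (g s)) v = phi * det3 (g s) v n by rewrite formZl GE.
  have [lt|gt|eq] := ltgtP s s0; last by move: ss0; rewrite eq eqxx.
  - have := form_increasing_lb rg (l := phi *: cross n (g s)) (c := phi ^+ 2 / 2) lt.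
    rewrite !LE det3_uuv mulr0 subr0 => H.
    rewrite (_ : (s - s0) ^+ 2 = (s0 - s) * (s0 - s)); last by ring.
    rewrite mulrCA ltr_pM2l ?subr_gt0//; apply: H => u usd.
    by rewrite LE; apply: h7 => //; apply: distR_between sd7 (s0d _ d70) usd.
  - have := form_increasing_lb rg (l := phi *: cross n (g s)) (c := phi ^+ 2 / 2) gt.
    rewrite !LE det3_uuv mulr0 sub0r => H.
    rewrite (_ : (s0 - s) * _ = (s - s0) * - (phi * det3 (g s) (g s0) n)); last by ring.
    rewrite expr2 mulrCA ltr_pM2l ?subr_gt0//; apply: H => u usd.
    by rewrite LE; apply: h7 => //; apply: distR_between (s0d _ d70) sd7 usd.
have {}bd : phi ^+ 2 / 8 * `|t1 - t0| <= `|phi * a0| * `|s - s0| / 4.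
  have : phi ^+ 2 / 2 * `|t1 - t0| <= `|phi * a0| * `|s - s0|.
    apply: (le_trans bd); rewrite fE mulrA normrM; apply: ler_wpM2l => //.
  by move: (phi ^+ 2) `|t1 - t0| (`|phi * a0| * `|s - s0|) => x y z; lra.
have key : 0 < (s0 - s) * phi * a0 * det3 (g s) (h t1) n.
  have G0 : det3 (g s) (h t0) n = a0 * det3 (g s) (g s0) n.
    by rewrite hE det3Zm.
  have E : (s0 - s) * phi * a0 * det3 (g s) (h t1) n =
    a0 ^+ 2 * ((s0 - s) * (phi * det3 (g s) (g s0) n)) +
    (s0 - s) * (phi * a0) * (det3 (g s) (h t1) n - det3 (g s) (h t0) n).
    by rewrite G0; ring.
  rewrite E.
  have a02 : 0 < a0 ^+ 2 by rewrite lt_neqAle eq_sym sqrf_eq0 a00 sqr_ge0.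
  have e1 : a0 ^+ 2 * (phi ^+ 2 / 2 * (s - s0) ^+ 2) <
            a0 ^+ 2 * ((s0 - s) * (phi * det3 (g s) (g s0) n)).
    by rewrite ltr_pM2l.
  have e2 : `|(s0 - s) * (phi * a0) * (det3 (g s) (h t1) n - det3 (g s) (h t0) n)| <=
            (phi * a0 * (s - s0)) ^+ 2 / 4.
    rewrite normrM normrM distrC.
    apply: (le_trans (ler_wpM2l _ (le_trans B bd))); first by rewrite mulr_ge0.
    rewrite (_ : (phi * a0 * (s - s0)) ^+ 2 = (`|phi * a0| * `|s - s0|) ^+ 2); last first.
      by rewrite -normrM real_normK ?num_real.
    move: (`|phi * a0|) (`|s - s0|) => z1 z2.
    by rewrite (_ : z2 * z1 * _ = (z1 * z2) ^+ 2 / 4)//; field.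
  have e3 : (phi * a0 * (s - s0)) ^+ 2 / 4 <= a0 ^+ 2 * (phi ^+ 2 / 2 * (s - s0) ^+ 2).
    rewrite (_ : a0 ^+ 2 * _ = (phi * a0 * (s - s0)) ^+ 2 / 2); last by field.
    have := sqr_ge0 (phi * a0 * (s - s0)); move: (_ ^+ 2) => z z0; lra.
  move: e2; rewrite ler_norml => /andP[e2 _].
  have := le_lt_trans e3 e1; rewrite -subr_gt0 => /lt_le_trans; apply.
  by rewrite lerD2l.
(* the coordinate of [h t1] transversal to [n], with origin [g s], has the sign of
   the coefficient [y] that enters the weight *)
have [x [y [E bE]]] := plane_beta t1z.
have GE' : det3 (g s) (h t1) n = y * det3 (g s) (derive1 g s) n.
  by rewrite E det3Dm !det3Zm det3_uuv mulr0 add0r.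
have := gtr0_sgz key; rewrite GE' !sgzM (h1 s t0) ?t0d// => K.
rewrite bE (h3 s sd3) (h4 t1 (lt_trans t1d dd4)) hE formZ sgzM.
have -> : (if s0 < s then -1 else 1) = sgz (s0 - s).
  move: ss0; rewrite neq_lt => /orP[lt|gt].
    by rewrite ltNge ltW// gtr0_sgz// subr_gt0.
  by rewrite gt ltr0_sgz// subr_lt0.
have k1 : sgz (s0 - s) * sgz (s0 - s) = 1 by rewrite mulz_sg subr_eq0 eq_sym ss0.
have k3 : sgz (form l (g s0)) * sgz (form l (g s0)) = 1 by rewrite mulz_sg lg.
have k4 : sgz phi * sgz phi = 1 by rewrite mulz_sg p0.
have -> : sgz y * sgz (form l (g s0)) * (sgz a0 * sgz (form l (g s0))) =
  sgz (s0 - s) * (sgz (s0 - s) * sgz phi * sgz a0 * (sgz y * sgz phi)).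
  transitivity (sgz y * sgz a0 * (sgz (form l (g s0)) * sgz (form l (g s0)))); first by ring.
  transitivity ((sgz y * sgz a0) * (sgz (s0 - s) * sgz (s0 - s)) * (sgz phi * sgz phi)).
    by rewrite k1 k3 k4 !mulr1.
  by ring.
by rewrite K mulr1.
Qed.

End Transversal.

(** * Jumps of the count: flexes and bitangents *)

Section TangentialCounts.
Variable R : realType.
Variables (l : 'cV[R]_3) (g : R -> 'rV[R]_3).
Hypothesis rg : regular g.

Let betag s v := form (beta_form (g s) (derive1 g s)) v.

Lemma beta_sign (s0 : R) : exists2 d, 0 < d & forall s t, `|s - s0| < d -> `|t - s0| < d ->
  sgz (betag s (g t)) = sgz (t - s).
Proof.
have [d d0 hd] : exists2 d, 0 < d & forall s u, `|s - s0| < d -> `|u - s0| < d ->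
    0 < betag s (derive1 g u).
  apply: (@box_gt _ _ _ (fun s u => betag s (derive1 g u)) (betag s0 (derive1 g s0))).
    apply: cvg_beta.
    - by apply: cvg_prod1; exact: regular_continuous.
    - by apply: cvg_prod1; exact: regular_C1.
    - by apply: cvg_prod2; exact: regular_C1.
  exact: beta_form_r (regular_free rg s0).
exists d => // s t sd td.
have inc x y : `|x - s0| < d -> `|y - s0| < d -> x < y -> betag s (g x) < betag s (g y).
  move=> xd yd xy; apply: form_increasing => // u uxy.
  by apply: hd => //; apply: distR_between xd yd uxy.
have b0 : betag s (g s) = 0 by exact: beta_form_l.
have [lt|gt|->] := ltgtP t s; last by rewrite b0 subrr !sgz0.
  by have := inc t s td sd lt; rewrite b0 => bn; rewrite !ltr0_sgz ?subr_lt0.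
by have := inc s t sd td gt; rewrite b0 => bn; rewrite !gtr0_sgz ?subr_gt0.
Qed.

Lemma weight_same (s : R) : weight l g g s s = 0.
Proof. by rewrite /weight beta_form_l !mul0r sgz0 if_same. Qed.

Lemma count_self (s0 e d : R) : 0 < d -> convex_on g e (s0 - d) (s0 + d) ->
  local_count (weight l g g) s0 s0 0 0.
Proof.
move=> d0 cv; exists d => // d' /andP[d'0 d'd].
apply/near_ball; exists d => // s sd _; rewrite if_same; apply: fsbig1 => t td.
have [->|ts] := eqVneq t s; first exact: weight_same.
rewrite /weight; case: eqP => // F0.
have := cv s t; rewrite -!ler_distl !ltW//; last exact: lt_trans td d'd.
by move=> /(_ isT isT); rewrite eq_sym ts F0 mulr0 ltxx => /(_ isT).
Qed.

(** At a flex the tangent meets the curve again beyond the flex, always on the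
    side of the arc to come: ahead before the flex, behind after it. *)
Lemma count_flex (s0 em ep : R) : locally_convex g s0 em ep -> em * ep < 0 ->
  form l (g s0) != 0 -> local_count (weight l g g) s0 s0 1 (-1).
Proof.
move=> [d d0 [cm cp]] emp lg.
have [d1 d10 h1] := beta_sign s0; have [d2 d20 h2] := form_sgz_const rg lg.
exists (Num.min d (Num.min d1 d2)); first by rewrite !lt_min d0 d10.
move=> d' /andP[d'0]; rewrite !lt_min => /and3P[dd dd1 dd2].
have sl : s0 < s0 + d' by rewrite ltrDl.
have sr : s0 - d' < s0 by rewrite ltrBlDr ltrDl.
have ld : s0 - d <= s0 - d' by rewrite lerD2l lerN2 ltW.
have rd : s0 + d' <= s0 + d by rewrite lerD2l ltW.
have cm' : convex_on g em (s0 - d') s0 by apply: convex_on_sub cm.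
have cp' : convex_on g ep s0 (s0 + d') by apply: convex_on_sub cp.
have n1 : \forall s \near s0, 0 < ep * tdet g s (g (s0 + d')).
  apply: near_tdet => //; apply: cp'; rewrite ?lexx ?ltW//.
  by rewrite lt_eqF.
have n2 : \forall s \near s0, 0 < em * tdet g s (g (s0 - d')).
  apply: near_tdet => //; apply: cm'; rewrite ?lexx ?ltW//.
  by rewrite gt_eqF.
have n3 : \forall s \near s0, `|s - s0| < d' by apply/near_ball; exists d'.
have val s t : `|s - s0| < d' -> `|t - s0| < d' -> tdet g s (g t) = 0 ->
    weight l g g s t = sgz (t - s).
  move=> sd td F0; rewrite /weight F0 eqxx !sgzM.
  rewrite (h1 s t (lt_trans sd dd1) (lt_trans td dd1)).
  rewrite (h2 s (lt_trans sd dd2)) (h2 t (lt_trans td dd2)) -mulrA mulz_sg lg.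
  by rewrite mulr1.
have opp (x y : R) : 0 < em * x -> 0 < ep * y -> x * y < 0.
  move=> hx hy; have := mulr_gt0 hx hy; rewrite mulrACA.
  by rewrite nmulr_rgt0.
apply: filterS3 n1 n2 n3 => s Fp Fm sd; rewrite neq_lt => /orP[lt|gt].
- rewrite ltNge (ltW lt) /=.
  have hs : s0 - d' <= s <= s0 by move: sd; rewrite ltr_distl => /andP[h _]; rewrite !ltW.
  have F0 : 0 < em * tdet g s (g s0).
    by apply: cm' => //; rewrite ?lexx ?ltW// lt_eqF.
  have [|c /andP[c1 c2] [cz cu]] := convex_line_once rg sl cp'
      (l := cross (g s) (derive1 g s)).
    by rewrite -!det3_form -!tdetE; exact: opp.
  move: cz; rewrite -det3_form -tdetE => cz.
  have cd : `|c - s0| < d'.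
    by rewrite ltr_distl c2 andbT (lt_trans _ c1).
  rewrite (@sum_one _ _ _ c cd); first by rewrite val// gtr0_sgz// subr_gt0 (lt_trans lt).
  move=> t; rewrite /= ltr_distl => /andP[tl tu] tc.
  have [->|ts] := eqVneq t s; first exact: weight_same.
  rewrite /weight; case: eqP => // tz; exfalso.
  have [ts0|s0t] := leP t s0.
    have := cm' s t hs; rewrite ts0 ltW// => /(_ isT).
    by rewrite eq_sym ts tz mulr0 ltxx => /(_ isT).
  move/eqP: tc; apply; apply: cu; first by rewrite !ltW.
  by rewrite -det3_form -tdetE.
- rewrite gt.
  have hs : s0 <= s <= s0 + d' by move: sd; rewrite ltr_distl => /andP[_ h]; rewrite !ltW.
  have F0 : 0 < ep * tdet g s (g s0).
    by apply: cp' => //; rewrite ?lexx ?ltW// gt_eqF.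
  have [|c /andP[c1 c2] [cz cu]] := convex_line_once rg sr cm'
      (l := cross (g s) (derive1 g s)).
    by rewrite -!det3_form -!tdetE; exact: opp.
  move: cz; rewrite -det3_form -tdetE => cz.
  have cd : `|c - s0| < d'.
    by rewrite ltr_distl c1 (lt_trans c2).
  rewrite (@sum_one _ _ _ c cd); first by rewrite val// ltr0_sgz// subr_lt0 (lt_trans c2).
  move=> t; rewrite /= ltr_distl => /andP[tl tu] tc.
  have [->|ts] := eqVneq t s; first exact: weight_same.
  rewrite /weight; case: eqP => // tz; exfalso.
  have [s0t|ts0] := leP s0 t.
    have := cp' s t hs; rewrite s0t ltW// => /(_ isT).
    by rewrite eq_sym ts tz mulr0 ltxx => /(_ isT).
  move/eqP: tc; apply; apply: cu; first by rewrite !ltW.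
  by rewrite -det3_form -tdetE.
Qed.

Variable (h : R -> 'rV[R]_3).
Hypothesis rh : regular h.

(** As [s] passes a bitangent, the tangent is pushed, near [t0], to one side of
    the bitangent, then to the other: it meets the arc of [h] twice when this is the
    side of that arc, and does not meet it otherwise. *)
Lemma count_bitangent (s0 t0 e eh c d : R) : 0 < d ->
  convex_on g e (s0 - d) (s0 + d) -> convex_on h eh (t0 - d) (t0 + d) ->
  c != 0 -> (forall v, tdet g s0 v = c * tdet h t0 v) ->
  betag s0 (h t0) != 0 -> form l (g s0) != 0 -> form l (h t0) != 0 ->
  let w := sgz (betag s0 (h t0)) * sgz (form l (g s0)) * sgz (form l (h t0)) in
  let q := sgz e * sgz (betag s0 (h t0)) * sgz (c * eh) in
  local_count (weight l g h) s0 t0 (w * (1 - q)) (w * (1 + q)).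
Proof.
move=> d0 cg ch c0 tan b0 lg lh w q.
have F0 : tdet g s0 (h t0) = 0 by rewrite tan tdet_same mulr0.
have e0 : e != 0 by apply: (convex_neq0 _ cg); rewrite ltrD2l gtrN.
have eh0 : eh != 0 by apply: (convex_neq0 _ ch); rewrite ltrD2l gtrN.
pose k := c * eh; have k0 : k != 0 by rewrite mulf_neq0.
have [n Dn] := cross_neq0 (regular_free rg s0); set D := det3 _ _ n in Dn.
have DN0 : D != 0 by rewrite gt_eqF.
pose al t := det3 (h t) (derive1 g s0) n; pose be t := det3 (g s0) (h t) n.
pose ga t := tdet g s0 (h t).
have beE : sgz (be t0) = sgz (betag s0 (h t0)).
  have E := cramer_div (h t0) DN0.
  rewrite -/D -/(al t0) -/(be t0) -tdetE F0 mul0r scale0r addr0 in E.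
  rewrite /betag E beta_form_comb !sgzM (gtr0_sgz (beta_form_r (regular_free rg s0))).
  by rewrite (gtr0_sgz (x := D^-1)) ?invr_gt0// !mulr1.
have be0 : be t0 != 0 by rewrite -sgz_eq0 beE sgz_eq0.
have gc := regular_continuous rg; have hc := regular_continuous rh.
have hct : h @ t0 --> h t0 by exact: hc.
have gcs : g @ s0 --> g s0 by exact: gc.
have g'cs : derive1 g @ s0 --> derive1 g s0 by exact: regular_C1.
have cc v (x : R) := @cvg_const R v x.
have rel s t : D * tdet g s (h t) =
    al t * tdet g s (g s0) + be t * tdet g s (derive1 g s0) + ga t * det3 (g s) (derive1 g s) n.
  have := cramer (g s0) (derive1 g s0) n (h t).
  move=> /(congr1 (form (cross (g s) (derive1 g s)))).
  by rewrite !formD !formZ -!det3_form -!tdetE !(tdetE _ _ n).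
have m0 : 0 < `|be t0| / 2 by rewrite divr_gt0// normr_gt0.
have [d1 d10 h1] := locally_convex_sweep rg (`|al t0| + 1) (convex_locally d0 cg) m0.
have [d2 d20 h2] := box_sgz (phi := fun s t => betag s (h t))
  (cvg_beta_box rg rh (s0 := s0) (t0 := t0)) b0.
have [d3 d30 h3] := form_sgz_const rg lg; have [d4 d40 h4] := form_sgz_const rh lh.
have n5 : \forall s \near s0, 0 < det3 (g s) (derive1 g s) n.
  exact: (near_det3 gcs g'cs (cc n s0)).
have [d6 d60 h6] : exists2 d, 0 < d & forall t, `|t - t0| < d -> `|al t| <= `|al t0| + 1.
  have := cvg_det3 (nbhs_filter t0) hct (cc (derive1 g s0) t0) (cc n t0).
  move=> /cvgr_norm_lt/(_ (`|al t0| + 1)); rewrite ltrDl => /(_ ltr01)/near_ball[d'' d''0 hd].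
  by exists d'' => // t /hd/ltW.
have [d7 d70 h7] : exists2 d, 0 < d & forall t, `|t - t0| < d -> `|be t0| / 2 < Num.sg (be t0) * be t.
  have bc := cvg_det3 (nbhs_filter t0) (cc (g s0) t0) hct (cc n t0).
  have cv : (fun t => Num.sg (be t0) * be t) @ t0 --> Num.sg (be t0) * be t0.
    by apply: cvgM; [exact: cvg_cst|exact: bc].
  apply/near_ball; apply: (cvgr_gt _ cv).
  by rewrite -normrEsg ltr_pdivrMr ?ltr_pMr ?ltr1n// normr_gt0.
have sw s t : `|s - s0| < d1 -> `|t - t0| < Num.min d6 d7 -> s != s0 ->
    sgz (e * (al t * tdet g s (g s0) + be t * tdet g s (derive1 g s0))) =
    - (sgz (be t0) * sgz (s - s0)).
  rewrite lt_min => sd /andP[td6 td7] ss0.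
  have := h1 s sd (Num.sg (be t0) * al t) (Num.sg (be t0) * be t).
  rewrite normrM normr_sg be0 mul1r => /(_ (h6 t td6) (ltW (h7 t td7))).
  rewrite -!mulrA -mulrDr !(mulrCA e) => -[hp hm].
  move: (e * _) hp hm => P hp hm; move: ss0; rewrite neq_lt => /orP[lt|gt].
    rewrite (ltr0_sgz (x := s - s0)) ?subr_lt0// mulrN1 opprK.
    have [bn|bp] : be t0 < 0 \/ 0 < be t0 by apply/orP; rewrite -neq_lt.
      by move: (hm lt); rewrite ltr0_sg// mulN1r oppr_gt0 => Pn; rewrite (ltr0_sgz Pn) (ltr0_sgz bn).
    by move: (hm lt); rewrite gtr0_sg// mul1r => Pp; rewrite (gtr0_sgz Pp) (gtr0_sgz bp).
  rewrite (gtr0_sgz (x := s - s0)) ?subr_gt0// mulr1.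
  have [bn|bp] : be t0 < 0 \/ 0 < be t0 by apply/orP; rewrite -neq_lt.
    by move: (hp gt); rewrite ltr0_sg// mulN1r oppr_lt0 => Pp; rewrite (gtr0_sgz Pp) (ltr0_sgz bn) opprK.
  by move: (hp gt); rewrite gtr0_sg// mul1r => Pn; rewrite (ltr0_sgz Pn) (gtr0_sgz bp).
have kga t : `|t - t0| < d -> t != t0 -> 0 < k * ga t.
  move=> td tt0; rewrite /k /ga tan mulrACA -expr2 (_ : c ^+ 2 = c * c)// -mulrA.
  rewrite mulrA -expr2 pmulr_rgt0; last by rewrite lt_neqAle eq_sym sqrf_eq0 c0 sqr_ge0.
  apply: ch; rewrite -?ler_distl ?subrr ?normr0 ?ltW//; by rewrite eq_sym.
have ga0 : ga t0 = 0 by exact: F0.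
(* the sign of the sweep decides between no zero and two zeros *)
have sw' s t : `|s - s0| < d1 -> `|t - t0| < Num.min d6 d7 -> s != s0 ->
    sgz (k * (al t * tdet g s (g s0) + be t * tdet g s (derive1 g s0))) =
    - (q * sgz (s - s0)).
  move=> sd td ss0; rewrite sgzM [X in _ * X = _](sgz_mulK _ e0) (sw s t sd td ss0) beE /q /k; ring.
exists (Num.min d (Num.min d2 (Num.min d4 (Num.min d6 d7)))).
  by rewrite !lt_min d0 d20 d40 d60.
move=> d' /andP[d'0]; rewrite !lt_min => /and5P[dd dd2 dd4 dd6 dd7].
have dd67 : d' < Num.min d6 d7 by rewrite lt_min dd6.
have n3 : \forall s \near s0, `|s - s0| < Num.min d1 (Num.min d2 d3).
  by apply/near_ball; exists (Num.min d1 (Num.min d2 d3)); rewrite // !lt_min d10 d20.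
have tl : t0 - d' < t0 by rewrite ltrBlDr ltrDl.
have tr : t0 < t0 + d' by rewrite ltrDl.
have tle : t0 - d <= t0 - d' by rewrite lerD2l lerN2 ltW.
have tre : t0 + d' <= t0 + d by rewrite lerD2l ltW.
have chl : convex_on h eh (t0 - d') t0.
  by apply: convex_on_sub ch => //; rewrite (le_trans _ tre)// ltW.
have chr : convex_on h eh t0 (t0 + d').
  by apply: convex_on_sub ch => //; rewrite (le_trans tle)// ltW.
have n1 : \forall s \near s0, 0 < k * tdet g s (h (t0 - d')).
  apply: near_tdet => //; apply: kga; last by rewrite lt_eqF.
  by rewrite addrAC subrr add0r normrN gtr0_norm.
have n2 : \forall s \near s0, 0 < k * tdet g s (h (t0 + d')).
  apply: near_tdet => //; apply: kga; last by rewrite gt_eqF.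
  by rewrite addrAC subrr add0r gtr0_norm.
apply: filterS3 (filterI n1 n2) n3 n5 => s [F1 F2]; rewrite !lt_min => /and3P[sd1 sd2 sd3] E ss0.
have qE : q = 1 \/ q = -1.
  have : q * q = 1.
    rewrite /q (_ : _ * _ = (sgz e * sgz e) * (sgz (betag s0 (h t0)) * sgz (betag s0 (h t0))) *
      (sgz (c * eh) * sgz (c * eh))); last by ring.
    by rewrite !mulz_sg e0 b0 k0.
  move=> /eqP; rewrite -expr2 sqrf_eq1 => /orP[]/eqP; by [left|right].
have relk t : D * (k * tdet g s (h t)) =
    k * (al t * tdet g s (g s0) + be t * tdet g s (derive1 g s0)) +
    k * ga t * det3 (g s) (derive1 g s) n.
  by rewrite mulrCA rel; ring.
have none : q * sgz (s - s0) = -1 ->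
    \sum_(t \in [set t | `|t - t0| < d']) weight l g h s t = 0.
  move=> qs; apply: fsbig1 => t td; rewrite /weight; case: eqP => // tz; exfalso.
  have /eqP := sw' s t sd1 (lt_trans td dd67) ss0.
  rewrite qs opprK sgz_cp0 => P0.
  have := relk t; rewrite tz !mulr0 => /esym/eqP; rewrite paddr_eq0 ?(ltW P0)//.
    by rewrite (gt_eqF P0).
  have [->|tt0] := eqVneq t t0; first by rewrite ga0 mulr0 mul0r.
  by rewrite ltW// mulr_gt0// kga// (lt_trans td).
have two : q * sgz (s - s0) = 1 ->
    \sum_(t \in [set t | `|t - t0| < d']) weight l g h s t = w + w.
  move=> qs.
  have F3 : k * tdet g s (h t0) < 0.
    have t00 : `|t0 - t0| < Num.min d6 d7 by rewrite subrr normr0 lt_min d60 d70.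
    have /eqP := sw' s t0 sd1 t00 ss0.
    by rewrite qs sgz_cp0 => P0; rewrite -(pmulr_rlt0 _ Dn) relk ga0 mulr0 mul0r addr0.
  have k2 : 0 < k ^+ 2 by rewrite lt_neqAle eq_sym sqrf_eq0 k0 sqr_ge0.
  have opp x y : 0 < k * x -> k * y < 0 -> x * y < 0.
    by move=> kx ky; rewrite -(pmulr_rlt0 _ k2) expr2 mulrACA pmulr_rlt0.
  have [|a /andP[a1 a2] [az au]] := convex_line_once rh tl chl (l := cross (g s) (derive1 g s)).
    by rewrite -!det3_form -!tdetE; exact: opp.
  have [|b /andP[b1 b2] [bz bu]] := convex_line_once rh tr chr (l := cross (g s) (derive1 g s)).
    by rewrite -!det3_form -!tdetE mulrC; exact: opp.
  move: az bz; rewrite -!det3_form -!tdetE => az bz.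
  have ad : `|a - t0| < d' by rewrite ltr_distl a1 (lt_trans a2).
  have bd : `|b - t0| < d' by rewrite ltr_distl b2 andbT (lt_trans _ b1).
  have val t : `|t - t0| < d' -> tdet g s (h t) = 0 -> weight l g h s t = w.
    move=> td tz; rewrite /weight tz eqxx !sgzM /w.
    by rewrite (h2 s t sd2 (lt_trans td dd2)) (h3 s sd3) (h4 t (lt_trans td dd4)).
  rewrite (@sum_two _ _ _ a b ad bd).
  - by rewrite !val.
  - by rewrite lt_eqF// (lt_trans a2).
  - move=> t; rewrite /= ltr_distl => /andP[t1 t2] ta tb; rewrite /weight.
    case: eqP => // tz; exfalso; have [tt0|t0t] := leP t t0.
      by move/eqP: ta; apply; apply: au; rewrite ?tt0 ?ltW// -det3_form -tdetE.
    by move/eqP: tb; apply; apply: bu; rewrite ?ltW// -det3_form -tdetE.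
move: ss0 none two; rewrite neq_lt => /orP[lt|gt].
  rewrite (ltr0_sgz (x := s - s0)) ?subr_lt0// mulrN1 ltNge ltW//=.
  case: qE => ->; rewrite ?opprK => none two; first by rewrite none// subrr mulr0.
  by rewrite two// mulrDr mulr1.
rewrite (gtr0_sgz (x := s - s0)) ?subr_gt0// mulr1 gt.
case: qE => -> none two; first by rewrite two// mulrDr mulr1.
by rewrite none// subrr mulr0.
Qed.

End TangentialCounts.

(** * Step functions on the circle *)

Section FiniteSums.
Variables (T : choiceType) (V : zmodType).
Implicit Types (A B D : set T) (f : T -> V).

Definition supp_in f D : set T := D `&` f @^-1` [set~ 0].

Lemma fsum_union f A B D : D = A `|` B -> A `&` B `<=` set0 ->
  finite_set (supp_in f A) -> finite_set (supp_in f B) ->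
  \sum_(x \in D) f x = \sum_(x \in A) f x + \sum_(x \in B) f x.
Proof.
move=> -> AB fA fB.
rewrite [LHS]fsbig_supp [X in X + _]fsbig_supp [X in _ + X]fsbig_supp setIUl.
rewrite fsbigU0// => x [[Ax _] [Bx _]]; exact: AB.
Qed.

Lemma supp_in_union f A B : supp_in f (A `|` B) = supp_in f A `|` supp_in f B.
Proof. exact: setIUl. Qed.

End FiniteSums.

Section StepFunctions.
Variable R : realType.
Implicit Types (f L : R -> int).

(** Real induction, in the form of a step across an arbitrary point [x]: the set of
    the points reached has a supremum, and the step at this supremum goes beyond
    it. *)
Lemma interval_induction (P : R -> Prop) : P 0 ->
  (forall x, 0 <= x <= 1 -> exists2 d, 0 < d & forall a b, 0 <= a -> b <= 1 ->
     x - d < a -> a <= x -> x <= b -> b < x + d -> P a -> P b) -> P 1.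
Proof.
move=> P0 step; pose A := [set x : R | 0 <= x <= 1 /\ P x].
have A0 : A 0 by split=> //; rewrite lexx ler01.
have ubA : has_ubound A by exists 1 => x [/andP[]].
have hs : has_sup A by split=> //; exists 0.
pose x := sup A.
have x0 : 0 <= x by apply: ub_le_sup.
have x1 : x <= 1 by apply: ge_sup; [exists 0|move=> y [/andP[]]].
have [|d d0 hd] := step x; first by rewrite x0.
have [a [/andP[a0 a1] Pa] xa] := sup_adherent d0 hs.
have ax : a <= x by apply: ub_le_sup => //; split=> //; rewrite a0.
pose b := Num.min 1 (x + d / 2).
have b1 : b <= 1 by rewrite ge_min lexx.
have xb : x <= b by rewrite le_min x1 lerDl divr_ge0// ltW.
have bd : b < x + d.
  by rewrite gt_min; apply/orP; right; rewrite ltrD2l ltr_pdivrMr// ltr_pMr// ltr1n.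
have Pb : P b by exact: hd Pa.
have : b <= x by apply: ub_le_sup => //; split=> //; rewrite b1 (le_trans x0).
rewrite ge_min gerDl => /orP[x1'|]; last by rewrite leNgt divr_gt0.
by move: Pb; rewrite /b min_l// (le_trans x1')// lerDl divr_ge0// ltW.
Qed.

Definition step_at f (s0 : R) (vm vp : int) : Prop :=
  \forall s \near s0, s != s0 -> f s = if s0 < s then vp else vm.

Lemma step_atP f s0 vm vp : step_at f s0 vm vp <-> exists2 d, 0 < d &
  (forall s, s0 - d < s -> s < s0 -> f s = vm) /\
  (forall s, s0 < s -> s < s0 + d -> f s = vp).
Proof.
split=> [/near_ball[d d0 hd]|[d d0 [hm hp]]].
- exists d => //; split=> s s1 s2.
    rewrite hd ?ltr_distl ?lt_eqF//; first by rewrite ltNge ltW.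
    by apply/andP; split; lra.
  rewrite hd ?ltr_distl ?gt_eqF ?s1//.
  by apply/andP; split; lra.
- apply/near_ball; exists d => // s; rewrite ltr_distl => /andP[s1 s2].
  rewrite neq_lt => /orP[lt|gt]; first by rewrite hm// ltNge ltW.
  by rewrite hp// gt.
Qed.

Lemma step_at_unique f s0 vm vp wm wp : step_at f s0 vm vp -> step_at f s0 wm wp ->
  vm = wm /\ vp = wp.
Proof.
move=> /step_atP[d d0 [hm hp]] /step_atP[e e0 [km kp]].
pose r := Num.min d e / 2.
have me : 0 < Num.min d e by rewrite lt_min d0.
have r0 : 0 < r by rewrite divr_gt0.
have re : r < Num.min d e by rewrite ltr_pdivrMr// ltr_pMr// ltr1n.
have {re} [rd re] : r < d /\ r < e by apply/andP; rewrite -lt_min.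
have l : s0 - r < s0 by rewrite ltrBlDr ltrDl.
have u : s0 < s0 + r by rewrite ltrDl.
split.
  by rewrite -(hm (s0 - r)) ?ltrD2l ?ltrN2// -(km (s0 - r)) ?ltrD2l ?ltrN2.
by rewrite -(hp (s0 + r)) ?ltrD2l// -(kp (s0 + r)) ?ltrD2l.
Qed.

(** The jumps telescope; that only finitely many are nonzero is part of the
    induction, the sum being otherwise zero by convention. *)
Lemma step_sum f L (L' : R -> int) :
  (forall s, 0 <= s <= 1 -> step_at f s (L s) (L' s)) ->
  finite_set (supp_in (fun s => L' s - L s) [set s | 0 <= s < 1]) /\
  \sum_(s \in [set s | 0 <= s < 1]) (L' s - L s) = L 1 - L 0.
Proof.
move=> st; pose J s := L' s - L s.
apply: (@interval_induction (fun x => finite_set (supp_in J [set s | 0 <= s < x]) /\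
  \sum_(s \in [set s | 0 <= s < x]) J s = L x - L 0)).
  have -> : [set s : R | 0 <= s < 0] = set0.
    by apply/seteqP; split=> // s /= /andP[s0 /(le_lt_trans s0)]; rewrite ltxx.
  by rewrite /supp_in set0I subrr fsbig_set0; split.
move=> x x01; have /step_atP[d d0 [hm hp]] := st x x01.
exists d => // a b a0 b1 xa ax xb bx [fina suma].
have loc s v r : 0 < r -> (forall t, s - r < t -> t < s + r -> f t = v) -> step_at f s v v.
  by move=> r0 hr; apply/step_atP; exists r => //; split=> t t1 t2; apply: hr => //; lra.
have left s : x - d < s -> s < x -> 0 <= s -> L s = L x /\ L' s = L x.
  move=> s1 s2 s0; have s01 : 0 <= s <= 1 by move: x01 => /andP[? ?]; apply/andP; split; lra.
  apply: (step_at_unique (st s s01)).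
  have [r [r0 r1 r2]] : exists r : R, [/\ 0 < r, r <= s - (x - d) & r <= x - s].
    exists (Num.min (s - (x - d)) (x - s)).
    by rewrite lt_min !subr_gt0 s1 s2 !ge_min !lexx orbT.
  by apply: (loc _ _ r r0) => t t1 t2; apply: hm; lra.
have right s : x < s -> s < x + d -> s <= 1 -> L s = L' x /\ L' s = L' x.
  move=> s1 s2 s3; have s01 : 0 <= s <= 1 by move: x01 => /andP[? ?]; apply/andP; split; lra.
  apply: (step_at_unique (st s s01)).
  have [r [r0 r1 r2]] : exists r : R, [/\ 0 < r, r <= x + d - s & r <= s - x].
    exists (Num.min (x + d - s) (s - x)).
    by rewrite lt_min !subr_gt0 s1 s2 !ge_min !lexx orbT.
  by apply: (loc _ _ r r0) => t t1 t2; apply: hp; lra.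
have LaE : L a = L x.
  by move: ax; rewrite le_eqVlt => /orP[/eqP ->//|ax']; apply: (left a _ _ _).1.
have D : [set s | 0 <= s < b] = [set s | 0 <= s < a] `|` [set s | a <= s < b].
  apply/seteqP; split=> s /=.
    by move=> /andP[s0 sb]; have [sa|as_] := ltP s a; [left; rewrite s0|right].
  by move=> [|] /andP[s1 s2]; apply/andP; split => //; lra.
have disj : [set s | 0 <= s < a] `&` [set s | a <= s < b] `<=` set0.
  by move=> s [/= /andP[_ sa] /andP[as_ _]]; move: sa; rewrite ltNge as_.
have J0 s : a <= s < b -> s != x -> J s = 0.
  move=> /andP[as_ sb]; rewrite neq_lt /J => /orP[sx|xs].
    by have [|||-> ->] := left s => //; rewrite ?subrr//; lra.
  by have [|||-> ->] := right s => //; rewrite ?subrr//; lra.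
have fin : finite_set (supp_in J [set s | a <= s < b]).
  apply: (@sub_finite_set _ _ [set x]); last exact: finite_set1.
  by move=> s [/= sab /eqP Js]; apply/eqP; apply: contraNT Js => /(J0 s sab) ->.
split; first by rewrite D supp_in_union finite_setU.
rewrite (fsum_union D disj fina fin) suma.
have -> : \sum_(s \in [set s | a <= s < b]) J s = L b - L a; last by rewrite addrC subrKA.
move: xb; rewrite le_eqVlt => /orP[/eqP xb|xb].
  rewrite -xb LaE subrr; apply: fsbig1 => s sab; apply: J0; rewrite -?xb//.
  by move: sab => /= /andP[_]; rewrite xb => h; rewrite lt_eqF.
rewrite (@sum_one _ _ _ x) /=; last exact: J0.
  by have [->] := right b xb bx b1; rewrite LaE.
by rewrite ax.
Qed.

(** After one turn the function is back to its initial value. *)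
Lemma step_circle f L (L' : R -> int) : (forall s, f (s + 1) = f s) ->
  (forall s, 0 <= s < 1 -> step_at f s (L s) (L' s)) ->
  finite_set (supp_in (fun s => L' s - L s) [set s | 0 <= s < 1]) /\
  \sum_(s \in [set s | 0 <= s < 1]) (L' s - L s) = 0.
Proof.
move=> per st; pose w (K : R -> int) s := if s == 1 then K 0 else K s.
have [|fin sum] := @step_sum f (w L) (w L').
  move=> s /andP[s0 s1]; rewrite /w; case: eqP => [->|/eqP sN1]; last first.
    by apply: st; rewrite s0 lt_neqAle sN1.
  have /step_atP[d d0 [hm hp]] := st 0 (introT andP (conj (lexx _) ltr01)).
  apply/step_atP; exists d => //; split=> t t1 t2.
    by rewrite -(hm (t - 1)) -?(per (t - 1)) ?subrK//; lra.
  by rewrite -(hp (t - 1)) -?(per (t - 1)) ?subrK//; lra.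
have E s : 0 <= s < 1 -> w L' s - w L s = L' s - L s.
  by move=> /andP[_ s1]; rewrite /w lt_eqF.
split.
  apply: sub_finite_set fin => s [/= hs]; split=> //=.
  by rewrite E.
have {}sum : \sum_(s \in [set s | 0 <= s < 1]) (w L' s - w L s) = 0.
  by rewrite sum /w eqxx eq_sym oner_eq0 subrr.
rewrite -[RHS]sum; apply: eq_fsbigr => s; rewrite inE => hs.
by rewrite E.
Qed.

End StepFunctions.

Section CircleSums.
Variable R : realType.

Lemma periodic_int (T : Type) (f : R -> T) : (forall t, f (t + 1) = f t) ->
  forall t (k : int), f (t + k%:~R) = f t.
Proof.
move=> per; have pn t (n : nat) : f (t + n%:R) = f t.
  by elim: n => [|n IH]; rewrite ?addr0// -natr1 addrA per.
move=> t [n|n]; first exact: pn.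
by rewrite NegzE mulrNz -(pn _ n.+1) subrK.
Qed.

Lemma circle_shift (V : zmodType) (f : R -> V) c : (forall t, f (t + 1) = f t) ->
  \sum_(t \in [set t | 0 <= t < 1]) f t = \sum_(t \in [set t | c <= t < c + 1]) f t.
Proof.
move=> per; pose fr t : R := t + (- Num.floor t)%:~R.
rewrite (reindex_fsbig fr [set t | c <= t < c + 1]).
  by apply: eq_fsbigr => t _; rewrite /fr periodic_int.
split.
- move=> t _ /=; rewrite /fr mulrNz subr_ge0 floor_le /= ltrBlDl.
  by have := floorD1_gt t; rewrite intrD mulr1z.
- move=> t u; rewrite !inE /= => /andP[t1 t2] /andP[u1 u2]; rewrite /fr => E.
  have D : t - u = (Num.floor t - Num.floor u)%:~R by rewrite intrB; move: E; rewrite !mulrNz; lra.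
  have l1 : t - u < 1 by lra.
  have l2 : - 1 < t - u by lra.
  move: l1 l2; rewrite D -[1]/(1%:~R) -mulrNz !ltr_int => l1 l2.
  have z : Num.floor t - Num.floor u = 0 by lia.
  by move: D; rewrite z => /eqP; rewrite subr_eq0 => /eqP.
- move=> y /= /andP[y0 y1]; exists (y + (- Num.floor (y - c))%:~R).
    have := floor_itv (y - c); rewrite intrD mulr1z => /andP[h1 h2].
    by rewrite mulrNz; apply/andP; split; lra.
  rewrite /fr; set k := - Num.floor (y - c).
  rewrite floorDrz ?rpred_int// intrKfloor.
  have -> : Num.floor y = 0 by apply/eqP; rewrite floor_eq add0r y0.
  by rewrite add0r -addrA -intrD subrr addr0.
Qed.

End CircleSums.

(** * The total count is a step function *)

Section CountLimit.
Variable R : realType.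

Lemma near_seq (T : eqType) (U : Type) (F : set_system U) (r : seq T) (P : T -> U -> Prop) :
  Filter F -> (forall x, x \in r -> \forall u \near F, P x u) ->
  \forall u \near F, forall x, x \in r -> P x u.
Proof.
move=> FF; elim: r => [|x r IH] h; first by apply: filterE.
have h1 := h x (mem_head _ _).
have h2 : \forall u \near F, forall y, y \in r -> P y u.
  by apply: IH => y yr; apply: h; rewrite in_cons yr orbT.
apply: filterS2 h1 h2 => u Px Pr y; rewrite in_cons => /orP[/eqP ->//|]; exact: Pr.
Qed.

(** The classes of [t] and [z] in the circle R/Z are at distance less than [d]. *)
Definition circle_close (d t z : R) : Prop := exists k : int, `|t - z + k%:~R| < d.

Lemma circle_close_trans d t z z' : circle_close d t z -> circle_close d t z' ->
  circle_close (d + d) z z'.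
Proof.
move=> [k hk] [k' hk']; exists (k' - k).
have -> : z - z' + (k' - k)%:~R = (t - z' + k'%:~R) - (t - z + k%:~R).
  by rewrite intrB; ring.
by apply: le_lt_trans (ler_normB _ _) _; exact: ltrD.
Qed.

Lemma circle_separated z z' : 0 <= z < 1 -> 0 <= z' < 1 -> z != z' ->
  exists2 d, 0 < d & ~ circle_close d z z'.
Proof.
move=> /andP[z0 z1] /andP[z'0 z'1] zz'.
have u1 : `|z - z'| < 1 by rewrite ltr_norml; apply/andP; split; lra.
exists (Num.min `|z - z'| (1 - `|z - z'|)).
  by rewrite lt_min normr_gt0 subr_eq0 zz' subr_gt0.
move=> [k]; rewrite lt_min => /andP[h1 h2].
have [k0|k0] := eqVneq k 0; first by move: h1; rewrite k0 addr0 ltxx.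
have : 1 <= `|k%:~R : R| by rewrite -intr_norm ler1z; lia.
have := lerB_dist (k%:~R : R) (- (z - z')); rewrite opprK normrN [k%:~R + _]addrC.
by lra.
Qed.

Lemma circle_closeDr d t z : circle_close d (t + 1) z <-> circle_close d t z.
Proof.
split=> -[k hk].
  exists (k + 1); move: hk.
  by rewrite intrD mulr1z (_ : t + 1 - z + k%:~R = t - z + (k%:~R + 1)); last ring.
exists (k - 1); move: hk.
by rewrite intrB mulr1z (_ : t + 1 - z + (k%:~R - 1) = t - z + k%:~R); last ring.
Qed.

Lemma circle_close_near d t z : d <= 1 / 2 -> z - 1 / 2 <= t < z - 1 / 2 + 1 ->
  circle_close d t z <-> `|t - z| < d.
Proof.
move=> d1 /andP[t1 t2]; split=> [[k]|h]; last by exists 0; rewrite addr0.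
rewrite ltr_norml => /andP[h1 h2].
have [k0|k0|k0] := ltgtP k 0.
- have : (k + 1)%:~R <= 0 :> R by rewrite lerz0; lia.
  by rewrite intrD mulr1z; lra.
- have : 0 <= (k - 1)%:~R :> R by rewrite ler0z; lia.
  by rewrite intrB mulr1z; lra.
- by rewrite ltr_norml; move: h1 h2; rewrite k0 addr0 => -> ->.
Qed.

Variables (F : R -> R -> R) (W : R -> R -> int) (s0 : R) (wm wp : R -> int).
Hypothesis contF : forall t,
  (fun p : R * R => F p.1 p.2) @ filter_prod (nbhs s0) (nbhs t) --> F s0 t.
Hypothesis perF : forall s t, (F s (t + 1) == 0) = (F s t == 0).
Hypothesis perW : forall s t, W s (t + 1) = W s t.
Hypothesis suppW : forall s t, F s t != 0 -> W s t = 0.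
Hypothesis finF : forall s, finite_set [set t | 0 <= t < 1 /\ F s t = 0].
Hypothesis loc : forall t, 0 <= t < 1 -> F s0 t = 0 -> local_count W s0 t (wm t) (wp t).
Hypothesis wm0 : forall t, F s0 t != 0 -> wm t = 0.
Hypothesis wp0 : forall t, F s0 t != 0 -> wp t = 0.

Let I := [set t : R | 0 <= t < 1].
Let Z := [set t | 0 <= t < 1 /\ F s0 t = 0].

(** The zeros of [F s] converge to those of [F s0] by compactness of the circle, so
    that the sum over the circle is the sum of the local counts. *)
Lemma count_limit :
  step_at (fun s => \sum_(t \in I) W s t) s0 (\sum_(t \in I) wm t) (\sum_(t \in I) wp t).
Proof.
have finZ : finite_set Z by exact: finF.
have [r Zr] := (finite_seqP _).1 finZ.
have rP z : z \in r -> 0 <= z < 1 /\ F s0 z = 0.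
  by move=> zr; have : [set` r] z by []; rewrite -Zr.
have right_lt (d : R) : 0 < d -> \forall e \near 0^'+, 0 < e < d.
  by move=> d0; apply/near_right; exists d => // e e0; rewrite add0r => ed; rewrite e0.
have n1 : \forall e \near 0^'+, forall z, z \in r ->
    \forall s \near s0, s != s0 ->
      \sum_(t \in [set t | `|t - z| < e]) W s t = if s0 < s then wp z else wm z.
  apply: near_seq => z /rP[zI zZ]; have [d d0 hd] := loc zI zZ.
  by apply: filterS (right_lt d d0) => e; exact: hd.
have n2 : \forall e \near 0^'+, forall z, z \in r -> forall z', z' \in r -> z != z' ->
    ~ circle_close (e + e) z z'.
  apply: near_seq => z /rP[zI _]; apply: near_seq => z' /rP[z'I _].
  have [->|zz'] := eqVneq z z'; first by apply: filterE.
  have [d d0 hd] := circle_separated zI z'I zz'.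
  have d2 : 0 < d / 2 by rewrite divr_gt0.
  apply: filterS (right_lt _ d2) => e /andP[e0 ed] _ [k hk].
  by apply: hd; exists k; apply: lt_trans hk _; lra.
have half0 : 0 < 1 / 2 :> R by rewrite divr_gt0.
have [d [[h1 h2] /andP[d0 dh]]] : exists d : R, ((forall z, z \in r ->
    \forall s \near s0, s != s0 ->
      \sum_(t \in [set t | `|t - z| < d]) W s t = if s0 < s then wp z else wm z) /\
    (forall z, z \in r -> forall z', z' \in r -> z != z' ->
    ~ circle_close (d + d) z z')) /\ 0 < d < 1 / 2.
  have [d /= hd] := filter_ex (filterI (filterI n1 n2) (right_lt _ half0)).
  by exists d.
have {}h1 := near_seq (nbhs_filter s0) h1.
have tube : \forall s \near s0, forall t, `[0, 1]%classic t ->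
    F s t = 0 -> exists2 z, z \in r & circle_close d t z.
  have /compact_near_coveringP K := @segment_compact R 0 1.
  apply: (K _ (nbhs s0) (fun s t => F s t = 0 -> exists2 z, z \in r & circle_close d t z)).
  move=> x /=; rewrite in_itv /= => /andP[x0 x1].
  have [Fx|Fx] := eqVneq (F s0 x) 0; last first.
    have [e e0 he] := box_sgz (contF (t := x)) Fx.
    exists (ball x e, ball s0 e); first by split; exact: nbhsx_ballx.
    move=> [t s] /= [xt ss]; rewrite /ball /= in xt ss.
    move=> /eqP; rewrite -sgz_eq0 he 1?distrC//.
    by rewrite sgz_eq0 (negbTE Fx).
  have [z zr zx] : exists2 z, z \in r & circle_close d x z /\ exists k : int, x - z + k%:~R = 0.
    move: x1; rewrite le_eqVlt => /orP[/eqP x1|x1].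
      exists 0; last first.
        by split; exists (-1); rewrite x1 subr0 mulrNz subrr ?normr0.
      suff : [set` r] 0 by []. 
      rewrite -Zr; split; first by rewrite lexx ltr01.
      by apply/eqP; rewrite -perF add0r -x1 Fx.
    exists x; last by split; exists 0; rewrite subrr addr0 ?normr0.
    by suff : [set` r] x by []; rewrite -Zr; split => //; rewrite x0.
  have [_ [k hk]] := zx.
  exists (ball x d, setT); first by split; [exact: nbhsx_ballx|exact: filterT].
  move=> [t s] /= [xt _] _; exists z => //; exists k.
  rewrite (_ : _ + _ = t - x + (x - z + k%:~R)); last by ring.
  by rewrite hk addr0 distrC.
apply: filterS2 h1 tube => s h1 tube ss0.
pose Q := [set t | 0 <= t < 1 /\ F s t = 0].
have QE : \sum_(t \in I) W s t = \sum_(t \in Q) W s t.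
  apply/esym/fsbig_widen; first by move=> t [].
  move=> t [tI nQ]; apply: suppW; apply/eqP => Ft; exact: nQ.
pose c z t := if `[< circle_close d t z >] then W s t else 0.
have cE t : Q t -> W s t = \sum_(z \in Z) c z t.
  move=> [tI Ft]; have [|z zr tz] := tube t _ Ft.
    by move: tI => /andP[t0 t1]; rewrite /= in_itv /= t0 ltW.
  have Zz : Z z by rewrite Zr.
  rewrite (sum_one Zz); first by rewrite /c asboolT.
  move=> z'; rewrite Zr /= => z'r zz'; rewrite /c asboolF// => tz'.
  by apply: (h2 z' z'r z zr zz'); exact: circle_close_trans tz' tz.
rewrite QE (eq_fsbigr (fun t => \sum_(z \in Z) c z t)); last by move=> t; rewrite inE => /cE.
rewrite exchange_fsbig; [|exact: finF|exact: finZ].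
have cper z t : c z (t + 1) = c z t.
  by rewrite /c perW; congr (if _ then _ else _); apply: asbool_equiv_eq; exact: circle_closeDr.
have sumc z : z \in r -> \sum_(t \in Q) c z t = if s0 < s then wp z else wm z.
  move=> zr; rewrite -(h1 z zr ss0).
  transitivity (\sum_(t \in I) c z t).
    apply: fsbig_widen; first by move=> t [].
    move=> t [tI nQ]; rewrite /= /c suppW ?if_same//; apply/eqP => Ft; exact: nQ.
  rewrite (circle_shift (z - 1 / 2) (cper z)).
  transitivity (\sum_(t \in [set t | `|t - z| < d]) c z t).
    apply/esym/fsbig_widen.
      move=> t /=; rewrite ltr_distl => /andP[t1 t2]; apply/andP; split; lra.
    move=> t [/= tI nt]; rewrite /c asboolF//.
    by move=> /(circle_close_near (ltW dh) tI).
  apply: eq_fsbigr => t; rewrite inE /= => tz; rewrite /c asboolT//.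
  by exists 0; rewrite addr0.
rewrite (eq_fsbigr (fun z => if s0 < s then wp z else wm z)); last first.
  by move=> z; rewrite inE Zr /=; exact: sumc.
by case: ifP => _; apply: fsbig_widen => [t []//|t [tI nZ]]; [apply: wp0|apply: wm0];
  apply/eqP => Ft; exact: nZ.
Qed.

End CountLimit.

(** * The height of a point at infinity *)

Section Folds.
Variable R : realType.
Variables (l : 'cV[R]_3) (g h : R -> 'rV[R]_3).
Hypotheses (rg : regular g) (rh : regular h).
Variable t0 : R.
Hypotheses (lh : form l (h t0) = 0) (lh' : form l (derive1 h t0) != 0).

Let betag s v := form (beta_form (g s) (derive1 g s)) v.

(** In affine coordinates where [h t0] is the direction of the x-axis and the
    asymptote of [h] is y = 0, this is the sign of y y' along [g], up to a sign that
    depends only on [h]: y' vanishes when the tangent to [g] passes through [h t0],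
    y vanishes on the asymptote, and y becomes infinite with [g]. *)
Definition height_step (s : R) : int :=
  sgz (form l (derive1 h t0) * tdet g s (h t0) * tdet h t0 (g s) * form l (g s)).

Lemma tdet_sgz_const (s0 : R) v : tdet g s0 v != 0 ->
  \forall s \near s0, sgz (tdet g s v) = sgz (tdet g s0 v).
Proof.
move=> F0; have c : (fun s => tdet g s v) @ s0 --> tdet g s0 v by exact: tdet_continuous.
exact: (cvg_sgz _ F0 c).
Qed.

Lemma step_at_side (f : R -> int) (s0 : R) (X : int) :
  (\forall s \near s0, s != s0 -> f s = X * sgz (s - s0)) -> step_at f s0 (- X) X.
Proof. by apply: filterS => s hs ss0; rewrite hs// sgz_side. Qed.

Lemma near_form_const (m : 'cV[R]_3) (s0 : R) : form m (g s0) != 0 ->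
  \forall s \near s0, sgz (form m (g s)) = sgz (form m (g s0)).
Proof. by move=> /(form_sgz_const rg)[d d0 hd]; apply/near_ball; exists d. Qed.

Lemma near_form_zero (m : 'cV[R]_3) (s0 : R) : form m (g s0) = 0 -> form m (derive1 g s0) != 0 ->
  \forall s \near s0, sgz (form m (g s)) = sgz (form m (derive1 g s0)) * sgz (s - s0).
Proof.
by move=> h0 /(form_simple_zero rg h0)[d d0 hd]; apply/near_ball; exists d.
Qed.

Let m := cross (h t0) (derive1 h t0).
Let mE v : tdet h t0 v = form m v. Proof. by rewrite tdetE det3_form. Qed.

Lemma height_const (s0 : R) : tdet g s0 (h t0) != 0 -> tdet h t0 (g s0) != 0 ->
  form l (g s0) != 0 -> step_at height_step s0 (height_step s0) (height_step s0).
Proof.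
rewrite mE => F0 m0 l0.
apply: filterS3 (tdet_sgz_const F0) (near_form_const m0) (near_form_const l0) => s E1 E2 E3 _.
by rewrite if_same /height_step !sgzM !mE E1 E2 E3.
Qed.

Lemma height_cross (s0 : R) : tdet g s0 (h t0) != 0 -> tdet h t0 (g s0) = 0 ->
  form l (g s0) != 0 -> step_at height_step s0 (-1) 1.
Proof.
rewrite mE => F0 m0 l0.
have [x [y E]] := plane_coord (regular_free rh t0) (etrans (det3_form _ _ _) m0).
have lE : form l (g s0) = y * form l (derive1 h t0).
  by rewrite E formD !formZ lh mulr0 add0r.
have FE : tdet g s0 (h t0) = y * form m (derive1 g s0).
  rewrite tdetE /m -det3_form {1}E det3Dl !det3Zl det3_uvu mulr0 add0r; congr (_ * _).
  by rewrite det3_rot.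
have y0 : y != 0 by apply: contraNneq l0 => y0; rewrite lE y0 mul0r.
have m1 : form m (derive1 g s0) != 0 by apply: contraNneq F0 => m1; rewrite FE m1 mulr0.
apply: step_at_side.
apply: filterS3 (tdet_sgz_const F0) (near_form_zero m0 m1) (near_form_const l0) => s E1 E2 E3 _.
rewrite /height_step !sgzM !mE E1 E2 E3 lE FE !sgzM mul1r.
rewrite (_ : _ * _ = (sgz (form l (derive1 h t0)) * sgz (form l (derive1 h t0))) *
  (sgz y * sgz y) * (sgz (form m (derive1 g s0)) * sgz (form m (derive1 g s0))) * sgz (s - s0));
  last by ring.
by rewrite !mulz_sg lh' y0 m1 !mulr1 mul1r.
Qed.

Lemma height_infinity (s0 : R) : tdet g s0 (h t0) != 0 -> tdet h t0 (g s0) != 0 ->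
  form l (g s0) = 0 -> step_at height_step s0 1 (-1).
Proof.
rewrite mE => F0 m0 l0.
(* l is a multiple of the equation of the line through g s0 and h t0 *)
have D0 : det3 (g s0) (h t0) (derive1 g s0) != 0.
  by rewrite det3_swap -tdetE oppr_eq0.
have l1 : form l (derive1 g s0) != 0.
  apply: contraNneq lh' => l1.
  by rewrite (cramer_div (derive1 h t0) D0) !formD !formZ l0 lh l1 !mulr0 !addr0.
have lE : det3 (g s0) (h t0) (derive1 g s0) * form l (derive1 h t0) =
          form m (g s0) * form l (derive1 g s0).
  have := cramer (g s0) (h t0) (derive1 g s0) (derive1 h t0).
  move=> /(congr1 (form l)); rewrite !formD !formZ l0 lh !mulr0 !add0r => ->.
  by rewrite /m -det3_form -(det3_rot (g s0)).
have FE : tdet g s0 (h t0) = - det3 (g s0) (h t0) (derive1 g s0) by rewrite det3_swap opprK tdetE.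
rewrite -[1]opprK; apply: step_at_side.
apply: filterS3 (tdet_sgz_const F0) (near_form_const m0) (near_form_zero l0 l1) => s E1 E2 E3 _.
rewrite /height_step !sgzM !mE E1 E2 E3 mulN1r.
have -> : sgz (tdet g s0 (h t0)) = - sgz (det3 (g s0) (h t0) (derive1 g s0)) by rewrite FE sgzN.
have := congr1 (@sgz R) lE; rewrite !sgzM.
move: (sgz (det3 _ _ _)) (sgz (form l (derive1 h t0))) => a b ab.
have {}ab : a * b * (sgz (form m (g s0)) * sgz (form l (derive1 g s0))) = 1.
  by rewrite ab mulrACA !mulz_sg m0 l1.
rewrite -[RHS]mulN1r -ab; ring.
Qed.

(** The sign of the jump of the count at a tangent to [g] through the point at
    infinity [h t0] is not determined by the configuration; but the height has the
    opposite jump. *)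
Lemma height_fold (s0 e d : R) : 0 < d -> convex_on g e (s0 - d) (s0 + d) ->
  tdet g s0 (h t0) = 0 -> tdet g s0 (derive1 h t0) != 0 ->
  betag s0 (h t0) != 0 -> form l (g s0) != 0 ->
  exists2 j, local_count (weight l g h) s0 t0 (- j) j & step_at height_step s0 j (- j).
Proof.
move=> d0 cv F0 p0 b0 lg.
pose j := sgz (form l (derive1 h t0)) * sgz (tdet g s0 (derive1 h t0)) *
          sgz e * sgz (form l (g s0)).
exists j; first exact: (count_target_infinity rg rh d0 cv F0 p0 b0 lg lh lh').
have [x [y [E bE]]] := plane_beta rg F0.
have m0E : form m (g s0) = y * tdet g s0 (derive1 h t0).
  by rewrite /m -det3_form E det3Dl !det3Zl det3_uvu mulr0 add0r det3_rot -tdetE.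
have y0 : y != 0 by rewrite -sgz_eq0 -bE sgz_eq0.
have m0 : form m (g s0) != 0 by rewrite m0E mulf_neq0.
rewrite -{1}[j]opprK; apply: step_at_side.
apply: filterS3 (sweep_sign rg d0 cv F0 b0) (near_form_const m0) (near_form_const lg) => s E1 E2 E3 ss0.
rewrite /height_step !sgzM !mE (E1 ss0) E2 E3 bE m0E sgzM /j.
rewrite (_ : _ * _ = - ((sgz y * sgz y) * (sgz (form l (derive1 h t0)) *
  sgz (tdet g s0 (derive1 h t0)) * sgz e * sgz (form l (g s0))) * sgz (s - s0))); last by ring.
by rewrite mulz_sg y0 mul1r mulNr.
Qed.

End Folds.

Section SelfFold.
Variable R : realType.
Variables (l : 'cV[R]_3) (g : R -> 'rV[R]_3) (rg : regular g).

(** By convexity the two determinants have the same sign, before [s0] as well as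
    after: only the value of [l] makes the product change sign. *)
Lemma height_self (s0 e d : R) : 0 < d -> convex_on g e (s0 - d) (s0 + d) ->
  form l (g s0) = 0 -> form l (derive1 g s0) != 0 ->
  step_at (height_step l g g s0) s0 (-1) 1.
Proof.
move=> d0 cv l0 l1; apply: step_at_side.
have n3 : \forall s \near s0, `|s - s0| < d by apply/near_ball; exists d.
apply: filterS2 (near_form_zero rg l0 l1) n3 => s E sd ss0.
have hs : s0 - d <= s <= s0 + d by rewrite -ler_distl ltW.
have h0 : s0 - d <= s0 <= s0 + d by rewrite -ler_distl subrr normr0 ltW.
have e0 : e != 0 by apply: (convex_neq0 _ cv); rewrite ltrD2l gtrN.
have F1 := gtr0_sgz (cv _ _ hs h0 ss0).
have F2 : sgz (e * tdet g s0 (g s)) = 1 by apply/gtr0_sgz/cv; rewrite // eq_sym.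
rewrite /height_step !sgzM (sgz_mulK (tdet g s (g s0)) e0) F1.
rewrite (sgz_mulK (tdet g s0 (g s)) e0) F2 E.
rewrite (_ : _ * _ = (sgz (form l (derive1 g s0)) * sgz (form l (derive1 g s0))) *
  (sgz e * sgz e) * sgz (s - s0)); last by ring.
by rewrite !mulz_sg l1 e0.
Qed.

End SelfFold.

(** * Counting pairs of points *)

Definition ind (P : Prop) : int := if `[< P >] then 1 else 0.

Lemma indT (P : Prop) : P -> ind P = 1. Proof. by move=> p; rewrite /ind asboolT. Qed.
Lemma indF (P : Prop) : ~ P -> ind P = 0. Proof. by move=> p; rewrite /ind asboolF. Qed.

Section PairCounting.
Variable T : choiceType.
Implicit Types (r : seq T) (A N : set T) (x y : T).

Lemma sum_ind_mul r A (f : T -> int) : uniq r -> (forall x, A x -> x \in r) ->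
  \sum_(x <- r) ind (A x) * f x = \sum_(x \in A) f x.
Proof.
move=> ur Ar; have finA : finite_set A.
  by apply: sub_finite_set (finite_seq r) => x /Ar.
transitivity (\sum_(x <- r | `[< A x >]) f x).
  by rewrite [RHS]big_mkcond; apply: eq_bigr => x _; rewrite /ind; case: ifP; rewrite ?mul1r ?mul0r.
rewrite -big_filter fsbig_finite//; apply: perm_big.
apply: uniq_perm; rewrite ?filter_uniq ?fset_uniq// => x.
rewrite mem_filter in_fset_set//.
by case: asboolP => [Ax|nA]; [rewrite Ar// mem_set|rewrite memNset].
Qed.

Lemma sum_ind r A : uniq r -> (forall x, A x -> x \in r) ->
  \sum_(x <- r) ind (A x) = #|` fset_set A|%:Z.
Proof.
move=> ur Ar; have finA : finite_set A.
  by apply: sub_finite_set (finite_seq r) => x /Ar.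
under eq_bigr do rewrite -[ind _]mulr1.
rewrite (sum_ind_mul (fun=> 1) ur Ar) fsbig_finite// big_const_seq count_predT.
by rewrite iter_addr_0 -natz.
Qed.

Lemma sum_diagonal r (f : T -> int) : uniq r ->
  \sum_(x <- r) \sum_(y <- r) (if x == y then f x else 0) = \sum_(x <- r) f x.
Proof.
move=> ur; apply: eq_big_seq => x xr.
by rewrite (bigD1_seq x)//= eqxx big1 ?addr0// => y; rewrite eq_sym => /negbTE ->.
Qed.

Lemma sum_off_diagonal r A (B : T -> set T) : uniq r -> (forall x, A x -> x \in r) ->
  (forall x y, A x -> B x y -> y \in r) -> (forall x, A x -> B x x) ->
  \sum_(x <- r) \sum_(y <- r) ind (x <> y /\ A x /\ B x y)
  = \sum_(x \in A) (#|` fset_set (B x)|%:Z - 1).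
Proof.
move=> ur Ar Br Bxx; rewrite -(sum_ind_mul _ ur Ar); apply: eq_big_seq => x xr.
have [Ax|nA] := pselect (A x); last first.
  by rewrite (indF nA) mul0r big1// => y _; apply: indF => -[_ []].
rewrite (indT Ax) mul1r -(sum_ind ur (fun y => Br x y Ax)) (bigD1_seq x)//=.
rewrite [in RHS](bigD1_seq x)//= (indT (Bxx x Ax)) indF; last by case.
rewrite add0r addrAC subrr add0r; apply: eq_bigr => y yx; rewrite /ind.
congr (if _ then _ else _); apply: asbool_equiv_eq; split=> [[_ []]//|h].
by split=> // xy; move: yx; rewrite xy eqxx.
Qed.

(** A point of [U] with two preimages in [N] contributes two ordered pairs of
    distinct points with the same image. *)
Lemma sum_double_pairs (U : choiceType) (p : T -> U) (f : U -> int) N r :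
  let D := [set d | exists x y, [/\ N x, N y, x <> y, p x = d & p y = d]] in
  (forall x y z, N x -> N y -> N z -> x <> y -> y <> z -> x <> z ->
    ~ (p x = p y /\ p y = p z)) ->
  finite_set D -> uniq r -> (forall x, x \in r -> N x) ->
  (forall x, N x -> D (p x) -> x \in r) ->
  \sum_(x <- r) \sum_(y <- r) (if `[< x <> y /\ p x = p y >] then f (p x) else 0)
  = 2 * \sum_(d \in D) f d.
Proof.
move=> D three finD ur rN Dr.
transitivity (\sum_(x <- r) \sum_(y <- r) \sum_(d <- fset_set D)
    (if [&& x != y, p x == d & p y == d] then f d else 0)).
  apply: eq_big_seq => x xr; apply: eq_big_seq => y yr.
  case: asboolP => [[xy pxy]|h].
    have Dx : D (p x) by exists x, y; split=> //; exact: rN.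
    rewrite (bigD1_seq (p x)) ?fset_uniq//=; last by rewrite in_fset_set// inE.
    rewrite eqxx -pxy eqxx (introN eqP xy) /= big1 ?addr0// => d dx.
    by rewrite eq_sym (negbTE dx).
  rewrite big1// => d _; case: ifP => // /and3P[/eqP xy /eqP h1 /eqP h2].
  by case: h; split=> //; rewrite h1.
under eq_bigr do rewrite exchange_big /=.
rewrite exchange_big /= fsbig_finite// mulr_sumr; apply: eq_big_seq => d.
rewrite in_fset_set// inE => Dd; have [x [y [Nx Ny xy px py]]] := Dd.
have xr : x \in r by apply: Dr => //; rewrite px.
have yr : y \in r by apply: Dr => //; rewrite py.
have inner z w : z \in r -> w \in r -> z <> w -> p z = d -> p w = d ->
    (forall v, v \in r -> p v = d -> v = z \/ v = w) ->
    \sum_(v <- r) (if [&& z != v, p z == d & p v == d] then f d else 0) = f d.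
  move=> zr wr zw pz pw two; rewrite (bigD1_seq w)//= (introN eqP zw) pz pw eqxx /=.
  rewrite big_seq_cond big1 ?addr0// => v /andP[vr vw]; case: ifP => // /andP[zv /eqP pv].
  by have [h|h] := two v vr pv; [move: zv|move: vw]; rewrite h eqxx.
have two v : v \in r -> p v = d -> v = x \/ v = y.
  move=> vr pv; apply: contrapT => /not_orP[vx vy].
  by apply: (three v x y (rN v vr) Nx Ny vx xy vy); split; [rewrite pv|rewrite px].
have twoC v : v \in r -> p v = d -> v = y \/ v = x.
  by move=> vr pv; apply/or_comm; exact: two.
rewrite (bigD1_seq x)//= (inner x y)// -big_filter (bigD1_seq y) ?filter_uniq//=; last first.
  by rewrite mem_filter yr andbT eq_sym (introN eqP xy).
rewrite (inner y x)//; last exact: nesym.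
rewrite big_filter_cond big_seq_cond big1 ?addr0; first by rewrite mulrDl mul1r.
move=> v /and3P[vr vx vy]; apply: big1 => w _; case: ifP => // /and3P[_ /eqP pv _].
by have [h|h] := two v vr pv; [move: vx|move: vy]; rewrite h eqxx.
Qed.

End PairCounting.

Section JumpTable.
Variables (T U : choiceType) (N F M : set T) (B : T -> set T) (p q : T -> U) (sg : U -> int).
Hypotheses (FN : F `<=` N) (MN : M `<=` N) (BN : forall x, B x `<=` N).
Hypotheses (finF : finite_set F) (finM : finite_set M) (finB : forall x, finite_set (B x)).
Hypothesis Bxx : forall x, M x -> B x x.

Definition doubles (f : T -> U) : set U :=
  [set d | exists x y, [/\ N x, N y, x <> y, f x = d & f y = d]].

Definition no_triple (f : T -> U) := forall x y z, N x -> N y -> N z ->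
  x <> y -> y <> z -> x <> z -> ~ (f x = f y /\ f y = f z).

Hypotheses (finp : finite_set (doubles p)) (finq : finite_set (doubles q)).
Hypotheses (triplep : no_triple p) (tripleq : no_triple q).

(** Here [N] stands for the points of the curve, [F] for its flexes, [M] for its
    points at infinity, [B x] for the points on the tangent at [x], while [p] and [q]
    are the maps to points and to tangents, so that nodes and bitangents are the
    values that [p] and [q] take twice. *)
Definition jump_table (x y : T) : int :=
  if x == y then - 2 * ind (F x) + 2 * ind (M x)
  else - 2 * ind (p x = p y)
    + 2 * (if `[< q x = q y >] then sg (q x) else 0)
    + 2 * ind (M x /\ B x y)
    + 2 * ind (M y /\ B y x)
    - 2 * ind (M x /\ M y).

Lemma finite_double (f : T -> U) : finite_set (doubles f) -> no_triple f ->
  finite_set [set x | N x /\ doubles f (f x)].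
Proof.
move=> fin three.
apply: (@sub_finite_set _ _ (\bigcup_(d in doubles f) [set x | N x /\ f x = d])).
  by move=> x [Nx Dx]; exists (f x).
apply: bigcup_finite => // d [x [y [Nx Ny xy fx fy]]].
apply: (@sub_finite_set _ _ ([set x] `|` [set y])).
  move=> z [Nz fz]; apply: contrapT => /not_orP[/= zx zy].
  by apply: (three z x y) => //; split; [rewrite fz|rewrite fx].
by rewrite finite_setU.
Qed.

Lemma jump_tableE x y : jump_table x y =
  - 2 * (if x == y then ind (F x) else 0) + 2 * (if x == y then ind (M x) else 0)
  - 2 * (if `[< x <> y /\ p x = p y >] then 1 else 0)
  + 2 * (if `[< x <> y /\ q x = q y >] then sg (q x) else 0)
  + 2 * ind (x <> y /\ M x /\ B x y) + 2 * ind (y <> x /\ M y /\ B y x)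
  - 2 * ind (x <> y /\ M x /\ M y).
Proof.
rewrite /jump_table; have [->|xy] := eqVneq x y.
  have e (P : Prop) : `[< y <> y /\ P >] = false by apply: asboolF; case.
  by rewrite /ind !e; ring.
have e (P : Prop) (z w : T) : z != w -> `[< z <> w /\ P >] = `[< P >].
  by move=> /eqP zw; apply: asbool_equiv_eq; split=> [[]|].
by rewrite /ind !e// 1?eq_sym//; ring.
Qed.

(** A node and a bitangent come from two ordered pairs each, which doubles their
    coefficient; the two terms with [B] are exchanged by [(x, y) |-> (y, x)]. *)
Lemma sum_jump_table : \sum_(x \in N) \sum_(y \in N) jump_table x y =
  - 2 * #|` fset_set F|%:Z + 2 * #|` fset_set M|%:Z
  - 4 * #|` fset_set (doubles p)|%:Z + 4 * \sum_(d \in doubles q) sg d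
  + 4 * \sum_(x \in M) (#|` fset_set (B x)|%:Z - 1)
  - 2 * (#|` fset_set M|%:Z * (#|` fset_set M|%:Z - 1)).
Proof.
pose X := F `|` M `|` [set x | N x /\ doubles p (p x)] `|` [set x | N x /\ doubles q (q x)]
  `|` \bigcup_(x in M) B x.
have finX : finite_set X.
  rewrite !finite_setU; split; last exact: bigcup_finite.
  by split; [split; [split|]|]; try exact: finite_double.
have XN : X `<=` N.
  by move=> x [[[[/FN|/MN]|[]]|[]]|[z _ /BN]].
pose r := fset_set X.
have rP x : (x \in r) = (x \in X) by rewrite in_fset_set.
have ur : uniq r by exact: fset_uniq.
have rN x : x \in r -> N x by rewrite rP inE; exact: XN.
have Fr x : F x -> x \in r by rewrite rP inE => h; do 4 left.
have Mr x : M x -> x \in r by rewrite rP inE => h; do 3 left; right.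
have pr x : N x -> doubles p (p x) -> x \in r.
  by move=> Nx h; rewrite rP inE; do 2 left; right.
have qr x : N x -> doubles q (q x) -> x \in r.
  by move=> Nx h; rewrite rP inE; left; right.
have Br x y : M x -> B x y -> y \in r by move=> Mx h; rewrite rP inE; right; exists x.
have zero x y : N x -> N y -> ~ (X x /\ X y) -> jump_table x y = 0.
  move=> Nx Ny h; have {}h : ~ (x \in r /\ y \in r) by rewrite !rP !inE.
  rewrite jump_tableE.
  have dbl (f : T -> U) : x <> y -> f x = f y -> doubles f (f x) /\ doubles f (f y).
    by move=> xy fxy; split; exists x, y; split.
  have h1 : ~ (x <> y /\ p x = p y).
    by move=> [xy /(dbl p xy)[h1 h2]]; apply: h; split; exact: pr.
  have h2 : ~ (x <> y /\ q x = q y).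
    by move=> [xy /(dbl q xy)[h2 h3]]; apply: h; split; exact: qr.
  have h3 : ~ (x <> y /\ M x /\ B x y).
    by move=> [_ [mx b]]; apply: h; split; [exact: Mr|exact: Br mx b].
  have h4 : ~ (y <> x /\ M y /\ B y x).
    by move=> [_ [my b]]; apply: h; split; [exact: Br my b|exact: Mr].
  have h5 : ~ (x <> y /\ M x /\ M y).
    by move=> [_ [mx my]]; apply: h; split; exact: Mr.
  rewrite (asboolF h1) (asboolF h2) (indF h3) (indF h4) (indF h5).
  have [xy|xy] := eqVneq x y; last by ring.
  rewrite !indF; first by ring.
    by move=> mx; apply: h; rewrite -xy; split; exact: Mr.
  by move=> fx; apply: h; rewrite -xy; split; exact: Fr.
transitivity (\sum_(x <- r) \sum_(y <- r) jump_table x y).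
  rewrite -(@fsbig_widen _ _ _ _ X N)//; last first.
    by move=> x [/= Nx nX]; apply: fsbig1 => y Ny; apply: zero => // -[].
  rewrite fsbig_finite//; apply: eq_big_seq => x; rewrite -/r rP inE => Xx.
  rewrite -(@fsbig_widen _ _ _ _ X N) ?fsbig_finite//.
  by move=> y [/= Ny nX]; apply: zero => //; [exact: XN|case].
under eq_bigr => x _ do under eq_bigr => y _ do rewrite jump_tableE.
under eq_bigr => x _ do rewrite !(big_split, sumrB, sumrN) /= -?mulr_sumr.
set S := \sum_(x \in M) _; rewrite !(big_split, sumrB, sumrN) /= -?mulr_sumr.
have sp := @sum_double_pairs _ _ p (fun=> 1) N r triplep finp ur rN pr.
have sq := @sum_double_pairs _ _ q sg N r tripleq finq ur rN qr.
have sM := @sum_off_diagonal _ r M (fun=> M) ur Mr (fun x y _ => Mr y) (fun x h => h).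
have sB := sum_off_diagonal ur Mr Br Bxx.
have dF := sum_diagonal (fun x => ind (F x)) ur.
have dM := sum_diagonal (fun x => ind (M x)) ur.
have nF := sum_ind ur Fr; have nM := sum_ind ur Mr.
have sB' : \sum_(x <- r) \sum_(y <- r) ind (y <> x /\ M y /\ B y x) = S.
  by rewrite exchange_big.
have cst (V : choiceType) (A : set V) (c : int) : finite_set A ->
    \sum_(v \in A) c = #|` fset_set A|%:Z * c.
  move=> finA; rewrite fsbig_finite// big_const_seq count_predT iter_addr_0.
  by rewrite -mulr_natl natz.
rewrite sp sq sM sB sB' dF dM nF nM !cst// -/S -/(doubles p) -/(doubles q).
by ring.
Qed.

End JumpTable.

(** * Points and tangents of a projective curve *)

(** [teq x] is an equation of the tangent at [x]; on this tangent, [beta x] has the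
    sign of the coordinate along the velocity [vel x]. *)
HB.lock Definition pos (R : realType) (C : curve R) (x : 'I_(ncomp C) * R) : 'rV[R]_3 :=
  lift x.1 x.2.
HB.lock Definition vel (R : realType) (C : curve R) (x : 'I_(ncomp C) * R) : 'rV[R]_3 :=
  derive1 (lift x.1) x.2.
HB.lock Definition teq (R : realType) (C : curve R) (x : 'I_(ncomp C) * R) v : R :=
  tdet (lift x.1) x.2 v.
HB.lock Definition beta (R : realType) (C : curve R) (x : 'I_(ncomp C) * R) v : R :=
  form (beta_form (lift x.1 x.2) (derive1 (lift x.1) x.2)) v.

Section Dictionary.
Variable R : realType.
Implicit Types (v : 'rV[R]_3) (l m : 'cV[R]_3).

Lemma same_kernel l m : (forall v, (form l v == 0) = (form m v == 0)) ->
  exists2 k : R, k != 0 & forall v, form m v = k * form l v.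
Proof.
move=> lm; have [[n ln]|l0] := pselect (exists n, form l n != 0); last first.
  exists 1 => [|v]; first exact: oner_neq0.
  have lv : form l v == 0 by apply: contrapT => /negP h; apply: l0; exists v.
  by move: (lv); rewrite lm => /eqP ->; rewrite (eqP lv) mulr0.
have mn : form m n != 0 by rewrite -lm.
exists (form m n / form l n) => [|v]; first by rewrite mulf_neq0// invr_eq0.
have : form m (v - (form l v / form l n) *: n) == 0.
  by rewrite -lm formB formZ divfK// subrr.
by rewrite formB formZ subr_eq0 => /eqP ->; rewrite mulrAC [RHS]mulrAC (mulrC (form l v)).
Qed.

Lemma line_equation (L : {vspace 'rV[R]_3}) : \dim L = 2%N ->
  exists2 l, equation L l & exists n, form l n != 0.
Proof.
move=> dL; have := vbasisP L; rewrite /basis_of => /andP[/eqP sL fL].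
have sz : size (vbasis L) = 2%N by rewrite size_tuple dL.
case: (tval (vbasis L)) sL fL sz => [|a [|b [|//]]]// sL fab _.
have [n hn] := cross_neq0 fab; exists (cross a b); last first.
  by exists n; rewrite -det3_form gt_eqF.
move=> v; rewrite -sL span_cons span_seq1 -det3_form.
apply/idP/eqP => [/memv_addP[_ /vlineP[x ->]] [_ /vlineP[y ->]] ->|].
  by rewrite det3D !det3Z det3_uvu det3_uvv !mulr0 addr0.
move=> /(plane_coord fab)[x [y ->]].
by rewrite memv_add// memvZ// memv_line.
Qed.

Variable C : curve R.
Implicit Types x y z : 'I_(ncomp C) * R.

Lemma lift_regular i : regular (lift (c := C) i).
Proof.
split; [exact: lift_derivable|exact: lift_C1|exact: lift_immersion].
Qed.

Lemma posE x : pos x = lift x.1 x.2. Proof. by rewrite unlock. Qed.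
Lemma velE x : vel x = derive1 (lift x.1) x.2. Proof. by rewrite unlock. Qed.
Lemma teq_tdet x v : teq x v = tdet (lift x.1) x.2 v. Proof. by rewrite unlock. Qed.
Lemma betaE x v : beta x v = form (beta_form (lift x.1 x.2) (derive1 (lift x.1) x.2)) v.
Proof. by rewrite unlock. Qed.

Lemma pos_vel_free x : free [:: pos x; vel x].
Proof. by rewrite posE velE; exact: (regular_free (lift_regular x.1)). Qed.

Lemma tangent_mem x v : (v \in tangent x) = (teq x v == 0).
Proof. by rewrite teq_tdet; apply: mem_tangent; rewrite -posE -velE pos_vel_free. Qed.

Lemma point_le x U : (point x <= U)%VS = (pos x \in U).
Proof. by rewrite posE -memvE. Qed.

Lemma teqE x v : teq x v = form (cross (pos x) (vel x)) v.
Proof. by rewrite teq_tdet tdetE det3_form posE velE. Qed.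

Lemma teq_pos x : teq x (pos x) = 0.
Proof. by rewrite teq_tdet posE tdet_same. Qed.

Lemma teq_vel x : teq x (vel x) = 0.
Proof. by rewrite teqE -det3_form det3_uvv. Qed.

Lemma tangent_eqP x y : tangent x = tangent y <->
  exists2 c : R, c != 0 & forall v, teq x v = c * teq y v.
Proof.
split=> [E|[c c0 h]].
  have K v : (form (cross (pos y) (vel y)) v == 0) = (form (cross (pos x) (vel x)) v == 0).
    by rewrite -(teqE y v) -(teqE x v) -(tangent_mem x) -(tangent_mem y) E.
  have [c c0 h] := same_kernel K.
  by exists c; [exact: c0|move=> v; rewrite (teqE x v) (teqE y v) h].
apply/vspaceP => v; rewrite (tangent_mem x) (tangent_mem y) h mulf_eq0.
by rewrite (negbTE c0).
Qed.

Lemma tangent_eq x y : teq x (pos y) = 0 -> teq x (vel y) = 0 -> tangent x = tangent y.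
Proof.
move=> h1 h2; apply/tangent_eqP.
have [n hn] := cross_neq0 (pos_vel_free y).
have hn0 : det3 (pos y) (vel y) n != 0 by rewrite gt_eqF.
have E v : teq x v = teq x n / det3 (pos y) (vel y) n * teq y v.
  rewrite (teqE x v) {1}(cramer_div v hn0) !formD !formZ.
  rewrite -(teqE x (pos y)) -(teqE x (vel y)) -(teqE x n) h1 h2 !mulr0 !add0r.
  rewrite (_ : teq y v = det3 (pos y) (vel y) v); last by rewrite teqE -det3_form.
  by rewrite mulrAC [RHS]mulrAC (mulrC (det3 _ _ v)).
exists (teq x n / det3 (pos y) (vel y) n); last exact: E.
have [n' hn'] := cross_neq0 (pos_vel_free x).
by apply: contraTneq hn' => c0; rewrite det3_form -(teqE x n') E c0 mul0r ltxx.
Qed.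

Lemma tangent_eq_mem x y : tangent x = tangent y -> teq x (pos y) = 0 /\ teq x (vel y) = 0.
Proof.
by move=> /tangent_eqP[c _ h]; rewrite !h teq_pos teq_vel mulr0.
Qed.

Lemma pos_neq0 z : pos z != 0.
Proof.
have := pos_vel_free z; rewrite free_cons span_seq1 => /andP[+ _].
by apply: contraNneq => ->; rewrite mem0v.
Qed.

Lemma point_eqP x y : point x = point y <-> exists2 a : R, a != 0 & pos y = a *: pos x.
Proof.
have pE z : point z = <[pos z]>%VS by rewrite posE.
rewrite !pE; split=> [E|[a a0 h]].
  have /vlineP[a ha] : pos y \in <[pos x]>%VS by rewrite E memv_line.
  by exists a => //; apply: contraNneq (pos_neq0 y) => a0; rewrite ha a0 scale0r.
rewrite h; apply/vspaceP => v; apply/vlineP/vlineP => -[k ->].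
  by exists (k / a); rewrite scalerA divfK.
by exists (k * a); rewrite scalerA.
Qed.

Lemma beta_eq0 x y : teq x (pos y) = 0 -> beta x (pos y) = 0 -> point x = point y.
Proof.
rewrite teq_tdet betaE => F0 b0; have [a [b [E bE]]] := plane_beta (lift_regular x.1) F0.
have {}bE : b = 0 by apply/eqP; rewrite -sgz_eq0 -bE b0 sgz0.
have E' : pos y = a *: pos x by rewrite E bE scale0r addr0 posE.
apply/point_eqP; exists a; last exact: E'.
by apply: contraNneq (pos_neq0 y) => a0; rewrite E' a0 scale0r.
Qed.

Lemma locally_convex_at x : normalization C x ->
  exists em ep, locally_convex (lift (c := C) x.1) x.2 em ep.
Proof.
move=> nx; have [k [tau [t0 tk arcs]]] := lift_arcs x.1.
exact: (exists_locally_convex (lift_regular x.1) (@lift_closed _ C x.1) t0 tk arcs nx).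
Qed.

Lemma finite_zeros i l n : form l n != 0 ->
  finite_set [set t | 0 <= t < 1 /\ form l (lift (c := C) i t) = 0].
Proof.
move=> ln; have [k [tau [t0 tk arcs]]] := lift_arcs (c := C) i.
exact: (finite_form_zeros (lift_regular i) t0 tk arcs ln).
Qed.

(** The side of the tangent on which an arc lies is the sign of its convexity, so
    that the curve crosses its tangent when the signs before and after differ. *)
Lemma flexP x em ep : locally_convex (lift (c := C) x.1) x.2 em ep -> is_flex x <-> em * ep < 0.
Proof.
move=> [d d0 [cm cp]].
have l0 : x.2 - d < x.2 by rewrite ltrBlDr ltrDl.
have r0 : x.2 < x.2 + d by rewrite ltrDl.
have hl u : x.2 - d < u -> u < x.2 -> 0 < em * teq x (lift x.1 u).
  by move=> u1 u2; rewrite teq_tdet; apply: cm; rewrite ?lexx ?ltW// gt_eqF.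
have hr u : x.2 < u -> u < x.2 + d -> 0 < ep * teq x (lift x.1 u).
  by move=> u1 u2; rewrite teq_tdet; apply: cp; rewrite ?lexx ?ltW// lt_eqF.
split=> [[m em' [/near_left[a a0 ha] /near_right[b b0 hb]]]|emp].
  have [c c0 hc] := tangent_equation (regular_free (lift_regular x.1) x.2) em'.
  pose r := Num.min (Num.min a b) d / 2.
  have m0 : 0 < Num.min (Num.min a b) d by rewrite !lt_min a0 b0.
  have rp : 0 < r by rewrite divr_gt0.
  have rm : r < Num.min (Num.min a b) d by rewrite ltr_pdivrMr// ltr_pMr// ltr1n.
  move: rm; rewrite !lt_min => /andP[/andP[ra rb] rd].
  have u1 : x.2 - r < x.2 by rewrite ltrBlDr ltrDl.
  have u2 : x.2 < x.2 + r by rewrite ltrDl.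
  have := hl (x.2 - r); rewrite ltrD2l ltrN2 rd u1 => /(_ isT isT) k1.
  have := hr (x.2 + r); rewrite ltrD2l rd u2 => /(_ isT isT) k2.
  have := ha (x.2 - r); rewrite ltrD2l ltrN2 ra u1 hc => /(_ isT isT) k3.
  have := hb (x.2 + r); rewrite ltrD2l rb u2 hc => /(_ isT isT) k4.
  move: k1 k2 k3 k4; rewrite !teq_tdet.
  move: (tdet _ _ (lift x.1 (x.2 - r))) (tdet _ _ (lift x.1 (x.2 + r))) => p q k1 k2 k3 k4.
  have e1 : em * c < 0.
    have : em * p * (c * p) < 0 by rewrite pmulr_rlt0.
    rewrite mulrACA -expr2 pmulr_llt0// lt_neqAle eq_sym sqrf_eq0 sqr_ge0 andbT.
    by apply: contraTneq k1 => ->; rewrite mulr0 ltxx.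
  have e2 : 0 < ep * c.
    have : 0 < ep * q * (c * q) by rewrite mulr_gt0.
    rewrite mulrACA -expr2 pmulr_lgt0// lt_neqAle eq_sym sqrf_eq0 sqr_ge0 andbT.
    by apply: contraTneq k2 => ->; rewrite mulr0 ltxx.
  have c2 : 0 < c ^+ 2 by rewrite lt_neqAle eq_sym sqrf_eq0 c0 sqr_ge0.
  by rewrite -(pmulr_llt0 _ c2) expr2 mulrACA nmulr_rlt0.
exists (ep *: cross (pos x) (vel x)).
  move=> v; rewrite tangent_mem formZl -(teqE x v) mulf_eq0.
  by rewrite (negbTE (_ : ep != 0))//; apply: contraTneq emp => ->; rewrite mulr0 ltxx.
have mE v : form (ep *: cross (pos x) (vel x)) v = ep * teq x v by rewrite formZl (teqE x v).
split.
  apply/near_left; exists d => // u u1 u2; rewrite mE.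
  have := hl u u1 u2; move: (teq x _) => p hp.
  rewrite ltNge; apply/negP => h; have : 0 <= em * p * (ep * p) by rewrite mulr_ge0// ltW.
  rewrite mulrACA -expr2 leNgt nmulr_rlt0// lt_neqAle eq_sym sqrf_eq0 sqr_ge0 andbT.
  by move=> /negP; apply; apply: contraTneq hp => ->; rewrite mulr0 ltxx.
by apply/near_right; exists d => // u u1 u2; rewrite mE; exact: hr.
Qed.

Lemma convex_at x : normalization C x -> ~ is_flex x ->
  exists e d, 0 < d /\ convex_on (lift (c := C) x.1) e (x.2 - d) (x.2 + d).
Proof.
move=> nx nf; have [em [ep lc]] := locally_convex_at nx.
have [d d0 cv] : exists2 d, 0 < d & convex_on (lift (c := C) x.1) em (x.2 - d) (x.2 + d).
  apply: (locally_convex_join (lift_regular x.1) lc).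
  rewrite lt_neqAle eq_sym mulf_eq0 leNgt; apply/andP; split; last first.
    by apply/negP => h; apply: nf; exact/(flexP lc).
  case: lc => d d0 [cm cp]; apply/negP => /orP[]; apply/negP.
    by apply: (convex_neq0 _ cm); rewrite ltrBlDr ltrDl.
  by apply: (convex_neq0 _ cp); rewrite ltrDl.
by exists em, d.
Qed.

End Dictionary.

(** * The jumps at a pair of points *)

Section LocalData.
Variables (R : realType) (C : curve R) (Linf : {vspace 'rV[R]_3}) (l : 'cV[R]_3).
Hypothesis el : equation Linf l.
Hypothesis ln : exists n, form l n != 0.
Hypothesis hC : generic C.
Hypothesis hCL : generically_transverse C Linf.
Implicit Types x y z : 'I_(ncomp C) * R.

Lemma point_meet x (U : {vspace 'rV[R]_3}) : normalization C x -> pos x \in U -> meet C U x.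
Proof. by move=> nx h; split; rewrite ?point_le. Qed.

Lemma meetP x : normalization C x -> meet C Linf x <-> form l (pos x) = 0.
Proof.
move=> nx; split=> [[_]|h]; first by rewrite point_le el => /eqP.
by apply: point_meet => //; rewrite el h.
Qed.

Lemma meet_tangentP x y : normalization C y -> meet C (tangent x) y <-> teq x (pos y) = 0.
Proof.
move=> ny; split=> [[_]|h]; first by rewrite point_le tangent_mem => /eqP.
by apply: point_meet => //; rewrite tangent_mem h.
Qed.

Lemma meet_tangent_self x : normalization C x -> meet C (tangent x) x.
Proof. by move=> nx; apply/meet_tangentP => //; exact: teq_pos. Qed.

(** The curve crosses the line at infinity, as its tangent is another line. *)
Lemma vel_infinity x : normalization C x -> form l (pos x) = 0 -> form l (vel x) != 0.
Proof.
move=> nx h; apply/eqP => h'; apply: (not_tangent hCL nx).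
have [n hn] := cross_neq0 (pos_vel_free x).
have hn0 : det3 (pos x) (vel x) n != 0 by rewrite gt_eqF.
have E v : form l v = form l n / det3 (pos x) (vel x) n * teq x v.
  rewrite {1}(cramer_div v hn0) !formD !formZ h h' !mulr0 !add0r.
  rewrite (_ : teq x v = det3 (pos x) (vel x) v); last by rewrite teqE -det3_form.
  by rewrite mulrAC [RHS]mulrAC (mulrC (det3 _ _ v)).
have k0 : form l n / det3 (pos x) (vel x) n != 0.
  by have [n' hn'] := ln; apply: contraNneq hn' => k0; rewrite E k0 mul0r.
by apply/vspaceP => v; rewrite tangent_mem el E mulf_eq0 (negbTE k0).
Qed.

Lemma bitangent_of x y : normalization C x -> normalization C y -> x <> y ->
  tangent x = tangent y -> bitangents C (tangent x).
Proof. by move=> nx ny xy txy; exists x, y; exact: And5 nx ny xy erefl (esym txy). Qed.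

Lemma bitangent_affine x y : normalization C x -> normalization C y -> x <> y ->
  tangent x = tangent y -> form l (pos x) != 0.
Proof.
move=> nx ny xy txy; apply/eqP => /(meetP nx) mx.
exact: (meet_special hCL mx (or_introl (bitangent_of nx ny xy txy)) (meet_tangent_self nx).2).
Qed.

Lemma bitangent_nonflex x y : normalization C x -> normalization C y -> x <> y ->
  tangent x = tangent y -> ~ is_flex x.
Proof.
move=> nx ny xy txy fx.
exact: (flex_tangent_once hC (conj nx fx) ny xy (esym txy)).
Qed.

Lemma node_affine x y : normalization C x -> normalization C y -> x <> y ->
  point x = point y -> form l (pos x) != 0.
Proof.
move=> nx ny xy pxy; apply/eqP => /(meetP nx)[_ mx].
have np : nodes C (point x) by exists x, y; exact: And5 nx ny xy erefl (esym pxy).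
exact: (not_node hCL np mx).
Qed.

Lemma nonflex_through_infinity x y : normalization C x -> meet C Linf y ->
  meet C (tangent x) y -> ~ is_flex x.
Proof.
move=> nx my [_ yx] fx; apply: (meet_special hCL my _ yx); right.
by exists x; first exact: conj nx fx.
Qed.

Lemma not_bitangent_through_infinity x y : normalization C x -> meet C Linf y -> x <> y ->
  meet C (tangent x) y -> tangent x <> tangent y.
Proof.
move=> nx my xy [ny yx] txy; apply: (meet_special hCL my _ yx); left.
exact: bitangent_of nx ny xy txy.
Qed.

(** Two distinct points that lie on the tangents at each other span both tangents. *)
Lemma mutual_tangent x y : point x <> point y -> teq x (pos y) = 0 -> teq y (pos x) = 0 ->
  tangent x = tangent y.
Proof.
move=> pxy h1 h2; apply/esym/tangent_eq => //.
have [a [b E]] : exists a b, pos y = a *: pos x + b *: vel x.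
  by apply: plane_coord (pos_vel_free x) _; rewrite det3_form -teqE.
have b0 : b != 0.
  apply/eqP => b0; apply: pxy; apply/point_eqP; exists a; last by rewrite E b0 scale0r addr0.
  by apply: contraNneq (pos_neq0 y) => a0; rewrite E a0 b0 !scale0r addr0.
have := teq_pos y; rewrite teqE {2}E formD !formZ -!(teqE y) h2 mulr0 add0r.
by move=> /eqP; rewrite mulf_eq0 (negbTE b0) => /eqP.
Qed.

(** The tangent at [x] meets the line at infinity in [x] only, and the line at
    infinity contains no node. *)
Lemma infinity_unique x y : normalization C x -> normalization C y -> x <> y ->
  meet C Linf x -> meet C Linf y -> teq x (pos y) != 0.
Proof.
move=> nx ny xy /(meetP nx) lx /(meetP ny) ly; apply/eqP => h.
have [a [b E]] : exists a b, pos y = a *: pos x + b *: vel x.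
  by apply: plane_coord (pos_vel_free x) _; rewrite det3_form -teqE.
have b0 : b = 0.
  move/eqP: ly; rewrite E formD !formZ lx mulr0 add0r mulf_eq0.
  by rewrite (negbTE (vel_infinity nx lx)) orbF => /eqP.
have pxy : point x <> point y.
  by move=> /(node_affine nx ny xy); rewrite lx eqxx.
apply: pxy; apply/point_eqP; exists a; last by rewrite E b0 scale0r addr0.
by apply: contraNneq (pos_neq0 y) => a0; rewrite E a0 b0 !scale0r addr0.
Qed.

Lemma near_punctured (P : R -> Prop) (s : R) : (\forall u \near s^', P u) <->
  exists2 d, 0 < d & forall u, `|u - s| < d -> u != s -> P u.
Proof. exact: (near_ball (fun u => u != s -> P u) s). Qed.

Lemma sgz_inv (a : R) : sgz a^-1 = sgz a.
Proof.
have [a0|a0|->] := ltgtP a 0; last by rewrite invr0.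
  by rewrite !ltr0_sgz ?invr_lt0.
by rewrite !gtr0_sgz ?invr_gt0.
Qed.

Lemma side_sgz (l' m : 'cV[R]_3) v : sgz (side l' m v) = sgz (form m v) * sgz (form l' v).
Proof. by rewrite /side sgzM sgz_inv. Qed.

Lemma below_both (r r' : R) : 0 < r -> 0 < r' -> exists q, [/\ 0 < q, q < r & q < r'].
Proof.
move=> r0 r'0; exists (Num.min r r' / 2).
have m0 : 0 < Num.min r r' by rewrite lt_min r0.
have : Num.min r r' / 2 < Num.min r r' by rewrite ltr_pdivrMr// ltr_pMr// ltr1n.
by rewrite lt_min => /andP[? ?]; split=> //; rewrite divr_gt0.
Qed.

(** The arc at [x] lies on the side of its tangent given by [e], and the arc at [y] on
    the side given by [c eh], where [c] compares the two equations of the common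
    tangent; the values of [l] turn these signs of lifts into affine sides. *)
Lemma bitangent_signE x y e eh d c : normalization C x -> normalization C y -> x <> y ->
  tangent x = tangent y -> 0 < d ->
  convex_on (lift (c := C) x.1) e (x.2 - d) (x.2 + d) ->
  convex_on (lift (c := C) y.1) eh (y.2 - d) (y.2 + d) ->
  c != 0 -> (forall v, teq x v = c * teq y v) ->
  bitangent_sign C Linf (tangent x) =
    sgz e * sgz (c * eh) * sgz (form l (pos x)) * sgz (form l (pos y)).
Proof.
move=> nx ny xy txy d0 cx cy c0 hc.
have lx := bitangent_affine nx ny xy txy.
have ly : form l (pos y) != 0 := bitangent_affine ny nx (nesym xy) (esym txy).
have e0 : e != 0 by apply: (convex_neq0 _ cx); rewrite ltrD2l gtrN.
have eh0 : eh != 0 by apply: (convex_neq0 _ cy); rewrite ltrD2l gtrN.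
pose Sx := sgz e * sgz (form l (pos x)); pose Sy := sgz (c * eh) * sgz (form l (pos y)).
have nearS z (k : R) : k != 0 -> form l (pos z) != 0 ->
    (forall u, `|u - z.2| < d -> u != z.2 -> 0 < k * teq x (lift z.1 u)) ->
    exists2 r, 0 < r & forall u, `|u - z.2| < r -> u != z.2 ->
      sgz (teq x (lift z.1 u)) * sgz (form l (lift z.1 u)) = sgz k * sgz (form l (pos z)).
  move=> k0; rewrite posE => lz hz.
  have [r r0 hr] := form_sgz_const (lift_regular z.1) lz.
  exists (Num.min d r) => [|u]; first by rewrite lt_min d0.
  rewrite lt_min => /andP[ud ur] uz; rewrite (hr u ur) (sgz_mulK _ k0).
  by rewrite (gtr0_sgz (hz u ud uz)) mulr1.
have around z (k : R) : convex_on (lift (c := C) z.1) k (z.2 - d) (z.2 + d) ->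
    forall u, `|u - z.2| < d -> u != z.2 -> 0 < k * teq z (lift z.1 u).
  move=> cz u ud uz; rewrite teq_tdet; apply: cz; rewrite -?ler_distl.
  - by rewrite subrr normr0 ltW.
  - exact: ltW.
  - by rewrite eq_sym.
have c2 : 0 < c ^+ 2 by rewrite lt_neqAle eq_sym sqrf_eq0 c0 sqr_ge0.
have [rx rx0 hx] : exists2 r, 0 < r & forall u, `|u - x.2| < r -> u != x.2 ->
      sgz (teq x (lift x.1 u)) * sgz (form l (lift x.1 u)) = Sx.
  by apply: (nearS x e e0 lx) => u ud ux; exact: (around x e cx).
have [ry ry0 hy] : exists2 r, 0 < r & forall u, `|u - y.2| < r -> u != y.2 ->
      sgz (teq x (lift y.1 u)) * sgz (form l (lift y.1 u)) = Sy.
  apply: (nearS y (c * eh) (mulf_neq0 c0 eh0) ly) => u ud uy.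
  by rewrite hc mulrACA -expr2 (pmulr_rgt0 _ c2); exact: (around y eh cy).
have -> : sgz e * sgz (c * eh) * sgz (form l (pos x)) * sgz (form l (pos y)) = Sx * Sy.
  by rewrite /Sx /Sy; ring.
pose k := e * form l (pos x); have k0 : k != 0 by rewrite mulf_neq0.
pose m := k *: cross (pos x) (vel x).
have mE v : form m v = k * teq x v by rewrite formZl -(teqE x).
have em : equation (tangent x) m.
  by move=> v; rewrite tangent_mem mE mulf_eq0 (negbTE k0).
have Sk : sgz k = Sx by rewrite sgzM.
clearbody k.
have Sx2 : Sx * Sx = 1 by rewrite -Sk mulz_sg k0.
have Sy2 : Sy * Sy = 1 by rewrite /Sy mulrACA !mulz_sg ly mulf_neq0.
clearbody Sx Sy.
have two z : normalization C z -> tangent z = tangent x -> z = x \/ z = y.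
  move=> nz tz; apply: contrapT => /not_orP[zx zy].
  exact: (bitangent_twice hC nz nx ny zx xy zy (conj tz txy)).
rewrite /bitangent_sign.
have [S|S] := eqVneq Sx Sy.
- rewrite asboolT; first by rewrite -S Sx2.
  exists l, m; split; [exact: el|exact: em|move=> z nz tz; apply/near_punctured].
  have pos_side u z' : sgz (teq x (lift z'.1 u)) * sgz (form l (lift z'.1 u)) = Sx ->
      0 < side l m (lift (c := C) z'.1 u).
    by move=> h; rewrite -sgz_gt0 side_sgz mE sgzM -mulrA h Sk Sx2.
  have [->|->] := two z nz tz.
    by exists rx; [exact: rx0|move=> u u1 u2; apply: pos_side; exact: hx].
  by exists ry; [exact: ry0|move=> u u1 u2; apply: pos_side; rewrite S; exact: hy].
- have Sxy : Sx * Sy = -1.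
    have : (Sx * Sy) ^+ 2 = 1 by rewrite expr2 mulrACA Sx2 Sy2.
    move=> /eqP; rewrite sqrf_eq1 => /orP[/eqP h|/eqP //].
    by move/eqP: S; case; rewrite -[Sx]mulr1 -Sy2 mulrA h mul1r.
  rewrite Sxy asboolF; last first.
    move=> [l' [m' [el' em' h]]].
    have [k1 k10 hk1] : exists2 k1 : R, k1 != 0 & forall v, form l' v = k1 * form l v.
      by apply: same_kernel => v; rewrite -el -el'.
    have [k2 k20 hk2] : exists2 k2 : R, k2 != 0 & forall v, form m' v = k2 * form m v.
      by apply: same_kernel => v; rewrite -em -em'.
    have key z S' : normalization C z -> tangent z = tangent x ->
        (exists2 r, 0 < r & forall u, `|u - z.2| < r -> u != z.2 ->
          sgz (teq x (lift z.1 u)) * sgz (form l (lift z.1 u)) = S') ->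
        sgz k2 * sgz k1 * Sx * S' = 1.
      move=> nz tz [r r0 hr].
      have /near_punctured[r' r'0 hr'] := h z nz tz.
      have [q [q0 qr qr']] := below_both r0 r'0.
      have uz : z.2 + q != z.2 by rewrite -subr_eq0 addrAC subrr add0r (gt_eqF q0).
      have ud : `|z.2 + q - z.2| = q by rewrite addrAC subrr add0r (gtr0_norm q0).
      have := hr' (z.2 + q); rewrite ud => /(_ qr' uz)/gtr0_sgz.
      rewrite side_sgz hk2 hk1 mE !sgzM Sk.
      have := hr (z.2 + q); rewrite ud => /(_ qr uz) <-.
      by move=> <-; ring.
    have kx := key x Sx nx erefl (ex_intro2 _ _ rx rx0 hx).
    have ky := key y Sy ny (esym txy) (ex_intro2 _ _ ry ry0 hy).
    by move: kx ky; rewrite -!(mulrA (sgz k2 * sgz k1)) Sx2 Sxy mulr1 mulrN1 => ->.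
  rewrite asboolT; first by [].
  exists l, m; split; [exact: el|exact: em|exists x, y].
  split; [exact: nx|exact: ny|exact: erefl|exact: esym txy|split; apply/near_punctured].
    exists rx; [exact: rx0|move=> u u1 u2].
    by rewrite -sgz_gt0 side_sgz mE sgzM -mulrA (hx u u1 u2) Sk Sx2.
  exists ry; [exact: ry0|move=> u u1 u2].
  by rewrite -sgz_lt0 side_sgz mE sgzM -mulrA (hy u u1 u2) Sk Sxy.
Qed.

(** What happens at [x] on behalf of [y]: the jump of the count of the points near
    [y] on the moving tangent, plus, when [y] is at infinity, the jump of the height of
    [y].  With the height, the jump depends only on the incidences of [x] and [y] and on
    the sign of their bitangent. *)
Definition total_jump x y : int :=
  jump_table (flexes C) (meet C Linf) (fun z => meet C (tangent z))
    (@point R C) (@tangent R C) (bitangent_sign C Linf) x y.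

Lemma total_jumpE x y : total_jump x y =
  if x == y then - 2 * ind (flexes C x) + 2 * ind (meet C Linf x)
  else - 2 * ind (point x = point y)
    + 2 * (if `[< tangent x = tangent y >] then bitangent_sign C Linf (tangent x) else 0)
    + 2 * ind (meet C Linf x /\ meet C (tangent x) y)
    + 2 * ind (meet C Linf y /\ meet C (tangent y) x)
    - 2 * ind (meet C Linf x /\ meet C Linf y).
Proof. by []. Qed.

(** [wm], [wp] are the limits of the local count of the points near [y] when the
    tangency point tends to [x] from either side, and [km], [kp] those of the
    height of [y]. *)
Definition local_data x y (wm wp km kp : int) : Prop :=
  [/\ local_count (weight l (lift (c := C) x.1) (lift (c := C) y.1)) x.2 y.2 wm wp,
      teq x (pos y) != 0 -> wm = 0 /\ wp = 0,
      meet C Linf y ->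
        step_at (height_step l (lift (c := C) x.1) (lift (c := C) y.1) y.2) x.2 km kp,
      ~ meet C Linf y -> km = 0 /\ kp = 0 &
      wp - wm + (kp - km) = total_jump x y].

Lemma local_data_finite x y wm wp : normalization C y ->
  local_count (weight l (lift (c := C) x.1) (lift (c := C) y.1)) x.2 y.2 wm wp ->
  (teq x (pos y) != 0 -> wm = 0 /\ wp = 0) -> form l (pos y) != 0 ->
  wp - wm = total_jump x y -> exists wm wp km kp, local_data x y wm wp km kp.
Proof.
move=> ny h1 h2 h3 h4; exists wm, wp, 0, 0.
split; [exact: h1|exact: h2| |by []|by rewrite subrr addr0].
by move=> /(meetP ny) h; move: h3; rewrite h eqxx.
Qed.

Lemma not_meet x : normalization C x -> form l (pos x) != 0 -> ~ meet C Linf x.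
Proof. by move=> nx lx /(meetP nx) h; move: lx; rewrite h eqxx. Qed.

Lemma ind_meet0l x (P : Prop) : normalization C x -> form l (pos x) != 0 ->
  ind (meet C Linf x /\ P) = 0.
Proof. by move=> nx lx; apply: indF => -[/(not_meet nx lx)]. Qed.

Lemma ind_meet0r x (P : Prop) : normalization C x -> form l (pos x) != 0 ->
  ind (P /\ meet C Linf x) = 0.
Proof. by move=> nx lx; apply: indF => -[_ /(not_meet nx lx)]. Qed.

Lemma ind_tangent0 x y (P : Prop) : normalization C y -> teq x (pos y) != 0 ->
  ind (P /\ meet C (tangent x) y) = 0.
Proof. by move=> ny /eqP h; apply: indF => -[_ /(meet_tangentP x ny)]. Qed.

Lemma local_data_flex x : normalization C x -> is_flex x ->
  exists wm wp km kp, local_data x x wm wp km kp.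
Proof.
move=> nx fx; have rx := lift_regular (C := C) x.1.
have lx : form l (pos x) != 0.
  apply/eqP => /(meetP nx) mx.
  exact: (nonflex_through_infinity nx mx (meet_tangent_self nx) fx).
have [em [ep lc]] := locally_convex_at nx.
have lx' : form l (lift x.1 x.2) != 0 by rewrite -posE.
apply: (local_data_finite nx (count_flex rx lc ((flexP lc).1 fx) lx') _ lx).
  by rewrite teq_pos eqxx.
by rewrite total_jumpE eqxx (indT (conj nx fx)) (indF (not_meet nx lx)).
Qed.

Lemma local_data_nonflex x : normalization C x -> ~ is_flex x ->
  exists wm wp km kp, local_data x x wm wp km kp.
Proof.
move=> nx nf; have rx := lift_regular (C := C) x.1.
have [e [d [d0 cv]]] := convex_at nx nf.
have c0 := count_self l d0 cv.
have tj : total_jump x x = 2 * ind (meet C Linf x).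
  by rewrite total_jumpE eqxx (indF (fun f : flexes C x => nf f.2)) mulr0 add0r.
clear nf; have [lx|lx] := eqVneq (form l (pos x)) 0; last first.
  apply: (local_data_finite nx c0 _ lx); first by move=> _; split.
  by rewrite tj (indF (not_meet nx lx)) subrr mulr0.
have lx' := vel_infinity nx lx; have mx := (meetP nx).2 lx.
exists 0, 0, (-1), 1; split; [exact: c0|by move=> _; split| | |].
- by move=> _; apply: (height_self rx d0 cv); [rewrite -posE|rewrite -velE].
- by move=> /(_ mx).
- by rewrite tj (indT mx).
Qed.

Lemma total_jump_off x y : normalization C x -> normalization C y -> (x == y) = false ->
  teq x (pos y) != 0 ->
  total_jump x y = 2 * ind (meet C Linf y /\ meet C (tangent y) x)
    - 2 * ind (meet C Linf x /\ meet C Linf y).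
Proof.
move=> nx ny xyE Fxy.
have ntg : tangent x <> tangent y.
  by move=> /tangent_eq_mem[h _]; move: Fxy; rewrite h eqxx.
have npt : point x <> point y.
  move=> /point_eqP[a a0 h]; move/negP: Fxy; apply.
  by rewrite h teqE formZ -(teqE x) teq_pos mulr0.
rewrite total_jumpE xyE.
rewrite (indF npt).
rewrite (asboolF ntg).
rewrite (ind_tangent0 (meet C Linf x) ny Fxy).
clear.
by rewrite !mulr0 !add0r.
Qed.

Lemma local_data_off x y : normalization C x -> normalization C y -> x <> y ->
  teq x (pos y) != 0 -> exists wm wp km kp, local_data x y wm wp km kp.
Proof.
move=> nx ny /eqP xy Fxy.
have rx := lift_regular (C := C) x.1; have ry := lift_regular (C := C) y.1.
have Fxy' : tdet (lift x.1) x.2 (lift y.1 y.2) != 0 by rewrite -teq_tdet -posE.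
have tj := total_jump_off nx ny (negbTE xy) Fxy.
have c0 := count_off l rx ry Fxy'.
have [ly|ly] := eqVneq (form l (pos y)) 0; last first.
  apply: (local_data_finite ny c0 _ ly); first by move=> _; split.
  by rewrite tj (ind_meet0l _ ny ly) (ind_meet0r _ ny ly).
have my := (meetP ny).2 ly; have ly' := vel_infinity ny ly.
have lyE : form l (lift y.1 y.2) = 0 by rewrite -posE.
have lyE' : form l (derive1 (lift y.1) y.2) != 0 by rewrite -velE.
suff [km [kp [st jp]]] : exists km kp : int,
    step_at (height_step l (lift x.1) (lift y.1) y.2) x.2 km kp /\ kp - km = total_jump x y.
  exists 0, 0, km, kp; split; [exact: c0|by move=> _; split|by move=> _; exact: st|by move=> /(_ my)|].
  by rewrite subrr add0r.
have [Fyx|Fyx] := eqVneq (teq y (pos x)) 0.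
- have lx : form l (pos x) != 0.
    apply/eqP => /(meetP nx) mx.
    by have := infinity_unique ny nx (nesym (elimN eqP xy)) my mx; rewrite Fyx eqxx.
  have lx' : form l (lift x.1 x.2) != 0 by rewrite -posE.
  have Fyx' : tdet (lift y.1) y.2 (lift x.1 x.2) = 0 by rewrite -teq_tdet -posE.
  exists (-1), 1; split; first exact: (height_cross rx ry lyE lyE' Fxy' Fyx' lx').
  by rewrite tj (ind_meet0l _ nx lx) (indT (conj my ((meet_tangentP y nx).2 Fyx))).
- rewrite (ind_tangent0 _ nx Fyx) mulr0 add0r in tj.
  have Fyx' : tdet (lift y.1) y.2 (lift x.1 x.2) != 0 by rewrite -teq_tdet -posE.
  have [lx|lx] := eqVneq (form l (pos x)) 0.
    have lx' : form l (lift x.1 x.2) = 0 by rewrite -posE.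
    exists 1, (-1); split; first exact: (height_infinity rx lyE lyE' Fxy' Fyx' lx').
    by rewrite tj (indT (conj ((meetP nx).2 lx) my)).
  have lx' : form l (lift x.1 x.2) != 0 by rewrite -posE.
  eexists; eexists; split; first exact: (height_const rx Fxy' Fyx' lx').
  by rewrite subrr tj (ind_meet0l _ nx lx).
Qed.

Lemma local_data_node x y : normalization C x -> normalization C y -> x <> y ->
  point x = point y -> exists wm wp km kp, local_data x y wm wp km kp.
Proof.
move=> nx ny xy pxy.
have rx := lift_regular (C := C) x.1; have ry := lift_regular (C := C) y.1.
have lx := node_affine nx ny xy pxy.
have ly := node_affine ny nx (nesym xy) (esym pxy).
have ntg := node_transverse hC nx ny xy pxy.
have tj : total_jump x y = -2.
  rewrite total_jumpE (negbTE (introN eqP xy)) (indT pxy) (asboolF ntg).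
  by rewrite !(ind_meet0l _ nx lx) (ind_meet0l _ ny ly).
have [a a0 ha] := (point_eqP x y).1 pxy.
have Fxy : teq x (pos y) = 0 by rewrite ha teqE formZ -(teqE x) teq_pos mulr0.
have p0 : tdet (lift x.1) x.2 (derive1 (lift y.1) y.2) != 0.
  by rewrite -teq_tdet -velE; apply/eqP => h; exact: (ntg (tangent_eq Fxy h)).
rewrite !posE in ha; have lx' : form l (lift x.1 x.2) != 0 by rewrite -posE.
apply: (local_data_finite ny (count_node rx ry a0 ha p0 lx') _ ly).
  by rewrite Fxy eqxx.
by rewrite tj.
Qed.

Lemma local_data_bitangent x y : normalization C x -> normalization C y -> x <> y ->
  tangent x = tangent y -> exists wm wp km kp, local_data x y wm wp km kp.
Proof.
move=> nx ny xy txy.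
have rx := lift_regular (C := C) x.1; have ry := lift_regular (C := C) y.1.
have lx := bitangent_affine nx ny xy txy.
have ly := bitangent_affine ny nx (nesym xy) (esym txy).
have [c c0 hc] := (tangent_eqP x y).1 txy.
have Fxy : teq x (pos y) = 0 by rewrite hc teq_pos mulr0.
have npt : point x <> point y by move=> /(node_transverse hC nx ny xy); apply.
have b0 : beta x (pos y) != 0 by apply/eqP => h; exact: (npt (beta_eq0 Fxy h)).
have [e [d [d0 cx]]] := convex_at nx (bitangent_nonflex nx ny xy txy).
have [eh [d' [d'0 cy]]] := convex_at ny (bitangent_nonflex ny nx (nesym xy) (esym txy)).
have [q [q0 qd qd']] := below_both d0 d'0.
have {}cx : convex_on (lift (c := C) x.1) e (x.2 - q) (x.2 + q).
  by apply: convex_on_sub cx; rewrite lerD2l ?lerN2 (ltW qd).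
have {}cy : convex_on (lift (c := C) y.1) eh (y.2 - q) (y.2 + q).
  by apply: convex_on_sub cy; rewrite lerD2l ?lerN2 (ltW qd').
have tj : total_jump x y = 2 * (sgz e * sgz (c * eh) * sgz (form l (pos x)) * sgz (form l (pos y))).
  rewrite total_jumpE (negbTE (introN eqP xy)) (indF npt) (asboolT txy).
  rewrite !(ind_meet0l _ nx lx) (ind_meet0l _ ny ly).
  by rewrite (bitangent_signE nx ny xy txy q0 cx cy c0 hc) !mulr0 add0r !addr0.
have hc' v : tdet (lift x.1) x.2 v = c * tdet (lift y.1) y.2 v.
  by rewrite -(teq_tdet x) -(teq_tdet y).
clear npt txy.
have lx' : form l (lift x.1 x.2) != 0 by rewrite -posE.
have ly' : form l (lift y.1 y.2) != 0 by rewrite -posE.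
have b0' : form (beta_form (lift x.1 x.2) (derive1 (lift x.1) x.2)) (lift y.1 y.2) != 0.
  by rewrite -betaE -posE.
have lc := count_bitangent rx ry q0 cx cy c0 hc' b0' lx' ly'.
apply: (local_data_finite ny lc _ ly); first by rewrite Fxy eqxx.
rewrite tj !posE; clear tj lc hc' hc lx ly Fxy; move: b0'.
move: (form l _) (form l _) (form (beta_form _ _) _) => p1 p2 b b0'.
have bb : sgz b * sgz b = 1 by rewrite mulz_sg b0'.
transitivity (2 * (sgz b * sgz b) * (sgz e * sgz (c * eh) * sgz p2 * sgz p1)); last by rewrite bb mulr1.
by ring.
Qed.

Lemma local_data_transversal x y : normalization C x -> normalization C y -> x <> y ->
  point x <> point y -> tangent x <> tangent y -> teq x (pos y) = 0 ->
  exists wm wp km kp, local_data x y wm wp km kp.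
Proof.
move=> nx ny xy npt ntg Fxy.
have rx := lift_regular (C := C) x.1; have ry := lift_regular (C := C) y.1.
have off : teq x (pos y) != 0 -> forall wm wp : int, wm = 0 /\ wp = 0.
  by rewrite Fxy eqxx.
have tFxy : tdet (lift x.1) x.2 (lift y.1 y.2) = 0 by rewrite -teq_tdet -posE.
have b0 : beta x (pos y) != 0 by apply/eqP => h; exact: (npt (beta_eq0 Fxy h)).
have b0' : form (beta_form (lift x.1 x.2) (derive1 (lift x.1) x.2)) (lift y.1 y.2) != 0.
  by rewrite -betaE -posE.
have p0 : tdet (lift x.1) x.2 (derive1 (lift y.1) y.2) != 0.
  by rewrite -teq_tdet -velE; apply/eqP => h; exact: (ntg (tangent_eq Fxy h)).
have Fyx : teq y (pos x) != 0 by apply/eqP => h; exact: (ntg (mutual_tangent npt Fxy h)).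
have tj : total_jump x y = 2 * ind (meet C Linf x) - 2 * ind (meet C Linf x /\ meet C Linf y).
  rewrite total_jumpE (negbTE (introN eqP xy)) (indF npt) (asboolF ntg).
  rewrite (ind_tangent0 _ nx Fyx) !mulr0 !add0r addr0; congr (2 * _ - _).
  have myx := (meet_tangentP x ny).2 Fxy.
  by rewrite /ind; congr (if _ then _ else _); apply: asbool_equiv_eq; split=> [[h _]|h]; [exact: h|exact: conj h myx].
clear npt ntg.
have [lx|lx] := eqVneq (form l (pos x)) 0.
- have mx := (meetP nx).2 lx; have lx' := vel_infinity nx lx.
  have ly : form l (pos y) != 0.
    apply/eqP => /(meetP ny) my.
    by have := infinity_unique nx ny xy mx my; rewrite Fxy eqxx.
  rewrite posE in lx; rewrite velE in lx'.
  have ly' : form l (lift y.1 y.2) != 0 by rewrite -posE.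
  apply: (local_data_finite ny (count_source_infinity rx ry tFxy p0 b0' lx lx') _ ly).
    by move=> /off; apply.
  by rewrite tj (indT mx) (ind_meet0r _ ny ly).
rewrite (ind_meet0l _ nx lx) (indF (not_meet nx lx)) in tj.
have lx' : form l (lift x.1 x.2) != 0 by rewrite -posE.
have [ly|ly] := eqVneq (form l (pos y)) 0.
- have my := (meetP ny).2 ly; have ly' := vel_infinity ny ly.
  have myx := (meet_tangentP x ny).2 Fxy.
  have [e [d [d0 cx]]] := convex_at nx (nonflex_through_infinity nx my myx).
  rewrite posE in ly; rewrite velE in ly'.
  have [j lc st] := height_fold rx ry ly ly' d0 cx tFxy p0 b0' lx'.
  exists (- j), j, j, (- j); split; [exact: lc|by move=> /off; apply|by []|by move=> /(_ my)|].
  by rewrite tj; ring.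
have ly' : form l (lift y.1 y.2) != 0 by rewrite -posE.
have [w lc] := count_transversal rx ry tFxy p0 b0' lx' ly'.
apply: (local_data_finite ny lc _ ly); first by move=> /off; apply.
by rewrite tj subrr.
Qed.

Lemma local_data_exists x y : normalization C x -> normalization C y ->
  exists wm wp km kp, local_data x y wm wp km kp.
Proof.
move=> nx ny; have [->|/eqP xy] := eqVneq x y.
  have [fy|fy] := pselect (is_flex y); first exact: local_data_flex.
  exact: local_data_nonflex.
have [h|h] := eqVneq (teq x (pos y)) 0; last exact: local_data_off.
have [pxy|npt] := pselect (point x = point y); first exact: local_data_node.
have [txy|ntg] := pselect (tangent x = tangent y); first exact: local_data_bitangent.
exact: local_data_transversal.
Qed.

End LocalData.

(** * Sum of the jumps *)

Section Periodicity.
Variable R : realType.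
Variables (l : 'cV[R]_3) (g h : R -> 'rV[R]_3).
Hypotheses (rg : regular g) (rh : regular h).
Hypothesis gclosed : forall t, lift_point g (t + 1) = lift_point g t.
Hypothesis hclosed : forall t, lift_point h (t + 1) = lift_point h t.

Lemma sgz_pos_mul (a b : R) : 0 < a -> sgz (a * b) = sgz b.
Proof. by move=> a0; rewrite sgzM gtr0_sgz// mul1r. Qed.

Lemma even_gt0 (c : R) n : c != 0 -> 0 < c ^+ n.*2.
Proof.
by move=> c0; rewrite -muln2 exprM lt_neqAle eq_sym sqrf_eq0 expf_neq0// sqr_ge0.
Qed.

Lemma tdet_zero_periodic s t : (tdet g s (h (t + 1)) == 0) = (tdet g s (h t) == 0).
Proof.
have [c c0 [-> _ _]] := tdet_shift rh hclosed t.
by rewrite tdetE det3Z -tdetE mulf_eq0 (negbTE c0).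
Qed.

(** The lift at [t + 1] is a multiple of the lift at [t]; the factor enters an even
    number of times. *)
Lemma weight_periodic s t : weight l g h s (t + 1) = weight l g h s t.
Proof.
rewrite /weight tdet_zero_periodic; have [c c0 [-> _ _]] := tdet_shift rh hclosed t.
case: ifP => // _; rewrite !formZ -[RHS](sgz_pos_mul _ (even_gt0 1 c0)).
by congr sgz; ring.
Qed.

Lemma weight_periodic_source s t : weight l g h (s + 1) t = weight l g h s t.
Proof.
rewrite /weight; have [c c0 [-> E1 E2]] := tdet_shift rg gclosed s.
rewrite E1 E2 mulf_eq0 expf_eq0 (negbTE c0) /=.
case: ifP => // _; rewrite !formZ -[RHS](sgz_pos_mul _ (even_gt0 2 c0)).
by congr sgz; ring.
Qed.

Lemma height_periodic t s : height_step l g h t (s + 1) = height_step l g h t s.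
Proof.
rewrite /height_step; have [c c0 [-> E1 _]] := tdet_shift rg gclosed s.
rewrite E1 formZ !tdetE det3Z -!tdetE -[RHS](sgz_pos_mul _ (even_gt0 2 c0)).
by congr sgz; ring.
Qed.

End Periodicity.

Section StepSums.
Variable R : realType.
Implicit Types (f : R -> int).

Lemma step_at_add f g (s0 : R) a b c d : step_at f s0 a b -> step_at g s0 c d ->
  step_at (fun s => f s + g s) s0 (a + c) (b + d).
Proof.
by apply: filterS2 => s h1 h2 ss0; rewrite h1// h2//; case: ifP.
Qed.

Lemma step_at_sum (T : eqType) (r : seq T) (f : T -> R -> int) (a b : T -> int) (s0 : R) :
  (forall x, x \in r -> step_at (f x) s0 (a x) (b x)) ->
  step_at (fun s => \sum_(x <- r) f x s) s0 (\sum_(x <- r) a x) (\sum_(x <- r) b x).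
Proof.
elim: r => [|x r IH] h.
  by apply: filterE => s _; rewrite !big_nil if_same.
have h1 := h x (mem_head _ _).
have h2 : step_at (fun s => \sum_(x <- r) f x s) s0 (\sum_(x <- r) a x) (\sum_(x <- r) b x).
  by apply: IH => y yr; apply: h; rewrite in_cons yr orbT.
have := step_at_add h1 h2; rewrite /step_at; apply: filterS => s hs /hs.
by rewrite !big_cons.
Qed.

Lemma pair_sum n (I : set R) (f : 'I_n * R -> int) :
  finite_set (supp_in f [set y | I y.2]) ->
  \sum_(y \in [set y : 'I_n * R | I y.2]) f y = \sum_(j < n) \sum_(t \in I) f (j, t).
Proof.
move=> fin; pose T := snd @` supp_in f [set y | I y.2].
have finT : finite_set T by exact: finite_image.
have TI : T `<=` I by move=> _ [y [Iy _] <-].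
have out j t : I t -> ~ T t -> f (j, t) = 0.
  move=> It nT; apply/eqP; apply: contrapT => /negP/eqP fjt; apply: nT.
  by exists (j, t).
transitivity (\sum_(y \in [set: 'I_n] `*` T) f y).
  apply/esym/fsbig_widen; first by move=> [j t] [_ /TI].
  by move=> [j t] [/= It nT]; apply: out => // Tt; apply: nT.
transitivity (\sum_(j \in [set: 'I_n]) \sum_(t \in T) f (j, t)).
  rewrite pair_fsbig; [|exact: finite_finset|exact: finT].
  by apply: eq_fsbigr => -[j t] _.
transitivity (\sum_(j \in [set: 'I_n]) \sum_(t \in I) f (j, t)).
  apply: eq_fsbigr => j _; apply: fsbig_widen => // t [It nT]; exact: out.
rewrite (fsbigE (enum 'I_n)) ?enum_uniq//; last by move=> j _; rewrite mem_enum.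
by rewrite big_enum_cond; apply: eq_bigl => j; rewrite in_setT.
Qed.

End StepSums.

Section TotalJump.
Variables (R : realType) (C : curve R) (Linf : {vspace 'rV[R]_3}) (l : 'cV[R]_3).
Hypothesis el : equation Linf l.
Hypothesis ln : exists n, form l n != 0.
Hypothesis hC : generic C.
Hypothesis hCL : generically_transverse C Linf.
Implicit Types x y z : 'I_(ncomp C) * R.
Let I := [set t : R | 0 <= t < 1].
Let norm := normalization C.

Lemma finite_form_points (m : 'cV[R]_3) n : form m n != 0 ->
  finite_set [set x : 'I_(ncomp C) * R | norm x /\ form m (pos x) = 0].
Proof.
move=> mn; apply: (@sub_finite_set _ _ (\bigcup_(i in [set: 'I_(ncomp C)])
  ((fun t => (i, t)) @` [set t | 0 <= t < 1 /\ form m (lift (c := C) i t) = 0]))).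
  move=> [i t] [/= nx]; rewrite posE => h; exists i; first by [].
  by exists t; first exact: conj nx h.
apply: bigcup_finite => [|i _]; first exact: finite_finset.
by apply: finite_image; exact: finite_zeros mn.
Qed.

Lemma finite_meet_tangent x : finite_set (meet C (tangent x)).
Proof.
have [n hn] := cross_neq0 (pos_vel_free x).
have hn0 : form (cross (pos x) (vel x)) n != 0 by rewrite -det3_form gt_eqF.
apply: sub_finite_set (finite_form_points hn0) => y [ny yx]; split; first exact: ny.
by rewrite -(teqE x); apply/meet_tangentP; [exact: ny|split; [exact: ny|exact: yx]].
Qed.

Lemma finite_meet_infinity : finite_set (meet C Linf).
Proof.
have [n hn] := ln; apply: sub_finite_set (finite_form_points hn) => y my.
by split; [exact: my.1|exact/(meetP el my.1).1].
Qed.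

(** On each component, the count of the points of the whole curve on the moving
    tangent plus the heights of all the points at infinity is a periodic step
    function, whose jump at [x] is the sum of [total_jump x y] over [y]. *)
Lemma total_jump_sum :
  \sum_(x \in norm) \sum_(y \in norm) total_jump Linf x y = 0.
Proof.
have finM := finite_meet_infinity.
have [D hD] : exists D : ('I_(ncomp C) * R) -> ('I_(ncomp C) * R) -> int * int * int * int,
    forall x y, norm x -> norm y ->
    local_data Linf l x y (D x y).1.1.1 (D x y).1.1.2 (D x y).1.2 (D x y).2.
  have : forall p : ('I_(ncomp C) * R) * ('I_(ncomp C) * R), exists q : int * int * int * int,
      norm p.1 -> norm p.2 -> local_data Linf l p.1 p.2 q.1.1.1 q.1.1.2 q.1.2 q.2.
    move=> [x y]; have [[nx ny]|h] := pselect (norm x /\ norm y); last first.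
      by exists (0, 0, 0, 0) => nx ny; case: h; exact: conj nx ny.
    have [wm [wp [km [kp h]]]] := local_data_exists el ln hC hCL nx ny.
    by exists (wm, wp, km, kp) => _ _; exact: h.
  move=> /choice[D hD]; exists (fun x y => D (x, y)) => x y; exact: (hD (x, y)).
pose wm x y := if teq x (pos y) == 0 then (D x y).1.1.1 else 0.
pose wp x y := if teq x (pos y) == 0 then (D x y).1.1.2 else 0.
pose km x y := (D x y).1.2; pose kp x y := (D x y).2.
pose M := fset_set (meet C Linf).
have MP y : y \in M -> meet C Linf y.
  by rewrite in_fset_set// inE.
pose G i s := \sum_(j < ncomp C) \sum_(t \in I) weight l (lift (c := C) i) (lift (c := C) j) s t +
  \sum_(y <- M) height_step l (lift (c := C) i) (lift (c := C) y.1) y.2 s.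
pose L (w k : ('I_(ncomp C) * R) -> ('I_(ncomp C) * R) -> int) (i : 'I_(ncomp C)) s :=
  \sum_(j < ncomp C) \sum_(t \in I) w (i, s) (j, t) + \sum_(y <- M) k (i, s) y.
have st i s : 0 <= s < 1 -> step_at (G i) s (L wm km i s) (L wp kp i s).
  move=> hs; have nx : norm (i, s) by exact: hs.
  apply: step_at_add; last first.
    apply: step_at_sum => y /MP my; have [_ _ h _ _] := hD (i, s) y nx my.1.
    exact: h.
  apply: step_at_sum => j _.
  apply: (@count_limit _ (fun s t => tdet (lift (c := C) i) s (lift (c := C) j t))).
  - by move=> t; apply: cvg_tdet_box; [exact: lift_regular|apply: regular_continuous; exact: lift_regular].
  - by move=> s' t; apply: tdet_zero_periodic; [exact: lift_regular|exact: lift_closed].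
  - by move=> s' t; apply: weight_periodic; [exact: lift_regular|exact: lift_closed].
  - by move=> s' t /negbTE h; rewrite /weight h.
  - move=> s'; have [n hn] := cross_neq0 (regular_free (lift_regular i) s').
    have hn0 : form (cross (lift (c := C) i s') (derive1 (lift i) s')) n != 0.
      by rewrite -det3_form gt_eqF.
    apply: sub_finite_set (finite_zeros j hn0) => t [tI h]; split; first exact: tI.
    by rewrite -det3_form -tdetE.
  - move=> t tI h; have ny : norm (j, t) by exact: tI.
    have [lc _ _ _ _] := hD (i, s) (j, t) nx ny.
    have e : (teq (i, s) (pos (j, t)) == 0) = true by rewrite teq_tdet posE /= h eqxx.
    by rewrite /wm /wp e; exact: lc.
  - by move=> t h; rewrite /wm teq_tdet posE /= (negbTE h).
  - by move=> t h; rewrite /wp teq_tdet posE /= (negbTE h).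
have per i s : G i (s + 1) = G i s.
  rewrite /G; congr (_ + _); apply: eq_bigr => j _.
    apply: eq_fsbigr => t _; apply: weight_periodic_source; [exact: lift_regular|exact: lift_closed].
  apply: height_periodic; [exact: lift_regular|exact: lift_closed].
have key x : norm x -> L wp kp x.1 x.2 - L wm km x.1 x.2 = \sum_(y \in norm) total_jump Linf x y.
  case: x => i s nx; pose x := (i, s); rewrite -/x in nx *.
  pose Y := meet C (tangent x) `|` meet C Linf.
  have finY : finite_set Y.
    by rewrite finite_setU; split; [exact: finite_meet_tangent|exact: finM].
  have Ynorm : Y `<=` norm by move=> y [[]|[]].
  have offY y : norm y -> ~ Y y -> teq x (pos y) != 0 /\ ~ meet C Linf y.
    move=> ny nY; split; last by move=> my; apply: nY; right.
    by apply/eqP => h; apply: nY; left; apply/meet_tangentP.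
  have sumw (w : ('I_(ncomp C) * R) -> int) : (forall y, teq x (pos y) != 0 -> w y = 0) ->
      \sum_(j < ncomp C) \sum_(t \in I) w (j, t) = \sum_(y <- fset_set Y) w y.
    move=> w0; rewrite -pair_sum; last first.
      apply: sub_finite_set (finite_meet_tangent x) => y [/= ny wy].
      apply/meet_tangentP; first exact: ny.
      by apply/eqP; apply: contrapT => /negP /w0.
    rewrite -fsbig_finite//; apply/esym/fsbig_widen; first exact: Ynorm.
    by move=> y [/= ny nY]; apply: w0; exact: (offY y ny nY).1.
  have sumk (k : ('I_(ncomp C) * R) -> int) : (forall y, norm y -> ~ meet C Linf y -> k y = 0) ->
      \sum_(y <- M) k y = \sum_(y <- fset_set Y) k y.
    move=> k0; rewrite /M -!fsbig_finite//; apply: fsbig_widen.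
      by move=> y my; right.
    by move=> y [/= Yy nm]; apply: k0; [exact: Ynorm|exact: nm].
  have h0 y : norm y -> ~ meet C Linf y -> km x y = 0 /\ kp x y = 0.
    by move=> ny nm; have [_ _ _ h _] := hD x y nx ny; exact: h.
  have wm0 y : teq x (pos y) != 0 -> wm x y = 0 by rewrite /wm => /negbTE ->.
  have wp0 y : teq x (pos y) != 0 -> wp x y = 0 by rewrite /wp => /negbTE ->.
  rewrite /L /= -/x (sumw (wp x) wp0) (sumw (wm x) wm0).
  rewrite (sumk (kp x) (fun y ny nm => (h0 y ny nm).2)) (sumk (km x) (fun y ny nm => (h0 y ny nm).1)).
  rewrite -(@fsbig_widen _ _ _ _ Y norm)//; last first.
    move=> y [/= ny nY]; have [F0 nm] := offY y ny nY.
    have [_ h1 _ h2 <-] := hD x y nx ny.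
    by have [-> ->] := h1 F0; have [-> ->] := h2 nm.
  rewrite fsbig_finite// -!big_split -sumrB /=; apply: eq_big_seq => y.
  rewrite in_fset_set// inE => Yy; have ny := Ynorm y Yy.
  have [_ h1 _ _ <-] := hD x y nx ny.
  rewrite /wm /wp /km /kp; case: eqP => [_|/eqP /h1 [-> ->]]; ring.
pose phi x := \sum_(y \in norm) total_jump Linf x y.
have keyi i s : I s -> L wp kp i s - L wm km i s = phi (i, s).
  by move=> hs; exact: (key (i, s)).
rewrite (@pair_sum _ _ I phi); last first.
  apply: (@sub_finite_set _ _ (\bigcup_(i in [set: 'I_(ncomp C)]) ((fun t => (i, t)) @`
     supp_in (fun s => L wp kp i s - L wm km i s) I))).
    move=> [i s] [/= hs ph]; exists i => //; exists s => //; split; first exact: hs.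
    by rewrite /= keyi.
  apply: bigcup_finite => [|i _]; first exact: finite_finset.
  by apply: finite_image; exact: (step_circle (per i) (st i)).1.
apply: big1 => i _; rewrite -[RHS](step_circle (per i) (st i)).2.
by apply: eq_fsbigr => s; rewrite inE => hs; rewrite keyi.
Qed.

End TotalJump.

(** * The signed count of bitangents *)

(** No two points at infinity share their tangent, which would be a bitangent
    meeting [C] at infinity. *)
Lemma tangent_inj_infinity (R : realType) (C : curve R) (Linf : {vspace 'rV[R]_3}) :
  generically_transverse C Linf -> set_inj (meet C Linf) (@tangent R C).
Proof.
move=> hCL x y; rewrite !inE => mx my txy; apply: contrapT => xy.
exact: (not_bitangent_through_infinity hCL mx.1 my xy
  (conj my.1 (etrans (f_equal (fun V => (point y <= V)%VS) txy) (meet_tangent_self my.1).2)) txy).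
Qed.

Theorem theorem3p2 (R : realType) (Linf : {vspace 'rV[R]_3}) (C : curve R)
  (hLinf : \dim Linf = 2%N) (hC : generic C)
  (hCL : generically_transverse C Linf) :
  let n : nat := #|` fset_set (nodes C)| in
  let i : nat := #|` fset_set (flexes C)| in
  let a : nat := nmeet C Linf in
  ((sigma C Linf)%:~R : rat) =
    n%:R + i%:R / 2 + a%:R * (a%:R - 2) / 2
    - \sum_(T \in tangents_at C Linf) ((nmeet C T)%:R - 1 : rat).
Proof.
have [l el ln] := line_equation hLinf.
move=> n i a.
have finM : finite_set (meet C Linf) := finite_meet_infinity C el ln.
have -> : \sum_(T \in tangents_at C Linf) ((nmeet C T)%:R - 1 : rat)
    = (\sum_(x \in meet C Linf) ((nmeet C (tangent x))%:Z - 1))%:~R.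
  rewrite /tangents_at fsbig_image; last exact: tangent_inj_infinity.
  rewrite !fsbig_finite// rmorph_sum; apply: eq_bigr => x _.
  by rewrite rmorphB /= -pmulrn.
have F1 : flexes C `<=` normalization C by move=> x [].
have M1 : meet C Linf `<=` normalization C by move=> x [].
have B1 (x : 'I_(ncomp C) * R) : meet C (tangent x) `<=` normalization C by move=> y [].
have B2 (x : 'I_(ncomp C) * R) : meet C Linf x -> meet C (tangent x) x.
  by move=> mx; exact: meet_tangent_self mx.1.
have := total_jump_sum el ln hC hCL.
rewrite (@sum_jump_table _ _ (normalization C) (flexes C) (meet C Linf)
  (fun x => meet C (tangent x)) (@point R C) (@tangent R C) (bitangent_sign C Linf)
  F1 M1 B1 (finite_flexes hC) finM (@finite_meet_tangent _ C) B2 (finite_nodes hC)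
  (finite_bitangents hC) (node_double hC) (bitangent_twice hC)).
change (\sum_(d \in _) bitangent_sign C Linf d) with (sigma C Linf).
change (#|` fset_set (doubles _ _)|) with n.
change (#|` fset_set (flexes C)|) with i.
change (#|` fset_set (meet C Linf)|) with a.
change (\sum_(x \in meet C Linf) (#|` _|%:Z - 1))
  with (\sum_(x \in meet C Linf) ((nmeet C (tangent x))%:Z - 1)).
move: (sigma C Linf) (\sum_(x \in _) _) => sg S; clearbody n i a => E.
have /= := congr1 (fun z : int => z%:~R : rat) E.
rewrite !(rmorphD, rmorphN, rmorphB, rmorphM) /= -!pmulrn.
lra.
Qed.
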